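(* Let $T_N$ be the $N\times N$ nilpotent matrix with $T_N(i,i+1)=1$ for $1\le i\le N-1$ and all other entries equal to $0$, and let $G_N$ be a sequence of polynomially vanishing Gaussian matrices. Then $L_N^{T+G}$ converges weakly, in probability, as $N\to\infty$, toward the uniform measure on the unit circle in $\mathbb C$.
   Context: $L_N^{T+G}:=\frac1N\sum_{i=1}^N\delta_{\lambda_i(T_N+G_N)}$ is the empirical measure of the eigenvalues $\lambda_i(T_N+G_N)$ of $T_N+G_N$. A sequence of $N\times N$ random Gaussian matrices $G_N$ is polynomially vanishing if its entries $G_N(i,j)$ are independent centered complex Gaussian variables and there exist $\kappa>0$ and $\kappa'\ge 1+\kappa$ (independent of $N$) such that $N^{-\kappa'}\le E|G_N(i,j)|^2\le N^{-1-\kappa}$ for all $i,j$ and $N$. *)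

(* Defs.v *)
From HB Require Import structures.
From mathcomp Require Import all_boot all_order all_algebra.
From mathcomp Require Import complex.
From mathcomp Require Import all_classical all_reals all_analysis.
From mathcomp Require Import measurable_realfun.

Set Implicit Arguments.
Unset Strict Implicit.
Unset Printing Implicit Defensive.

Import Order.TTheory GRing.Theory Num.Theory.
Import numFieldNormedType.Exports.

Local Open Scope classical_set_scope.
Local Open Scope complex_scope.
Local Open Scope ring_scope.

(* Measures on C are measures on R * R, whose product sigma-algebra and product
   topology are the Borel sigma-algebra and the usual topology of C. *)
Definition cpair (R : realType) (z : R[i]) : R * R :=
  (complex.Re z, complex.Im z).

(* The roots of the characteristic polynomial, listed with multiplicity; the
   list has length n since char_poly A is monic of degree n. *)
Definition eigenvalues (R : realType) (n : nat) (A : 'M[R[i]]_n) : seq R[i] :=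
  sval (closed_field_poly_normal (char_poly A)).

Definition empirical_measure (R : realType) (n : nat) (A : 'M[R[i]]_n) :
    {measure set (R * R) -> \bar R} :=
  mscale (n%:R^-1)%:nng
    (msum (fun k => \d_(cpair (nth 0 (eigenvalues A) k))) n).

Section circle.
Variable R : realType.

Definition circle_param (t : measurableTypeR R) : R * R := (cos t, sin t).

Lemma measurable_circle_param : measurable_fun [set: measurableTypeR R] circle_param.
Proof.
apply: measurable_fun_pair; apply: continuous_measurable_fun.
- exact: continuous_cos.
- exact: continuous_sin.
Qed.

HB.instance Definition _ :=
  isMeasurableFun.Build _ _ _ _ circle_param measurable_circle_param.

Lemma two_pi_gt0 : 0 < 2 * pi :> R.
Proof. by rewrite mulr_gt0 ?pi_gt0. Qed.

Definition uniform_circle : probability (R * R)%type R :=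
  distribution (uniform_prob two_pi_gt0) circle_param.

End circle.

Definition mutually_independent d d' (T : measurableType d)
    (T' : measurableType d') (R : realType) (P : probability T R)
    (I : finType) (X : I -> T -> T') : Prop :=
  forall (J : {set I}) (B : I -> set T'), (forall i, measurable (B i)) ->
    P (\bigcap_(i in [set` J]) (X i @^-1` B i)) =
    (\prod_(i in J) P (X i @^-1` B i))%E.

(* N(0, s^2), where normal_prob is only the normal law for s != 0. *)
Definition centered_normal (R : realType) (s : R) : set R -> \bar R :=
  if s == 0 then \d_(0 : R) else normal_prob 0 s.

(* (Re Z, Im Z) is a centered, possibly degenerate, Gaussian vector: every real
   linear combination of its coordinates is a centered normal variable.  The
   circularly symmetric and the real Gaussian variables are special cases. *)
Definition centered_complex_gaussian d (T : measurableType d) (R : realType)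
    (P : probability T R) (Z : T -> R[i]) : Prop :=
  measurable_fun [set: T] (fun w => cpair (Z w)) /\
  forall a b : R, exists s : R, forall A : set R, measurable A ->
    P ((fun w => a * complex.Re (Z w) + b * complex.Im (Z w)) @^-1` A) =
    centered_normal s A.

(* Each N has its own probability space: nothing is assumed on the joint law of
   the matrices for different N. *)
Definition polynomially_vanishing (R : realType) (d : nat -> measure_display)
    (T : forall N : nat, measurableType (d N))
    (P : forall N : nat, probability (T N) R)
    (G : forall N : nat, T N -> 'M[R[i]]_N) : Prop :=
  (forall N : nat,
     (forall i j : 'I_N,
        centered_complex_gaussian (P N) (fun w => G N w i j)) /\
     mutually_independent (P N)
       (fun (ij : 'I_N * 'I_N) w => cpair (G N w ij.1 ij.2))) /\
  exists kappa kappa' : R,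
    [/\ 0 < kappa, 1 + kappa <= kappa' &
      forall (N : nat) (i j : 'I_N),
        ((N%:R `^ (- kappa'))%:E
           <= 'E_(P N) [(fun w => Normc.normc (G N w i j) ^+ 2)%R]
           <= (N%:R `^ (- 1 - kappa))%:E)%E].

Definition nilpotent_shift (R : realType) (n : nat) : 'M[R[i]]_n :=
  \matrix_(i, j) ((j : nat) == i.+1)%:R.

Definition cvg_weakly_in_probability (R : realType)
    (d : nat -> measure_display) (T : forall N : nat, measurableType (d N))
    (P : forall N : nat, probability (T N) R)
    (mu : forall N : nat, T N -> {measure set (R * R) -> \bar R})
    (nu : {measure set (R * R) -> \bar R}) : Prop :=
  forall f : R * R -> R, continuous f -> (exists M : R, forall z, `|f z| <= M) ->
  forall eps : R, 0 < eps ->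
    P N [set w | (eps%:E <
      `| \int[mu N w]_z (f z)%:E - \int[nu]_z (f z)%:E |)%E]
    @[N --> \oo] --> 0%E.

(* Main.v *)
Require Import Defs.
From HB Require Import structures.
From mathcomp Require Import all_boot all_order all_algebra.
From mathcomp Require Import perm complex spectral mxred.
From mathcomp Require Import all_classical all_reals all_analysis.
From mathcomp Require Import measurable_realfun.
From mathcomp Require Import ring lra zify.

(** The proof compares the spectrum of [T + G] with the unit circle through its
    characteristic polynomial [p], of degree [N].

    A monic polynomial of degree [N] whose coefficients are at most [expR (o(N))]
    and whose constant coefficient is at least [expR (- o(N))] in modulus has
    asymptotically uniform roots on the unit circle (Erdos and Turan).  The form
    used here is [roots_equidistributed].  Reflecting the roots of modulus less
    than [1] across the circle does not change, up to normalization, the sum of the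
    squared coefficients, so the Mahler measure is subexponential and, the product
    of the roots not being small, all but a small proportion of the roots are close
    to the circle ([coef_norm2_reflected], [sum_defect_le]).  Bounding the polynomial on the unit
    disc gives a bound on the power sums of the roots ([power_sum_le],
    [unit_part_power_sum]), and a Weyl criterion based on the kernels
    [(2 + 2 cos t)^n] turns it into convergence for continuous functions
    ([weyl_bound]).

    It remains to see that the two hypotheses on [p] hold with probability close
    to one.

    - Coefficients.  The minors of [z - T] have squared norm at most one.  The
      entries of [G] are independent and centered, so adding them one at a time
      multiplies the mean squared norm by at most [1 + sg], where [sg] bounds
      the variances ([mean_minor_norm]).  After [N^2] steps the mean is at most
      [expR (N^2 sg)], which is subexponential as [sg <= N^(-1-kappa)].

    - Constant coefficient.  Let [B] be [T + G] after a cyclic permutation of its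
      rows.  Up to one entry, [B] is the identity plus a copy of [G], so the
      squared Hilbert-Schmidt norm of [B - 1] is [o(N / ln N)] with high
      probability.  A determinant is affine in each entry with a cofactor as
      slope, and the variances are at least [N^(-kappa')]; with high probability
      the leading minors and [\det B] are therefore at least some [N^(-c)] times
      their own first minors ([minor_ratio]).  Then [B] is invertible and its
      inverse has polynomially bounded entries, so that its eigenvalues are
      polynomially bounded from below.  By Schur's triangularization the
      eigenvalues are square-summably close to [1], and [\det B], being their
      product, is at least [expR (- o(N))] ([det_lower]).

    The deviation events are measurable because a continuous symmetric function of
    the roots is a measurable function of the polynomial ([measurable_root_sum]).
    All the error terms are at most multiples of a fixed negative power of [N]
    ([error_terms_small]). *)

Set Implicit Arguments.
Unset Strict Implicit.
Unset Printing Implicit Defensive.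

Import Order.TTheory GRing.Theory Num.Theory.
Import numFieldNormedType.Exports.

Local Open Scope classical_set_scope.
Local Open Scope complex_scope.
Local Open Scope ring_scope.

(** * The modulus of complex numbers *)

Section ComplexModulus.
Variable R : realType.
Local Notation C := R[i].
Implicit Types (x y z : C).

Lemma normcE_norm z : `|z| = (Normc.normc z)%:C.
Proof. by case: z => a b; rewrite normc_def. Qed.

Local Notation nc := (@Normc.normc R).

Lemma nc_ge0 z : 0 <= nc z.
Proof. by rewrite -lecR -normcE_norm normr_ge0. Qed.

Lemma nc_eq0 z : (nc z == 0) = (z == 0).
Proof. by apply/eqP/eqP => [/Normc.eq0_normc//|->]; rewrite Normc.normc0. Qed.

Lemma nc_gt0 z : (0 < nc z) = (z != 0).
Proof. by rewrite lt0r nc_eq0 nc_ge0 andbT. Qed.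

Lemma nc0 : nc 0 = 0. Proof. exact: Normc.normc0. Qed.
Lemma nc1 : nc 1 = 1. Proof. exact: Normc.normc1. Qed.
Lemma ncM x y : nc (x * y) = nc x * nc y. Proof. exact: Normc.normcM. Qed.
Lemma ncV x : nc x^-1 = (nc x)^-1. Proof. exact: Normc.normcV. Qed.
Lemma ncD x y : nc (x + y) <= nc x + nc y. Proof. exact: le_normcD. Qed.
Lemma ncN x : nc (- x) = nc x. Proof. exact: normcN. Qed.
Lemma ncB x y : nc (x - y) <= nc x + nc y.
Proof. by rewrite -(ncN y) ncD. Qed.

Lemma ncX x n : nc (x ^+ n) = nc x ^+ n.
Proof. by elim: n => [|n IH]; rewrite ?expr0 ?nc1// !exprS ncM IH. Qed.

Lemma nc_sqr z : nc z ^+ 2 = complex.Re z ^+ 2 + complex.Im z ^+ 2.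
Proof. by case: z => a b /=; rewrite sqr_sqrtr// addr_ge0// sqr_ge0. Qed.

Lemma ncJ z : nc z^*%C = nc z.
Proof. by case: z => a b /=; rewrite sqrrN. Qed.

Lemma nc_real (a : R) : nc a%:C = `|a|.
Proof. by rewrite /= expr0n/= addr0 sqrtr_sqr. Qed.

Lemma abs_Re_le z : `|complex.Re z| <= nc z.
Proof. by rewrite -lecR -normcE_norm normc_ge_Re. Qed.

Lemma abs_Im_le z : `|complex.Im z| <= nc z.
Proof.
have : `|complex.Im z| ^+ 2 <= nc z ^+ 2.
  by rewrite nc_sqr real_normK ?num_real// lerDr sqr_ge0.
by rewrite ler_pXn2r// ?nnegrE ?nc_ge0.
Qed.

Lemma nc_le_abs z : nc z <= `|complex.Re z| + `|complex.Im z|.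
Proof.
rewrite {1}(complexE z); apply: le_trans (ncD _ _) _.
by rewrite ncM nc_real nc_real /= !expr0n/= add0r expr1n sqrtr1 mul1r.
Qed.

Lemma mulJ_nc z : z * z^*%C = (nc z ^+ 2)%:C.
Proof. by rewrite -sqr_normc normcE_norm rmorphXn. Qed.

Lemma nc_sum (I : Type) (s : seq I) (P : pred I) (F : I -> C) :
  nc (\sum_(i <- s | P i) F i) <= \sum_(i <- s | P i) nc (F i).
Proof.
elim/big_ind2: _ => [|x1 x2 y1 y2 h1 h2|//]; first by rewrite nc0.
exact: le_trans (ncD _ _) (lerD h1 h2).
Qed.

Lemma nc_prod (I : Type) (s : seq I) (P : pred I) (F : I -> C) :
  nc (\prod_(i <- s | P i) F i) = \prod_(i <- s | P i) nc (F i).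
Proof. by apply: (big_morph nc ncM nc1). Qed.

Lemma Re_sum (I : Type) (s : seq I) (F : I -> C) :
  complex.Re (\sum_(i <- s) F i) = \sum_(i <- s) complex.Re (F i).
Proof.
by apply: (big_morph (@complex.Re R)) => // -[a b] [c e].
Qed.

Lemma Re_realM (a : R) z : complex.Re (a%:C * z) = a * complex.Re z.
Proof. by case: z => b c /=; rewrite mul0r subr0. Qed.

Lemma nc_rotate z : exists2 c : C, nc c = 1 & complex.Re (c * z) = nc z.
Proof.
have [->|z0] := eqVneq z 0; first by exists 1; rewrite ?nc1// mulr0 nc0.
have n0 : nc z != 0 by rewrite nc_eq0.
exists ((nc z)^-1%:C * z^*%C).
  by rewrite ncM nc_real ncJ ger0_norm ?invr_ge0 ?nc_ge0// mulVf.
rewrite -mulrA (mulrC _^*%C) mulJ_nc Re_realM /=.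
by rewrite expr2 mulrA mulVf// mul1r.
Qed.

End ComplexModulus.
(** The real-valued modulus; [`|z|] is an element of [C]. *)
Notation nc := (@Normc.normc _).

(** * Power sums bounded by a polynomial on the unit disc *)

Section PowerSums.
Variable R : realType.
Local Notation C := R[i].

(** The inverse of the left-hand side is at least [1 - x + 2 x^2], whose product
    with [1 + x] is at least [1] in this range. *)
Lemma expR_le1Dx (x : R) : -1/2 <= x -> expR (x - 2 * x ^+ 2) <= 1 + x.
Proof.
move=> hx.
have h0 : 0 < 1 - x + 2 * x ^+ 2 by nra.
have h1 : 1 - x + 2 * x ^+ 2 <= expR (- (x - 2 * x ^+ 2)).
  by apply: le_trans (expR_ge1Dx _); lra.
have h2 := expRxMexpNx_1 (x - 2 * x ^+ 2).
have h3 := expR_gt0 (x - 2 * x ^+ 2).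
have hb : expR (x - 2 * x ^+ 2) * (1 - x + 2 * x ^+ 2) <= 1.
  by apply: le_trans (ler_wpM2l (ltW h3) h1) _; rewrite h2.
rewrite -(ler_pM2r h0); apply: le_trans hb _; nra.
Qed.

(** At the point of modulus [r] that aligns the sum with the positive reals, the
    logarithm of the modulus of the product is [r] times the modulus of the sum,
    up to an error of order [r^2] for each factor. *)
Lemma sum_le_of_prod_le (s : seq C) (B r : R) :
  (forall w, w \in s -> nc w <= 1) ->
  (forall y : C, nc y <= 1 -> nc (\prod_(w <- s) (1 - w * y)) <= expR B) ->
  0 < r -> r <= 1 / 4 ->
  nc (\sum_(w <- s) w) <= B / r + 4 * r * (size s)%:R.
Proof.
move=> hs hB r0 r4.
have [c c1 <-] := nc_rotate (\sum_(w <- s) w).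
have /hB hy : nc (- (r%:C * c)) <= 1.
  by rewrite ncN ncM nc_real c1 mulr1 ger0_norm ?ltW//; lra.
have h2 : nc (\prod_(w <- s) (1 - w * - (r%:C * c))) ^+ 2 <= expR (2 * B).
  rewrite mulrDl mul1r expRD -expr2 ler_pXn2r ?nnegrE ?nc_ge0 ?expR_ge0//.
suff h3 : expR (\sum_(w <- s) (2 * r * complex.Re (c * w) - 8 * r ^+ 2)) <=
    nc (\prod_(w <- s) (1 - w * - (r%:C * c))) ^+ 2.
  have := le_trans h3 h2; rewrite ler_expR big_split/= -mulr_sumr.
  rewrite -Re_sum -mulr_sumr.
  rewrite big_const_seq count_predT iter_addr addr0.
  rewrite -[_ *+ size s]mulr_natr.
  move: (complex.Re _) (size s)%:R => S n h.
  rewrite -(ler_pM2r (_ : 0 < 2 * r)) ?mulr_gt0//.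
  have -> : (B / r + 4 * r * n) * (2 * r) = 2 * B + 8 * r ^+ 2 * n.
    by field; rewrite gt_eqF.
  lra.
rewrite nc_prod -prodrXl.
elim: s hs {hB hy h2} => [|w s IH] hs; first by rewrite !big_nil expR0.
rewrite !big_cons expRD ler_pM ?expR_ge0//; last first.
  by apply: IH => v vs; apply: hs; rewrite in_cons vs orbT.
have w1 : nc w <= 1 by apply: hs; rewrite in_cons eqxx.
have hx : `|complex.Re (c * w)| <= 1.
  by apply: le_trans (abs_Re_le _) _; rewrite ncM c1 mul1r.
move: hx; rewrite ler_norml => /andP[hx1 hx2].
have -> : nc (1 - w * - (r%:C * c)) ^+ 2 =
    1 + 2 * r * complex.Re (c * w) + r ^+ 2 * nc (c * w) ^+ 2.
  have -> : 1 - w * - (r%:C * c) = 1 + r%:C * (c * w) by ring.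
  by case: (c * w) => a b; rewrite nc_sqr [in RHS]nc_sqr /=; ring.
apply: (@le_trans _ _ (1 + 2 * r * complex.Re (c * w))); last first.
  by rewrite lerDl mulr_ge0 ?sqr_ge0.
apply: le_trans (expR_le1Dx _); last nra.
rewrite ler_expR; move: (complex.Re _) hx1 hx2 => t t1 t2.
have : t ^+ 2 <= 1 by nra.
rewrite -subr_ge0 => ht.
have := mulr_ge0 (sqr_ge0 r) ht; nra.
Qed.

Lemma prod_unity_roots (k : nat) : (0 < k)%N ->
  exists2 rs : seq C, size rs = k &
    (forall z, z \in rs -> nc z = 1) /\
    forall y : C, \prod_(z <- rs) (1 - y * z) = 1 - y ^+ k.
Proof.
move=> k0.
have [rs hrs] := closed_field_poly_normal ('X^k - 1 : {poly C}).
move: hrs; rewrite (monicP _) ?scale1r; last exact: monicXnsubC.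
move=> hrs; exists rs.
  have := size_prod_XsubC rs id; rewrite -hrs size_XnsubC// => -[].
  by [].
split=> [z|y].
  rewrite -root_prod_XsubC -hrs rootE !hornerE subr_eq0 => /eqP zk.
  have := congr1 (@Normc.normc R) zk; rewrite ncX nc1.
  move/eqP; rewrite pexpr_eq1 ?nc_ge0//.
  by move/eqP.
have sz : size rs = k.
  by have := size_prod_XsubC rs id; rewrite -hrs size_XnsubC// => -[].
have [->|y0] := eqVneq y 0.
  by rewrite expr0n gtn_eqF//= subr0 big1// => z _; rewrite mul0r subr0.
transitivity (y ^+ k * \prod_(z <- rs) ('X - z%:P).[y^-1]).
  rewrite -sz -[in y ^+ _](count_predT rs) -iter_mulr_1.
  rewrite -big_const_seq -big_split/=; apply: eq_bigr => z _.
  by rewrite !hornerE mulrBr divff.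
rewrite -horner_prod -hrs !hornerE mulrBr mulr1.
by rewrite -exprMn divff// expr1n.
Qed.

(** The factor [1 - w^k y] is the product of the [1 - w z u], where [z^k = y] and
    [u] runs over the [k]-th roots of unity; this reduces power sums to sums. *)
Lemma power_sum_le (s : seq C) (B r : R) (k : nat) : (0 < k)%N ->
  (forall w, w \in s -> nc w <= 1) ->
  (forall y : C, nc y <= 1 -> nc (\prod_(w <- s) (1 - w * y)) <= expR B) ->
  0 < r -> r <= 1 / 4 ->
  nc (\sum_(w <- s) w ^+ k) <= k%:R * B / r + 4 * r * (size s)%:R.
Proof.
move=> k0 hs hB r0 r4.
rewrite -(big_map (fun w => w ^+ k) predT id) -[size s](size_map (fun w => w ^+ k)).
apply: sum_le_of_prod_le => //.
  by move=> _ /mapP[w ws ->]; rewrite ncX exprn_ile1 ?nc_ge0// hs.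
move=> y y1; rewrite big_map/=.
pose z := k.-root y.
have zk : z ^+ k = y by rewrite rootCK.
have z1 : nc z <= 1.
  have [//|z1] := leP (nc z) 1; have := @exprn_egt1 R k (nc z).
  rewrite -lt0n k0 z1 -ncX zk => /(_ isT).
  by move=> /lt_le_trans /(_ y1); rewrite ltxx.
have [rs szrs [rs1 rsE]] := prod_unity_roots k0.
have -> : \prod_(w <- s) (1 - w ^+ k * y) =
    \prod_(w <- s) \prod_(u <- rs) (1 - w * z * u).
  by apply: eq_bigr => w _; rewrite rsE exprMn zk.
rewrite exchange_big/= nc_prod.
rewrite expRM_natl -szrs -[in leRHS](count_predT rs) -iter_mulr_1 -big_const_seq.
rewrite big_seq [leRHS]big_seq.
apply: ler_prod => u us; rewrite nc_ge0/=.
under eq_bigr do rewrite -mulrA.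
by apply: hB; rewrite ncM (rs1 u us) mulr1.
Qed.

End PowerSums.

(** * Reflecting the roots into the unit disc *)

Lemma size_mul_le2 (R : nzRingType) (p q : {poly R}) : (size p <= 2)%N ->
  (size (p * q)%R <= (size q).+1)%N.
Proof.
move=> sp; apply: leq_trans (size_polyMleq _ _) _.
by move: (size p) (size q) sp => a b; lia.
Qed.

Lemma size_1BZX (R : nzRingType) (a : R) : (size (1 - a *: 'X)%R <= 2)%N.
Proof.
apply: leq_trans (size_polyD _ _) _; rewrite size_polyN geq_max size_poly1/=.
by apply: leq_trans (size_scale_leq _ _) _; rewrite size_polyX.
Qed.

Section Reflection.
Variable R : realType.
Local Notation C := R[i].

Definition coef_norm2 (n : nat) (p : {poly C}) : R :=
  \sum_(0 <= i < n) nc (p`_i) ^+ 2.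

(** The two polynomials have the same modulus on the unit circle; coefficient by
    coefficient, the difference of the squares telescopes. *)
Lemma coef_norm2_swap n (a : C) (q : {poly C}) : (size q <= n)%N ->
  coef_norm2 n.+1 ((1 - a^*%C *: 'X) * q) = coef_norm2 n.+1 (('X - a%:P) * q).
Proof.
move=> sq; apply/eqP; rewrite -subr_eq0; apply/eqP.
rewrite /coef_norm2 -sumrB.
pose c (i : nat) : R := if i is j.+1 then nc (q`_j) ^+ 2 else 0.
transitivity (\sum_(0 <= i < n.+1) (1 - nc a ^+ 2) * (c i.+1 - c i)).
  apply: eq_bigr => i _.
  rewrite mulrBl mul1r mulrBl !coefB -scalerAl coefZ coefXM coefCM.
  case: i => [|i] /=.
    by rewrite mulr0 subr0 add0r ncN ncM subr0; ring.
  move: q`_i.+1 q`_i => [x1 x2] [y1 y2]; case: a => a1 a2.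
  rewrite !nc_sqr /=; ring.
rewrite -mulr_sumr telescope_sumr//= nth_default// nc0 expr0n/= subr0.
by rewrite mulr0.
Qed.

(** Chosen so that [1 - reflected l *: 'X] has the modulus of ['X - l%:P] on the
    unit circle, up to the constant [outer_modulus l], and no root inside it. *)
Definition reflected (l : C) : C := if nc l < 1 then l^*%C else l^-1.

(** The contribution of a root to the Mahler measure. *)
Definition outer_modulus (l : C) : R := if nc l < 1 then 1 else nc l.

Lemma outer_modulus_ge1 l : 1 <= outer_modulus l.
Proof. by rewrite /outer_modulus; case: ltP. Qed.

Lemma reflected_le1 l : nc (reflected l) <= 1.
Proof.
rewrite /reflected; case: ltP => [/ltW|h]; first by rewrite ncJ.
by rewrite ncV invf_le1// (lt_le_trans ltr01).
Qed.

Lemma nc_reflected l : nc (reflected l) * outer_modulus l ^+ 2 = nc l.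
Proof.
rewrite /reflected /outer_modulus; case: ltP => h.
  by rewrite ncJ expr1n mulr1.
by rewrite ncV expr2 mulrA mulVf ?mul1r// gt_eqF// (lt_le_trans ltr01).
Qed.

Let refl_factor (l : C) : {poly C} :=
  if nc l < 1 then 1 - l^*%C *: 'X else 'X - l%:P.

Let coef_norm2_refl (s : seq C) (q : {poly C}) n :
  (size s + size q <= n.+1)%N ->
  coef_norm2 n.+1 (\prod_(l <- s) refl_factor l * q) =
  coef_norm2 n.+1 (\prod_(l <- s) ('X - l%:P) * q).
Proof.
elim: s q => [|a s IH] q /= sn; first by rewrite !big_nil.
rewrite !big_cons [X in coef_norm2 _ (X * q) = _]mulrC.
rewrite -[X in coef_norm2 _ X = _]mulrA IH; last first.
  apply: leq_trans sn; rewrite addSn -addnS leq_add2l.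
  rewrite size_mul_le2// /refl_factor.
  by case: ifP => _; rewrite ?size_XsubC ?size_1BZX.
rewrite mulrCA -mulrA.
rewrite /refl_factor; case: ifP => // _; rewrite coef_norm2_swap//.
apply: leq_trans (size_polyMleq _ _) _.
by rewrite size_prod_XsubC; move: sn; rewrite addSn; lia.
Qed.

(** Replacing a factor [X - l] by [1 - l^*%C X] preserves the modulus on the unit
    circle, hence the sum of squared coefficients.  Reflecting all the roots of
    modulus less than [1] and normalizing the constant coefficient to [1] gives
    Landau's inequality, in the form of an identity. *)
Lemma coef_norm2_reflected (s : seq C) n : (size s <= n)%N ->
  coef_norm2 n.+1 (\prod_(l <- s) ('X - l%:P)) =
  (\prod_(l <- s) outer_modulus l) ^+ 2 *
  coef_norm2 n.+1 (\prod_(l <- s) (1 - reflected l *: 'X)).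
Proof.
move=> sn; rewrite -[\prod_(l <- s) ('X - _)]mulr1 -coef_norm2_refl; last first.
  by rewrite size_poly1 addn1 ltnS.
rewrite mulr1.
have -> : \prod_(l <- s) refl_factor l =
    (\prod_(l <- s) (if nc l < 1 then 1 else - l)) *:
    \prod_(l <- s) (1 - reflected l *: 'X).
  rewrite -scaler_prod; apply: eq_bigr => l _.
  rewrite /refl_factor /reflected; case: ltP => h; first by rewrite scale1r.
  rewrite scalerBr scalerA mulNr divff ?scaleN1r ?opprK; last first.
    by rewrite -nc_eq0 gt_eqF// (lt_le_trans ltr01).
  by rewrite addrC -alg_polyC scaleNr.
rewrite /coef_norm2 mulr_sumr; apply: eq_bigr => i _.
rewrite coefZ ncM exprMn; congr (_ ^+ 2 * _).
rewrite nc_prod; apply: eq_bigr => l _.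
by rewrite /outer_modulus; case: ifP; rewrite ?nc1 ?ncN.
Qed.

(** A crude bound of each coefficient by the norm: the factor [n] only adds a
    logarithm to the exponents. *)
Lemma horner_le_coef_norm2 n (p : {poly C}) (y : C) : (size p <= n)%N ->
  nc y <= 1 -> nc p.[y] <= n%:R * Num.sqrt (coef_norm2 n p).
Proof.
move=> sp y1; rewrite (horner_coef_wide _ sp).
apply: le_trans (nc_sum _ _ _) _.
apply: (@le_trans _ _ (\sum_(i < n) Num.sqrt (coef_norm2 n p))); last first.
  by rewrite sumr_const card_ord mulr_natl.
apply: ler_sum => i _; rewrite ncM ncX.
apply: (@le_trans _ _ (nc p`_i)).
  by rewrite ler_piMr ?nc_ge0// exprn_ile1 ?nc_ge0.
rewrite -[nc _]ger0_norm ?nc_ge0// -sqrtr_sqr ler_wsqrtr//.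
rewrite /coef_norm2 big_mkord (bigD1 i)//= lerDl sumr_ge0// => j _.
exact: sqr_ge0.
Qed.

End Reflection.

Section RootStatistics.
Variable R : realType.
Local Notation C := R[i].
Variables (s : seq C) (e : R).
Hypothesis norm_le : coef_norm2 (size s).+1 (\prod_(l <- s) ('X - l%:P)) <= expR e ^+ 2.
Hypothesis const_ge : expR (- e) <= \prod_(l <- s) nc l.

Local Notation w := (@reflected R).
(* the Mahler measure of the polynomial *)
Let Mah := \prod_(l <- s) outer_modulus l.
Let h := \prod_(l <- s) (1 - w l *: 'X).

Let Mah_ge1 : 1 <= Mah.
Proof.
rewrite /Mah; elim/big_ind: _ => // [x y x1 y1|l _]; last exact: outer_modulus_ge1.
by rewrite -[1]mulr1 ler_pM.
Qed.

Let size_h : (size h <= (size s).+1)%N.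
Proof.
rewrite /h; elim: s => [|l t IH]; first by rewrite big_nil size_poly1.
by rewrite big_cons; apply: leq_trans (size_mul_le2 _ (size_1BZX _)) _.
Qed.

Let norm_h_ge1 : 1 <= coef_norm2 (size s).+1 h.
Proof.
rewrite /coef_norm2 big_nat_recl//= -horner_coef0 horner_prod big1.
  by rewrite nc1 expr1n lerDl sumr_ge0// => j _; exact: sqr_ge0.
by move=> l _; rewrite !(hornerE, mulr0, subr0).
Qed.

Let Mah_norm : Mah ^+ 2 * coef_norm2 (size s).+1 h <= expR e ^+ 2.
Proof. by rewrite /Mah /h -coef_norm2_reflected. Qed.

(** Dividing by the Mahler measure, which is at least [1], can only decrease the
    norm. *)
Lemma prod_reflected_le (y : C) : nc y <= 1 ->
  nc (\prod_(l <- [seq w l | l <- s]) (1 - l * y)) <= expR (e + ln (size s).+1%:R).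
Proof.
move=> y1; rewrite big_map.
have -> : \prod_(l <- s) (1 - w l * y) = h.[y].
  by rewrite horner_prod; apply: eq_bigr => l _; rewrite !hornerE.
apply: le_trans (horner_le_coef_norm2 size_h y1) _.
rewrite expRD lnK ?posrE ?ltr0n// mulrC ler_wpM2r//.
rewrite -[expR e]ger0_norm ?expR_ge0// -sqrtr_sqr ler_wsqrtr//.
apply: le_trans Mah_norm; rewrite ler_peMl ?(le_trans ler01)//.
by rewrite -[1](expr1n _ 2) ler_pXn2r ?nnegrE ?ler01 ?(le_trans ler01).
Qed.

(** The moduli of the reflected roots multiply up to [|p(0)|] divided by the
    square of the Mahler measure, so that few of them are far from [1]. *)
Lemma sum_defect_le : \sum_(l <- s) (1 - nc (w l)) <= 3 * e.
Proof.
rewrite -ler_expR.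
have MahE : Mah <= expR e.
  rewrite -(@ler_pXn2r _ 2) ?nnegrE ?expR_ge0 ?(le_trans ler01)//.
  by apply: le_trans Mah_norm; rewrite ler_peMr// sqr_ge0.
have hp : \prod_(l <- s) nc (w l) * Mah ^+ 2 = \prod_(l <- s) nc l.
  by rewrite /Mah -prodrXl -big_split/=; apply: eq_bigr => l _; exact: nc_reflected.
have h1 : expR (- e) <= \prod_(l <- s) nc (w l) * expR e ^+ 2.
  apply: le_trans const_ge _; rewrite -hp ler_wpM2l//.
    by apply: prodr_ge0 => l _; exact: nc_ge0.
  by rewrite ler_pXn2r ?nnegrE ?expR_ge0 ?(le_trans ler01).
have h2 : \prod_(l <- s) nc (w l) * expR (\sum_(l <- s) (1 - nc (w l))) <= 1.
  rewrite expR_sum -big_split/=.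
  apply: prodr_ile1 => l _; rewrite mulr_ge0 ?nc_ge0 ?expR_ge0//=.
  have := expR_ge1Dx (- (1 - nc (w l))).
  rewrite opprB addrC subrK -(ler_pM2r (expR_gt0 (1 - nc (w l)))).
  by rewrite -expRD addrA subrK subrr expR0; apply: le_trans.
have e3 : expR (3 * e) = expR e ^+ 2 * expR e.
  by rewrite -exprSr -expRM_natl.
have eN : expR (- e) * expR e = 1 by rewrite -expRD addNr expR0.
have h3 : 1 <= \prod_(l <- s) nc (w l) * expR (3 * e).
  by rewrite e3 mulrA -[X in X <= _]eN ler_pM2r ?expR_gt0.
have := le_trans h2 h3.
rewrite ler_pM2l// lt_neqAle prodr_ge0 ?andbT; last by move=> l _; exact: nc_ge0.
by apply/eqP => E; move: h3; rewrite -E mul0r ler10.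
Qed.

Definition unit_part (l : C) : C := l / (nc l)%:C.

Lemma nc_unit_part l : l != 0 -> nc (unit_part l) = 1.
Proof.
by move=> l0; rewrite ncM ncV nc_real ger0_norm ?nc_ge0// divff// nc_eq0.
Qed.

(** Points of the ray spanned by [l] are compared with its unit vector. *)
Lemma unit_part_sub (l a : C) : l != 0 -> forall b : R, a = b%:C * unit_part l ->
  nc (a - unit_part l) = `|b - 1|.
Proof.
move=> l0 b ->; rewrite -[X in _ - X]mul1r -mulrBl ncM nc_unit_part// mulr1.
by rewrite -(rmorph1 (real_complex R)) -rmorphB nc_real.
Qed.

Lemma reflected_sub (l : C) : l != 0 ->
  nc ((w l)^*%C - unit_part l) = 1 - nc (w l).
Proof.
move=> l0; have n0 : nc l != 0 by rewrite nc_eq0.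
rewrite (unit_part_sub l0 (b := nc (w l))).
  by rewrite ler0_norm ?opprB// subr_le0 reflected_le1.
rewrite /reflected; case: ifP => _.
  rewrite conjcK ncJ /unit_part mulrCA divff ?mulr1//.
  by rewrite -(rmorph0 (real_complex R)) (inj_eq (@complexI R)).
rewrite ncV conjc_inv /unit_part.
apply: (@mulIf _ (l^*%C)); first by rewrite conjc_eq0.
rewrite mulVf ?conjc_eq0//.
rewrite [RHS](_ : _ = (nc l)^-1%:C * (nc l)%:C^-1 * (l * l^*%C)); last by ring.
rewrite mulJ_nc -fmorphV -!rmorphM.
by rewrite -(rmorph1 (real_complex R)); congr (_ %:C); field.
Qed.

Lemma sub_unit_part (l : C) (dlt : R) : l != 0 -> dlt <= 1 / 2 ->
  1 - nc (w l) <= dlt -> nc (l - unit_part l) <= 2 * dlt.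
Proof.
move=> l0 d2 hw; have n0 : nc l != 0 by rewrite nc_eq0.
rewrite (unit_part_sub l0 (b := nc l)); last first.
  rewrite /unit_part mulrCA divff ?mulr1//.
  by rewrite -(rmorph0 (real_complex R)) (inj_eq (@complexI R)).
move: hw; rewrite /reflected; case: ltP => h1.
  by rewrite ncJ => hd; rewrite ler0_norm; lra.
rewrite ncV ger0_norm ?subr_ge0//.
have nV : nc l * (nc l)^-1 = 1 by rewrite divff.
move: (nc l) (nc l)^-1 h1 nV => a b; nra.
Qed.

Lemma pow_sub_le (a b : C) k : nc a <= 1 -> nc b <= 1 ->
  nc (a ^+ k - b ^+ k) <= k%:R * nc (a - b).
Proof.
move=> a1 b1; rewrite subrXX ncM mulrC ler_wpM2r ?nc_ge0//.
apply: le_trans (nc_sum _ _ _) _.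
rewrite -[k in k%:R]card_ord -sumr_const; apply: ler_sum => i _.
by rewrite ncM !ncX mulr_ile1 ?exprn_ge0 ?nc_ge0 ?exprn_ile1 ?nc_ge0.
Qed.

Lemma root_neq0 l : l \in s -> l != 0.
Proof.
move=> ls; apply/negP => /eqP l0; have := lt_le_trans (expR_gt0 (- e)) const_ge.
by rewrite (big_rem l)//= l0 nc0 mul0r ltxx.
Qed.

(** The conjugates of the reflected roots lie in the unit disc, where power sums
    are controlled, and they are close to the unit parts on average. *)
Lemma unit_part_power_sum k (r : R) : (0 < k)%N -> 0 < r -> r <= 1 / 4 ->
  nc (\sum_(l <- s) unit_part l ^+ k) <=
  k%:R * (e + ln (size s).+1%:R) / r + 4 * r * (size s)%:R + k%:R * (3 * e).
Proof.
move=> k0 r0 r4.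
have -> : \sum_(l <- s) unit_part l ^+ k = \sum_(l <- s) ((w l)^*%C) ^+ k +
    \sum_(l <- s) (unit_part l ^+ k - (w l)^*%C ^+ k).
  by rewrite -big_split/=; apply: eq_bigr => l _; rewrite addrC subrK.
apply: le_trans (ncD _ _) _; apply: lerD.
  have -> : \sum_(l <- s) (w l)^*%C ^+ k = (\sum_(l <- [seq w l | l <- s]) l ^+ k)^*%C.
    by rewrite rmorph_sum big_map; apply: eq_bigr => l _; rewrite rmorphXn.
  rewrite ncJ -[size s in X in _ <= _ + X](size_map w).
  apply: power_sum_le => //; last exact: prod_reflected_le.
  by move=> _ /mapP[l _ ->]; exact: reflected_le1.
apply: le_trans (nc_sum _ _ _) _.
apply: (@le_trans _ _ (k%:R * \sum_(l <- s) (1 - nc (w l)))); last first.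
  by rewrite ler_wpM2l// sum_defect_le.
rewrite mulr_sumr big_seq [leRHS]big_seq; apply: ler_sum => l ls.
have l0 := root_neq0 ls.
apply: le_trans (pow_sub_le _ _ _) _; rewrite ?nc_unit_part ?ncJ ?reflected_le1//.
by rewrite -ncN opprB reflected_sub.
Qed.

End RootStatistics.

(** * Integration over the unit circle *)

Section ProductBorel.
Variable R : realType.

(** The Borel sets of the plane belong to the product sigma-algebra, because
    rational squares form a countable base. *)
Lemma open_measurable_plane (U : set (R * R)) : open U -> measurable U.
Proof.
move=> oU.
pose box (i : rat * rat * nat) : set (R * R) :=
  ball (ratr i.1.1 : R) i.2.+1%:R^-1 `*` ball (ratr i.1.2 : R) i.2.+1%:R^-1.
pose F i := if `[< box i `<=` U >] then box i else set0.
have -> : U = \bigcup_i F i.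
  rewrite eqEsubset; split=> [x Ux|x [i _]]; last first.
    by rewrite /F; case: ifPn => // /asboolP; apply.
  have /nbhs_ballP[e /= e0 eU] : nbhs x U by exact: open_nbhs_nbhs.
  have [m] := ltr_add_invr (divr_gt0 e0 (ltr0n _ 2)); rewrite add0r => me.
  have m0 : 0 < m.+1%:R^-1 :> R by rewrite invr_gt0.
  have near_rat (a : R) : exists q : rat, ball (ratr q : R) m.+1%:R^-1 a.
    have [|q] := @rat_in_itvoo R (a - m.+1%:R^-1) (a + m.+1%:R^-1).
      by rewrite ltrBlDr -addrA ltrDl addr_gt0.
    rewrite in_itv/= => /andP[h1 h2]; exists q.
    rewrite -ball_normE/= ltr_norml; move: (ratr q) (m.+1%:R^-1) h1 h2 => b c h1 h2.
    by apply/andP; split; lra.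
  have [q1 hq1] := near_rat x.1; have [q2 hq2] := near_rat x.2.
  exists (q1, q2, m) => //; rewrite /F; case: ifPn => [_//|/asboolP[] [y1 y2]].
  move=> [/= h1 h2]; apply: eU.
  have sum_lt (p q r : R) : ball p m.+1%:R^-1 q -> ball p m.+1%:R^-1 r -> ball q e r.
    move=> /ball_sym pq pr; rewrite (splitr e).
    by apply: (ball_triangle (y := p)); apply: le_ball (ltW me) _ _.
  by split => /=; apply: sum_lt; [exact: hq1| |exact: hq2|].
apply: countable_bigcupT_measurable => // i.
rewrite /F; case: ifP => // _.
by apply: measurableX; exact: measurable_ball.
Qed.

Lemma measurable_continuous_plane (f : R * R -> R) : continuous f ->
  measurable_fun [set: R * R] f.
Proof.
move=> cf _; apply: (measurability _ (RGenOInfty.measurableE R)) => //.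
move=> /= _ [_ [x ->] <-]; rewrite setTI; apply: open_measurable_plane.
by apply: open_comp => // ? _; exact: cf.
Qed.

End ProductBorel.

Section CircleIntegral.
Variable R : realType.
Local Notation C := R[i].
Local Notation mu := (@lebesgue_measure R).
Local Notation D := (`[0, 2 * pi]%classic : set R).

Definition circle_int (h : R -> R) : R := \int[mu]_(t in D) h t.

Lemma circle_integrable (h : R -> R) : continuous h -> mu.-integrable D (EFin \o h).
Proof.
move=> ch; apply: continuous_compact_integrable; first exact: segment_compact.
exact: continuous_subspaceT.
Qed.

Lemma circle_intD (g h : R -> R) : continuous g -> continuous h ->
  circle_int (fun t => g t + h t) = circle_int g + circle_int h.
Proof. by move=> cg ch; rewrite /circle_int RintegralD//; exact: circle_integrable. Qed.

Lemma circle_intB (g h : R -> R) : continuous g -> continuous h ->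
  circle_int (fun t => g t - h t) = circle_int g - circle_int h.
Proof. by move=> cg ch; rewrite /circle_int RintegralB//; exact: circle_integrable. Qed.

Lemma circle_intZ a (h : R -> R) : continuous h ->
  circle_int (fun t => a * h t) = a * circle_int h.
Proof. by move=> ch; rewrite /circle_int RintegralZl//; exact: circle_integrable. Qed.

Lemma circle_int_cst a : circle_int (fun=> a) = 2 * pi * a.
Proof.
have e : (lebesgue_measure D = (2 * pi)%:E)%E.
  by rewrite lebesgue_measure_itv/= lte_fin two_pi_gt0/= oppr0 adde0.
rewrite /circle_int Rintegral_cst//.
by rewrite [X in a * fine X](_ : _ = (2 * pi)%:E)%E//= mulrC.
Qed.

Lemma circle_int_le (g h : R -> R) : continuous g -> continuous h ->
  (forall t, g t <= h t) -> circle_int g <= circle_int h.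
Proof.
move=> cg ch gh; apply: le_Rintegral => //; exact: circle_integrable.
Qed.

Lemma continuous_sum_seq (I : Type) (s : seq I) (F : I -> R -> R) :
  (forall i, continuous (F i)) -> continuous (fun t => \sum_(i <- s) F i t).
Proof.
move=> cF; elim: s => [|i s IH] t.
  under [X in continuous_at _ X]eq_fun do rewrite big_nil.
  exact: cvg_cst.
under [X in continuous_at _ X]eq_fun do rewrite big_cons.
by apply: cvgD; [exact: cF|exact: IH].
Qed.

Lemma circle_int_sum (I : Type) (s : seq I) (F : I -> R -> R) :
  (forall i, continuous (F i)) ->
  circle_int (fun t => \sum_(i <- s) F i t) = \sum_(i <- s) circle_int (F i).
Proof.
move=> cF; elim: s => [|i s IH].
  under [X in circle_int X]eq_fun do rewrite big_nil.
  by rewrite circle_int_cst mulr0 big_nil.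
under [X in circle_int X]eq_fun do rewrite big_cons.
by rewrite circle_intD ?IH ?big_cons//; exact: continuous_sum_seq.
Qed.

Lemma circle_int_abs_le (h : R -> R) (b : R) : continuous h ->
  (forall t, `|h t| <= b) -> `|circle_int h| <= 2 * pi * b.
Proof.
move=> ch hb; have hb2 t : - b <= h t <= b by rewrite -ler_norml.
rewrite ler_norml -mulrN -!circle_int_cst.
apply/andP; split; apply: circle_int_le => //.
- by move=> ?; exact: cvg_cst.
- by move=> t; case/andP: (hb2 t).
- by move=> ?; exact: cvg_cst.
- by move=> t; case/andP: (hb2 t).
Qed.

Definition circ (t : R) : C := (cos t) +i* (sin t).

Lemma nc_circ t : nc (circ t) = 1.
Proof.
by apply/eqP; rewrite -(@pexpr_eq1 _ _ 2) ?nc_ge0// nc_sqr /= cos2Dsin2.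
Qed.

Lemma circX t k : circ t ^+ k = circ (k%:R * t).
Proof.
elim: k => [|k IH]; first by rewrite expr0 mul0r /circ cos0 sin0.
rewrite exprS IH -natr1 mulrDl mul1r addrC /circ.
by rewrite cosD sinD; congr (_ +i* _); rewrite mulrC addrC (mulrC (sin t)).
Qed.

Lemma continuous_mulnx (k : nat) : continuous (fun t : R => k%:R * t).
Proof. by move=> t; apply: cvgM; [exact: cvg_cst|exact: cvg_id]. Qed.

Lemma circle_int_harmonic (a b : R) (k : nat) : (0 < k)%N ->
  circle_int (fun t => a * cos (k%:R * t) + b * sin (k%:R * t)) = 0.
Proof.
move=> k0; have kn0 : k%:R != 0 :> R by rewrite pnatr_eq0 -lt0n.
have cc : continuous (fun t : R => cos (k%:R * t)).
  by move=> t; apply: continuous_comp; [exact: continuous_mulnx|exact: continuous_cos].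
have cs : continuous (fun t : R => sin (k%:R * t)).
  by move=> t; apply: continuous_comp; [exact: continuous_mulnx|exact: continuous_sin].
pose F := fun t : R => k%:R^-1 * (a * sin (k%:R * t) - b * cos (k%:R * t)).
have dF (t : R) : is_derive t 1 F (a * cos (k%:R * t) + b * sin (k%:R * t)).
  rewrite /F; apply: is_derive_eq.
  rewrite /GRing.scale/=.
  by field.
have cF : continuous F.
  move=> t; apply: differentiable_continuous; apply/derivable1_diffP.
  by have := dF t => /@ex_derive.
rewrite /circle_int /Rintegral (@continuous_FTC2 _ _ F)//.
- have e2 : cos (k%:R * (2 * pi)) = 1 :> R.
    elim: (k) => [|n IH]; first by rewrite mul0r cos0.
    by rewrite -natr1 mulrDl mul1r (mulr_natl pi 2) cosD2pi -(mulr_natl pi 2).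
  have e3 : sin (k%:R * (2 * pi)) = 0 :> R.
    elim: (k) => [|n IH]; first by rewrite mul0r sin0.
    by rewrite -natr1 mulrDl mul1r (mulr_natl pi 2) sinD2pi -(mulr_natl pi 2).
  by rewrite /F e2 e3 !mulr0 cos0 sin0 -EFinB !mulr0 subrr.
- exact: two_pi_gt0.
- apply: continuous_subspaceT => t; apply: cvgD; apply: cvgM; try exact: cvg_cst.
    exact: cc.
  exact: cs.
- split=> [t _||].
  + by have := dF t => /@ex_derive.
  + exact/cvg_at_right_filter/cF.
  + exact/cvg_at_left_filter/cF.
- by move=> t _; rewrite derive1E; have := dF t => /@derive_val.
Qed.

Lemma integral_uniform_circle (f : R * R -> R) (M : R) : continuous f ->
  (forall z, `|f z| <= M) ->
  (\int[uniform_circle R]_z (f z)%:E =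
   ((2 * pi)^-1 * circle_int (fun t => f (cos t, sin t)))%:E)%E.
Proof.
move=> cf fM.
pose g := fun t => f (cos t, sin t).
have cg : continuous g.
  move=> t; apply: (@continuous_comp _ _ _ (fun t : R => (cos t, sin t)) f); last exact: cf.
  exact: (cvg_pair (@continuous_cos R t) (@continuous_sin R t)).
have mf := measurable_continuous_plane cf.
have ifin (h : R * R -> R) (B : R) : measurable_fun setT h -> (forall z, `|h z| <= B) ->
    (uniform_circle R).-integrable setT (EFin \o h).
  move=> mh hB; apply: measurable_bounded_integrable => //.
    by rewrite (le_lt_trans (probability_le1 _ _))// ltry.
  exists B; split; first exact: num_real.
  by move=> x Bx y _; apply: le_trans (hB y) (ltW Bx).
have h1 : (\int[uniform_circle R]_z (f z + M)%:E =
    ((2 * pi)^-1 * (circle_int g + 2 * pi * M))%:E)%E.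
  have fM0 z : 0 <= f z + M.
    by have := fM z; rewrite ler_norml => /andP[]; rewrite lerNl -subr_ge0 opprK addrC.
  (* the integrand has been shifted by its bound to become nonnegative *)
  rewrite ge0_integral_distribution//=; last first.
    by apply/measurable_EFinP/measurable_funD.
  rewrite integral_uniform//=; [|idtac|by move=> t; rewrite lee_fin].
  2: { apply/measurable_EFinP; apply: measurable_funD => //.
    by apply: measurableT_comp => //; exact: measurable_circle_param. }
  rewrite subr0 EFinM; congr (_ * _)%E.
  rewrite -circle_int_cst -circle_intD//; last by move=> ?; exact: cvg_cst.
  rewrite /circle_int /Rintegral fineK//.
  apply: integrable_fin_num => //; apply: (@circle_integrable (fun t => g t + M)) => t.
  by apply: cvgD; [exact: cg|exact: cvg_cst].
transitivity (\int[uniform_circle R]_z ((f z + M)%:E - M%:E))%E.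
  by apply: eq_integral => z _; rewrite -EFinB addrK.
rewrite integralB_EFin//.
- rewrite h1 integral_cst//= probability_setT mule1 -EFinB mulrDr mulrA mulVf ?mul1r ?addrK//.
  by rewrite gt_eqF// two_pi_gt0.
- apply: (ifin _ (M + `|M|)); first exact: measurable_funD.
  by move=> z; apply: le_trans (ler_normD _ _) _; rewrite lerD2r.
- by apply: (ifin _ `|M|).
Qed.

End CircleIntegral.

(** * A quantitative Weyl criterion *)

Section Kernel.
Variable R : realType.
Local Notation C := R[i].

(** The distance between [j] and [n], in truncated arithmetic. *)
Definition gap (n j : nat) : nat := (j - n + (n - j))%N.

Lemma gap_eq0 n j : (gap n j == 0)%N = (j == n).
Proof. by rewrite /gap; apply/idP/idP => [|/eqP ->]; lia. Qed.

Lemma gap_le n j : (j < (2 * n).+1)%N -> (gap n j <= n)%N.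
Proof. by rewrite /gap; lia. Qed.

(** The square of the modulus of [1 + u * (circ t)^*%C] when [u] has modulus 1.  Its
    powers are nonnegative trigonometric polynomials with a peak at [u]. *)
Definition kernel_base (u : C) (t : R) : R :=
  2 + 2 * complex.Re (u * (circ t)^*%C).

(** The base is [y^-1 (1 + y)^2] on the unit circle, so its powers are given by
    the binomial theorem. *)
Lemma kernel_expand (y : C) n : nc y = 1 ->
  (2 + 2 * complex.Re y) ^+ n =
  \sum_(j <- iota 0 (2 * n).+1) 'C(2 * n, j)%:R * complex.Re (y ^+ gap n j).
Proof.
move=> y1; have yJ : y * y^*%C = 1 by rewrite mulJ_nc y1 expr1n.
have base : (2 + 2 * complex.Re y)%:C = y^*%C * (1 + y) ^+ 2.
  transitivity (y^*%C + 2 * (y * y^*%C) + y * (y * y^*%C)); last by ring.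
  rewrite yJ; case: (y) => a b; apply/eqP; rewrite eq_complex /=.
  by apply/andP; split; apply/eqP; ring.
have -> : (2 + 2 * complex.Re y) ^+ n = complex.Re ((y^*%C) ^+ n * (1 + y) ^+ (2 * n)).
  by rewrite exprM -exprMn -base -rmorphXn.
rewrite exprDn big_distrr/= Re_sum -(big_mkord predT (fun i => complex.Re
  ((y^*)%C ^+ n * (1 ^+ (2 * n - i) * y ^+ i *+ 'C(2 * n, i)))))/=.
rewrite /index_iota subn0; apply: eq_big_seq => j.
rewrite mem_iota/= add0n => jn.
rewrite expr1n mul1r -mulr_natl mulrCA -(rmorph_nat (real_complex R)) Re_realM.
congr (_ * _); rewrite /gap; case: (leqP n j) => nj.
  rewrite (_ : n - j = 0)%N ?addn0; last lia.
  by rewrite -[in LHS](subnK nj) exprD mulrCA -exprMn (mulrC _ y) yJ expr1n mulr1.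
rewrite (_ : j - n = 0)%N ?add0n; last lia.
rewrite -[in LHS](subnK (ltnW nj)) exprD -mulrA -exprMn (mulrC _ y) yJ expr1n mulr1.
by rewrite -rmorphXn /=; case: (y ^+ _).
Qed.

Lemma nc_mul_circJ (u : C) t : nc u = 1 -> nc (u * (circ t)^*%C) = 1.
Proof. by move=> u1; rewrite ncM ncJ u1 nc_circ mulr1. Qed.

Lemma kernel_base_ge0 (u : C) t : nc u = 1 -> 0 <= kernel_base u t.
Proof.
move=> u1; have := abs_Re_le (u * (circ t)^*%C).
by rewrite nc_mul_circJ// ler_norml /kernel_base => /andP[]; lra.
Qed.

Lemma kernel_base_dist (u : C) t : nc u = 1 ->
  nc (u - circ t) ^+ 2 = 4 - kernel_base u t.
Proof.
move=> u1; have := nc_sqr u; have := nc_sqr (circ t); rewrite nc_circ u1.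
rewrite /kernel_base nc_sqr; case: u {u1} => a b /=; rewrite expr1n.
by move: (cos t) (sin t) => c d; nra.
Qed.

Lemma Re_pow_circJ (u : C) t k : complex.Re ((u * (circ t)^*%C) ^+ k) =
  complex.Re (u ^+ k) * cos (k%:R * t) + complex.Im (u ^+ k) * sin (k%:R * t).
Proof.
rewrite exprMn -rmorphXn circX; case: (u ^+ k) => a b /=; ring.
Qed.

Lemma continuous_Re_pow (u : C) k : continuous (fun t => complex.Re ((u * (circ t)^*%C) ^+ k)).
Proof.
move=> t; under [X in continuous_at _ X]eq_fun do rewrite Re_pow_circJ.
apply: cvgD; apply: cvgM; try exact: cvg_cst.
  by apply: continuous_comp; [exact: continuous_mulnx|exact: continuous_cos].
by apply: continuous_comp; [exact: continuous_mulnx|exact: continuous_sin].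
Qed.

Lemma circle_int_Re_pow (u : C) k :
  circle_int (fun t => complex.Re ((u * (circ t)^*%C) ^+ k)) = 2 * pi * (k == 0)%:R.
Proof.
case: k => [|k]; first by rewrite -circle_int_cst.
rewrite mulr0 -(circle_int_harmonic (complex.Re (u ^+ k.+1)) (complex.Im (u ^+ k.+1)) (ltn0Sn k)).
by congr circle_int; apply/funext => t; exact: Re_pow_circJ.
Qed.

Lemma continuous_kernel (u : C) n : continuous (fun t => kernel_base u t ^+ n).
Proof.
have c1 : continuous (kernel_base u).
  have -> : kernel_base u = fun t => 2 + 2 * complex.Re ((u * (circ t)^*%C) ^+ 1).
    by apply/funext => t; rewrite expr1.
  move=> t; apply: cvgD; first exact: cvg_cst.
  by apply: cvgM; [exact: cvg_cst|exact: continuous_Re_pow].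
move=> t; elim: n => [|n IH].
  under [X in continuous_at _ X]eq_fun do rewrite expr0.
  exact: cvg_cst.
under [X in continuous_at _ X]eq_fun do rewrite exprS.
by apply: cvgM => //; exact: c1.
Qed.

Lemma circle_int_kernel (u : C) n : nc u = 1 ->
  circle_int (fun t => kernel_base u t ^+ n) = 2 * pi * 'C(2 * n, n)%:R.
Proof.
move=> u1.
transitivity (circle_int (fun t => \sum_(j <- iota 0 (2 * n).+1)
    'C(2 * n, j)%:R * complex.Re ((u * (circ t)^*%C) ^+ gap n j))).
  by congr circle_int; apply/funext => t; rewrite -kernel_expand// nc_mul_circJ.
rewrite circle_int_sum; last first.
  by move=> j t; apply: cvgM; [exact: cvg_cst|exact: continuous_Re_pow].
transitivity (\sum_(j <- iota 0 (2 * n).+1)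
    2 * pi * ('C(2 * n, j)%:R * (j == n)%:R) : R).
  apply: eq_bigr => j _; rewrite circle_intZ; last exact: continuous_Re_pow.
  by rewrite circle_int_Re_pow gap_eq0 mulrCA.
rewrite -mulr_sumr; congr (_ * _).
rewrite (bigD1_seq n) ?iota_uniq ?mem_iota//=; last lia.
rewrite eqxx mulr1 big1 ?addr0// => j /negbTE ->.
by rewrite mulr0.
Qed.

Lemma central_bin_rec n :
  'C(2 * n.+1, n.+1)%:R * n.+1%:R = (4 * n.+1%:R - 2) * 'C(2 * n, n)%:R :> R.
Proof.
have h1 : ((2 * n.+1) * 'C((2 * n).+1, n) = n.+1 * 'C(2 * n.+1, n.+1))%N.
  by have := mul_bin_diag (2 * n.+1) n; rewrite (_ : (2 * n.+1).-1 = (2 * n).+1)//; lia.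
have h2 : ((2 * n).+1 * 'C(2 * n, n) = n.+1 * 'C((2 * n).+1, n))%N.
  by have := mul_bin_down (2 * n).+1 n; rewrite /= (_ : ((2 * n).+1 - n = n.+1)%N)//; lia.
have h3 : ('C(2 * n.+1, n.+1) * n.+1 = 2 * ((2 * n).+1 * 'C(2 * n, n)))%N.
  by rewrite h2 mulnC -h1 mulnA.
rewrite -natrM h3 !natrM -!natr1 natrM; ring.
Qed.

(** Mean squared distance to [u] under the probability density proportional to
    the kernel: the kernels concentrate at [u] as [n] grows. *)
Lemma circle_int_kernel_dist (u : C) n : nc u = 1 ->
  circle_int (fun t => nc (u - circ t) ^+ 2 * kernel_base u t ^+ n) =
  2 * pi * 'C(2 * n, n)%:R * (2 / n.+1%:R).
Proof.
move=> u1.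
transitivity (circle_int (fun t => 4 * kernel_base u t ^+ n - kernel_base u t ^+ n.+1)).
  by congr circle_int; apply/funext => t; rewrite kernel_base_dist// mulrBl -exprS.
rewrite circle_intB; [|by move=> t; apply: cvgM; [exact: cvg_cst|exact: continuous_kernel]
  |exact: continuous_kernel].
rewrite circle_intZ ?circle_int_kernel//; last exact: continuous_kernel.
have n0 : n.+1%:R != 0 :> R by rewrite pnatr_eq0.
have := central_bin_rec n; move: ('C(2 * n.+1, n.+1)%:R) ('C(2 * n, n)%:R) => a b h.
apply: (mulIf n0).
have -> : 2 * pi * b * (2 / n.+1%:R) * n.+1%:R = 2 * pi * (b * 2) by field.
rewrite mulrBl -[2 * pi * a * _]mulrA h; ring.
Qed.

End Kernel.

Section WeylCriterion.
Variable R : realType.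
Local Notation C := R[i].
Variables (f : R * R -> R) (M : R).
Hypotheses (cf : continuous f) (fM : forall z, `|f z| <= M).

Definition circle_mean : R := (2 * pi)^-1 * circle_int (fun t => f (cos t, sin t)).

Let cg : continuous (fun t : R => f (cos t, sin t)).
Proof.
move=> t; apply: (@continuous_comp _ _ _ (fun t : R => (cos t, sin t)) f); last exact: cf.
exact: (cvg_pair (@continuous_cos R t) (@continuous_sin R t)).
Qed.

Let M_ge0 : 0 <= M. Proof. exact: le_trans (fM (0, 0)). Qed.

(** The quantitative Weyl criterion: the sum of [f] over the sequence is
    compared with the sum of its convolutions with the kernel, which only see
    finitely many power sums. *)
Lemma weyl_bound (us : seq C) (n : nat) (tau eta K : R) :
  (forall u, u \in us -> nc u = 1) -> 0 <= tau ->
  (forall k, (0 < k <= n)%N -> nc (\sum_(u <- us) u ^+ k) <= tau) ->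
  (forall u t, nc u = 1 ->
     `|f (cpair u) - f (cos t, sin t)| <= eta + K * nc (u - circ t) ^+ 2) ->
  `|\sum_(u <- us) f (cpair u) - (size us)%:R * circle_mean| <=
  (size us)%:R * (eta + K * (2 / n.+1%:R)) + M * (4 ^+ n * tau).
Proof.
move=> us1 tau0 hk hf.
pose cn : R := 'C(2 * n, n)%:R.
have cn1 : 1 <= cn by rewrite /cn -[1]/(1%:R) ler_nat bin_gt0; lia.
have pi2 : 0 < 2 * pi :> R by exact: two_pi_gt0.
pose g t := f (cos t, sin t).
pose kr (u : C) (t : R) := kernel_base u t ^+ n.
have ckr u : continuous (kr u) by exact: continuous_kernel.
pose A := circle_int (fun t => \sum_(u <- us) (f (cpair u) - g t) * kr u t).
pose B := circle_int (fun t => g t * (\sum_(u <- us) kr u t - (size us)%:R * cn)).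
have cA u : continuous (fun t => (f (cpair u) - g t) * kr u t).
  by move=> t; apply: cvgM; [apply: cvgB; [exact: cvg_cst|exact: cg]|exact: ckr].
have csum : continuous (fun t => \sum_(u <- us) kr u t) by exact: continuous_sum_seq.
have AB : (2 * pi * cn) * (\sum_(u <- us) f (cpair u) - (size us)%:R * circle_mean) = A + B.
  rewrite -circle_intD.
  - transitivity (circle_int (fun t => \sum_(u <- us) f (cpair u) * kr u t -
        ((size us)%:R * cn) * g t)); last first.
      congr circle_int; apply/funext => t.
      under [in RHS]eq_bigr do rewrite mulrBl.
      rewrite sumrB -mulr_sumr; ring.
    rewrite circle_intB; first last.
    + by move=> t; apply: cvgM; [exact: cvg_cst|exact: cg].
    + by apply: continuous_sum_seq => u t; apply: cvgM; [exact: cvg_cst|exact: ckr].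
    rewrite circle_int_sum; last by move=> u t; apply: cvgM; [exact: cvg_cst|exact: ckr].
    rewrite circle_intZ//.
    have -> : \sum_(u <- us) circle_int (fun t => f (cpair u) * kr u t) =
        \sum_(u <- us) f (cpair u) * (2 * pi * cn).
      apply: eq_big_seq => u uin; rewrite circle_intZ//.
      by rewrite circle_int_kernel ?us1.
    rewrite -mulr_suml /circle_mean mulrBr (mulrC (\sum_(_ <- _) _)); congr (_ - _).
    have := lt0r_neq0 (pi_gt0 R); rewrite -/g; move: (@pi R) (circle_int g) => p I p0.
    by field.
  - exact: continuous_sum_seq.
  - move=> t; apply: cvgM; first exact: cg.
    by apply: cvgB; [exact: csum|exact: cvg_cst].
have hA : `|A| <= (2 * pi * cn) * ((size us)%:R * (eta + K * (2 / n.+1%:R))).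
  rewrite /A circle_int_sum//.
  apply: le_trans (ler_norm_sum _ _ _) _.
  rewrite mulrCA -[(size us)%:R]/(_%:R) -(@sum1_size _ us) natr_sum mulr_suml.
  rewrite big_seq [leRHS]big_seq; apply: ler_sum => u uin.
  rewrite mul1r.
  pose h t := eta * kr u t + K * (nc (u - circ t) ^+ 2 * kr u t).
  have cd : continuous (fun t => nc (u - circ t) ^+ 2 * kr u t).
    move=> t; under [X in continuous_at _ X]eq_fun do rewrite kernel_base_dist ?us1// -[kernel_base _ _]expr1.
    apply: cvgM; last exact: ckr.
    by apply: cvgB; [exact: cvg_cst|exact: continuous_kernel].
  have ch : continuous h.
    by move=> t; apply: cvgD; apply: cvgM; try exact: cvg_cst; [exact: ckr|exact: cd].
  have hh t : `|(f (cpair u) - g t) * kr u t| <= h t.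
    rewrite normrM [`|kr u t|]ger0_norm; last by rewrite exprn_ge0// kernel_base_ge0 ?us1.
    rewrite /h mulrA -mulrDl ler_wpM2r ?hf ?us1//.
    by rewrite exprn_ge0// kernel_base_ge0 ?us1.
  have -> : 2 * pi * cn * (eta + K * (2 / n.+1%:R)) = circle_int h.
    rewrite /h circle_intD; first last.
    - by move=> t; apply: cvgM; [exact: cvg_cst|exact: cd].
    - by move=> t; apply: cvgM; [exact: cvg_cst|exact: ckr].
    rewrite circle_intZ// circle_intZ// circle_int_kernel_dist ?us1// circle_int_kernel ?us1//.
    by rewrite /cn; ring.
  rewrite ler_norml; apply/andP; split.
    rewrite -mulN1r -circle_intZ//; apply: circle_int_le => //.
      by move=> t; apply: cvgM; [exact: cvg_cst|exact: ch].
    by move=> t; have := hh t; rewrite ler_norml mulN1r => /andP[].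
  by apply: circle_int_le => // t; exact: le_trans (ler_norm _) (hh t).
have hB : `|B| <= 2 * pi * (M * (4 ^+ n * tau)).
  apply: circle_int_abs_le.
    move=> t; apply: cvgM; first exact: cg.
    by apply: cvgB; [exact: csum|exact: cvg_cst].
  move=> t; rewrite normrM; apply: ler_pM; rewrite ?normr_ge0 ?fM//.
  have -> : \sum_(u <- us) kr u t = \sum_(j <- iota 0 (2 * n).+1)
      'C(2 * n, j)%:R * complex.Re ((\sum_(u <- us) u ^+ gap n j) * ((circ t)^*%C) ^+ gap n j).
    transitivity (\sum_(u <- us) \sum_(j <- iota 0 (2 * n).+1)
        'C(2 * n, j)%:R * complex.Re ((u * (circ t)^*%C) ^+ gap n j)).
      by apply: eq_big_seq => u uin; rewrite -kernel_expand ?nc_mul_circJ ?us1.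
    rewrite exchange_big/=; apply: eq_bigr => j _.
    rewrite -mulr_sumr mulr_suml Re_sum; congr (_ * _).
    by apply: eq_bigr => u _; rewrite exprMn.
  rewrite (bigD1_seq n) ?iota_uniq ?mem_iota//; last lia.
  have -> : gap n n = 0%N by apply/eqP; rewrite gap_eq0.
  rewrite expr0 mulr1.
  have -> : complex.Re (\sum_(u <- us) u ^+ 0) = (size us)%:R.
    rewrite Re_sum; under eq_bigr do rewrite expr0.
    by rewrite -(@sum1_size _ us) natr_sum.
  rewrite -/cn (mulrC cn) addrAC subrr add0r.
  apply: le_trans (ler_norm_sum _ _ _) _.
  have -> : 4 ^+ n * tau = \sum_(j <- iota 0 (2 * n).+1) 'C(2 * n, j)%:R * tau.
    rewrite -mulr_suml; congr (_ * _).
    have -> : 4 = (1 + 1) ^+ 2 :> R by ring.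
    rewrite -exprM exprDn -(big_mkord predT (fun i => 1 ^+ (2 * n - i) * 1 ^+ i *+ 'C(2 * n, i))).
    by rewrite /index_iota subn0; apply: eq_bigr => j _; rewrite !expr1n mul1r.
  rewrite big_seq_cond [leRHS]big_seq [leRHS](bigID (fun j => j != n)).
  apply: ler_wpDr; first by apply: sumr_ge0 => j _; rewrite mulr_ge0.
  apply: ler_sum => j /andP[]; rewrite mem_iota/= add0n => jn jnn.
  rewrite normrM ger0_norm// ler_wpM2l//.
  apply: le_trans (abs_Re_le _) _.
  rewrite ncM ncX -[_ -i* _]/((circ t)^*%C) ncJ nc_circ expr1n mulr1 hk//.
  by rewrite lt0n gap_eq0 jnn gap_le.
have pc : 0 < 2 * pi * cn by rewrite mulr_gt0// (lt_le_trans ltr01).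
rewrite -(ler_pM2l pc) -{1}(gtr0_norm pc) -normrM AB.
apply: le_trans (ler_normD _ _) _; rewrite [leRHS]mulrDr lerD//.
apply: le_trans hB _; rewrite -!mulrA ler_pM2l// ler_pM2l ?pi_gt0//.
by rewrite ler_peMl// mulr_ge0 ?M_ge0// mulr_ge0 ?exprn_ge0.
Qed.

End WeylCriterion.

(** * Equidistribution of the roots of a polynomial *)

Section Equidistribution.
Variable R : realType.
Local Notation C := R[i].

(** Uniform continuity on the square containing the circle, whose points are
    compared with points outside the square as well. *)
Lemma continuous_near_circle (f : R * R -> R) (eta : R) : continuous f -> 0 < eta ->
  exists2 dlt : R, 0 < dlt & forall u z : C, nc u = 1 -> nc (z - u) <= dlt ->
    `|f (cpair z) - f (cpair u)| <= eta.
Proof.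
move=> cf eta0.
pose K : set (R * R) := `[-1, 1]%classic `*` `[-1, 1]%classic.
have cK : compact K by apply: compact_setX; exact: segment_compact.
pose P (d : R) (p : R * R) : Prop := forall q : R * R, `|q.1 - p.1| <= d ->
  `|q.2 - p.2| <= d -> `|f q - f p| <= eta.
have near_all : \forall d \near 0^'+, K `<=` P d.
  move/compact_near_coveringP : cK => cK.
  apply: (cK R (0^'+) P) => p Kp.
  have eta2 : 0 < eta / 2 by rewrite divr_gt0.
  have /cvgrPdist_lt/(_ _ eta2)/nbhs_ballP[r /= r0 hr] := cf p.
  exists (ball p (r / 2), [set d | d < r / 2]).
    split => /=; first by apply: nbhsx_ballx; rewrite divr_gt0.
    by apply: nbhs_right_lt; rewrite divr_gt0.
  move=> [p' d] [/= bp' dr] q q1 q2.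
  have h1 : `|f p - f p'| < eta / 2.
    by apply: hr; apply: le_ball bp'; rewrite ler_pdivrMr// ler_peMr ?ler1n// ltW.
  have h2 : `|f p - f q| < eta / 2.
    apply: hr; rewrite (splitr r); apply: (ball_triangle bp').
    split; rewrite -ball_normE/= distrC; [apply: le_lt_trans q1 _|apply: le_lt_trans q2 _] => //.
  have -> : f q - f p' = (f p - f p') - (f p - f q) by ring.
  apply: le_trans (ler_normB _ _) _.
  by rewrite ltW// (splitr eta) ltrD.
have [d [d0 hd]] : exists d : R, 0 < d /\ K `<=` P d.
  by near (0 : R)^'+ => d; exists d; split; near: d => //; exact: nbhs_right_gt.
exists d => // u z u1 zu.
have Ku : K (cpair u).
  have := abs_Re_le u; have := abs_Im_le u; rewrite u1 !ler_norml.
  by move=> h1 h2; split; rewrite /= in_itv.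
apply: (hd _ Ku); rewrite /cpair/=.
  by apply: le_trans zu; apply: le_trans (abs_Re_le _); case: (z) (u) => a b [c e].
by apply: le_trans zu; apply: le_trans (abs_Im_le _); case: (z) (u) => a b [c e].
Unshelve. all: by end_near. Qed.

(** The exponential dominates the square of [1 + x / 2]. *)
Lemma ln_le_linear (e : R) : 0 < e ->
  exists N0 : nat, forall N : nat, (N0 <= N)%N -> ln N.+1%:R <= e * N%:R :> R.
Proof.
move=> e0; exists (Num.truncn (4 / e ^+ 2)).+1 => N hN.
have hN2 : 4 / e ^+ 2 <= N%:R.
  apply: ltW; apply: lt_le_trans (truncnS_gt _) _; by rewrite ler_nat.
rewrite -ler_expR lnK ?posrE//.
have h : 1 + e * N%:R / 2 <= expR (e * N%:R / 2) by exact: expR_ge1Dx.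
have eN0 : 0 <= e * N%:R / 2 by rewrite divr_ge0// mulr_ge0// ltW.
have -> : expR (e * N%:R) = expR (e * N%:R / 2) ^+ 2.
  by rewrite -expRM_natl; congr expR; field.
apply: (@le_trans _ _ ((1 + e * N%:R / 2) ^+ 2)); last first.
  by rewrite ler_pXn2r ?nnegrE ?expR_ge0// addr_ge0.
move: hN2; rewrite ler_pdivrMr ?exprn_gt0// -[N.+1%:R]natr1 => h4.
have : N%:R * 4 <= (e * N%:R) ^+ 2.
  have -> : (e * N%:R) ^+ 2 = N%:R * (N%:R * e ^+ 2) by ring.
  by rewrite ler_wpM2l.
nra.
Qed.

(** Monic polynomials whose coefficients and inverse constant coefficient grow
    subexponentially in the degree have asymptotically uniform roots on the
    unit circle (a weak form of the Erdos-Turan theorem). *)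
Theorem roots_equidistributed (f : R * R -> R) (M eta : R) : continuous f ->
  (forall z, `|f z| <= M) -> 0 < eta ->
  exists2 e0 : R, 0 < e0 & exists N0 : nat,
  forall (s : seq C), (N0 <= size s)%N ->
    coef_norm2 (size s).+1 (\prod_(l <- s) ('X - l%:P)) <= expR (e0 * (size s)%:R) ^+ 2 ->
    expR (- (e0 * (size s)%:R)) <= \prod_(l <- s) nc l ->
  `|\sum_(l <- s) f (cpair l) - (size s)%:R * circle_mean f| <= eta * (size s)%:R.
Proof.
move=> cf fM eta0.
have M0 : 0 <= M by exact: le_trans (fM (0, 0)).
have fM2 z z' : `|f z - f z'| <= 2 * M.
  by apply: le_trans (ler_normB _ _) _; rewrite mulrDl mul1r lerD.
have eta4 : 0 < eta / 4 by rewrite divr_gt0.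
have [dlt dlt0 hdlt] := continuous_near_circle cf eta4.
(* [f z - f u] is at most [eta / 4] near the diagonal and at most [K] times the
   squared distance away from it *)
pose K := 2 * M / dlt ^+ 2.
have K0 : 0 <= K by rewrite divr_ge0 ?mulr_ge0 ?exprn_ge0// ltW.
pose n := Num.truncn (8 * K / eta).
have hn : K * (2 / n.+1%:R) <= eta / 4.
  have : 8 * K / eta < n.+1%:R by exact: truncnS_gt.
  rewrite ltr_pdivrMr// => h.
  rewrite mulrA ler_pdivrMr//; move: (n.+1%:R) h => x h; lra.
(* once the degree [n] of the kernel is fixed, the power sums have to be small
   compared with the number of roots divided by [Q] *)
pose Q := (M + 1) * 4 ^+ n.
have Q1 : M * 4 ^+ n <= Q by rewrite /Q ler_wpM2r ?exprn_ge0// lerDl.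
have Q0 : 0 < Q by rewrite mulr_gt0 ?exprn_gt0// ltr_wpDl.
pose r := Num.min (1 / 4) (eta / (64 * Q)).
have r0 : 0 < r by rewrite lt_min; apply/andP; split; rewrite divr_gt0// mulr_gt0.
have r4 : r <= 1 / 4 by rewrite ge_min lexx.
have rQ : Q * (4 * r) <= eta / 16.
  have : r <= eta / (64 * Q) by rewrite ge_min lexx orbT.
  rewrite ler_pdivlMr ?mulr_gt0//; lra.
pose d := Num.min (dlt / 2) (1 / 2).
have d0 : 0 < d by rewrite lt_min; apply/andP; split; rewrite divr_gt0.
have d2 : d <= 1 / 2 by rewrite ge_min lexx orbT.
have dd : 2 * d <= dlt.
  have : d <= dlt / 2 by rewrite ge_min lexx.
  lra.
pose W := Q * (2 * n%:R / r + 3 * n%:R) + 6 * M / d.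
have W0 : 0 <= W.
  rewrite /W addr_ge0//; last by rewrite divr_ge0 ?mulr_ge0// ltW.
  by rewrite mulr_ge0 ?(ltW Q0)// addr_ge0 ?mulr_ge0// invr_ge0 ltW.
pose e0 := eta / (8 * (W + 1)).
have e00 : 0 < e0 by rewrite divr_gt0// mulr_gt0// ltr_wpDl.
have We : W * e0 <= eta / 8.
  have W1 : 0 < W + 1 by rewrite ltr_wpDl.
  have : e0 * (8 * (W + 1)) = eta by rewrite /e0 divfK// gt_eqF// mulr_gt0.
  move=> h; have : 0 <= e0 * 8 by rewrite mulr_ge0// ltW.
  lra.
exists e0 => //; have [N0 hN0] := ln_le_linear e00; exists N0 => s sN hnorm hcst.
set N := (size s)%:R; pose e := e0 * N.
have Nge0 : 0 <= N by exact: ler0n.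
have hs l : l \in s -> l != 0 by move=> ls; exact: (root_neq0 hcst ls).
have -> : \sum_(l <- s) f (cpair l) - N * circle_mean f =
   \sum_(l <- s) (f (cpair l) - f (cpair (unit_part l))) +
   (\sum_(u <- [seq unit_part l | l <- s]) f (cpair u) -
    (size [seq unit_part l | l <- s])%:R * circle_mean f).
  by rewrite sumrB big_map size_map addrA subrK.
apply: le_trans (ler_normD _ _) _.
have h1 : `|\sum_(l <- s) (f (cpair l) - f (cpair (unit_part l)))| <=
    N * (eta / 4) + (2 * M / d) * (3 * e).
  apply: le_trans (ler_norm_sum _ _ _) _.
  apply: (@le_trans _ _ (\sum_(l <- s) (eta / 4 + (2 * M / d) * (1 - nc (reflected l))))).
    rewrite big_seq [leRHS]big_seq; apply: ler_sum => l ls.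
    have l0 := hs _ ls.
    have c0 : 0 <= 2 * M / d by rewrite divr_ge0 ?mulr_ge0// ltW.
    have [hw|hw] := leP (1 - nc (reflected l)) d.
      apply: ler_wpDr; first by rewrite mulr_ge0// subr_ge0 reflected_le1.
      apply: hdlt; first exact: nc_unit_part.
      exact: le_trans (sub_unit_part l0 d2 hw) dd.
    apply: ler_wpDl; first exact: ltW.
    apply: le_trans (fM2 _ _) _.
    by rewrite -[leLHS](divfK (lt0r_neq0 d0)) ler_wpM2l// ltW.
  rewrite big_split/=.
  have -> : \sum_(i <- s) eta / 4 = N * (eta / 4).
    by rewrite big_const_seq count_predT iter_addr addr0 mulr_natl.
  rewrite -mulr_sumr lerD2l.
  apply: ler_wpM2l; first by rewrite divr_ge0 ?mulr_ge0// ltW.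
  by apply: (sum_defect_le hnorm hcst).
have e_ge0 : 0 <= e by rewrite mulr_ge0// ltW.
have l_ge0 : 0 <= ln (size s).+1%:R :> R by rewrite ln_ge0// ler1n.
have rV0 : 0 <= r^-1 by rewrite invr_ge0 ltW.
have rN0 : 0 <= 4 * r * N by rewrite mulr_ge0// mulr_ge0// ltW.
have tau0 : 0 <= n%:R * (e + ln (size s).+1%:R) / r + 4 * r * N + n%:R * (3 * e).
  apply: addr_ge0; last by do 2 apply: mulr_ge0 => //.
  by apply: addr_ge0 => //; do 2 apply: mulr_ge0 => //; exact: addr_ge0.
have hpow k : (0 < k <= n)%N -> nc (\sum_(u <- [seq unit_part l | l <- s]) u ^+ k) <=
    n%:R * (e + ln (size s).+1%:R) / r + 4 * r * N + n%:R * (3 * e).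
  move=> /andP[k0 kn]; rewrite big_map.
  apply: le_trans (unit_part_power_sum hnorm hcst k0 r0 r4) _.
  apply: lerD; last by rewrite ler_wpM2r ?ler_nat// mulr_ge0.
  rewrite lerD2r; apply: ler_wpM2r => //.
  by rewrite ler_wpM2r ?ler_nat// addr_ge0.
have hw := weyl_bound cf fM (us := [seq unit_part l | l <- s]) (n := n)
  (eta := eta / 4) (K := K) _ tau0 hpow _.
apply: le_trans (lerD h1 (hw _ _)) _ => {hw}.
- by move=> _ /mapP[l ls ->]; rewrite nc_unit_part// hs.
- move=> u t u1.
  have -> : (cos t, sin t) = cpair (circ t) by [].
  have [h|h] := leP (nc (u - circ t)) dlt.
    apply: le_trans (hdlt (circ t) u (nc_circ t) h) _.
    by rewrite lerDl mulr_ge0// sqr_ge0.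
  apply: ler_wpDl; first exact: ltW.
  apply: le_trans (fM2 _ _) _.
  rewrite /K -mulrA ler_peMr ?mulr_ge0//.
  rewrite mulrC ler_pdivlMr ?exprn_gt0// mul1r.
  by rewrite ler_pXn2r ?nnegrE ?ltW// (lt_trans dlt0).
rewrite size_map -/N.
have hln := hN0 _ sN.
have hQ : M * (4 ^+ n * (n%:R * (e + ln (size s).+1%:R) / r + 4 * r * N + n%:R * (3 * e)))
   <= Q * ((2 * n%:R / r + 3 * n%:R) * e0 * N + 4 * r * N).
  rewrite mulrA; apply: ler_pM => //; first by rewrite mulr_ge0 ?exprn_ge0.
  have : n%:R * (e + ln (size s).+1%:R) / r <= n%:R * (e + e) / r.
    by rewrite ler_wpM2r ?invr_ge0 ?(ltW r0)// ler_wpM2l// lerD2l.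
  move=> h; rewrite -addrA; apply: le_trans (lerD h (lexx _)) _.
  by rewrite /e le_eqVlt; apply/orP; left; apply/eqP; field; rewrite gt_eqF.
have hK : N * (eta / 4 + K * (2 / n.+1%:R)) <= N * (eta / 4 + eta / 4).
  by rewrite ler_wpM2l// lerD2l.
have hr : Q * (4 * r) * N <= eta / 16 * N by rewrite ler_wpM2r.
have hW : W * e0 * N <= eta / 8 * N by rewrite ler_wpM2r.
have E : W * e0 * N = Q * ((2 * n%:R / r + 3 * n%:R) * e0 * N) + 2 * M / d * (3 * e).
  by rewrite /W /e; field; rewrite !gt_eqF.
rewrite [X in _ <= X]mulrC.
rewrite [X in _ <= X]mulrDr in hQ.
have E2 : Q * (4 * r * N) = Q * (4 * r) * N by ring.
rewrite E2 in hQ.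
apply: le_trans (lerD (lexx _) (lerD hK hQ)) _.
have : N * (eta / 4) + 2 * M / d * (3 * e) + (N * (eta / 4 + eta / 4) +
  (Q * ((2 * n%:R / r + 3 * n%:R) * e0 * N) + Q * (4 * r) * N)) =
  3 / 4 * (eta * N) + W * e0 * N + Q * (4 * r) * N.
  by rewrite E; field; rewrite !gt_eqF.
move=> ->.
have EN : 0 <= eta * N by rewrite mulr_ge0// ltW.
lra.
Qed.

End Equidistribution.

(** * Lower bounds on determinants *)

Section DeterminantLowerBound.
Variable R : realType.
Local Notation C := R[i].

(** The squared Hilbert-Schmidt norm. *)
Definition hs2 m n (A : 'M[C]_(m, n)) : R := \sum_i \sum_j nc (A i j) ^+ 2.

Local Open Scope sesquilinear_scope.

Lemma hs2_trace n (A : 'M[C]_n) : (hs2 A)%:C = \tr (A *m A ^t*).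
Proof.
rewrite /hs2 rmorph_sum; apply: eq_bigr => i _.
rewrite rmorph_sum mxE; apply: eq_bigr => j _.
by rewrite !mxE /= -mulJ_nc.
Qed.

Lemma hs2_unitary n (P A : 'M[C]_n) : P \is unitarymx ->
  hs2 (P *m A *m P ^t*) = hs2 A.
Proof.
move=> uP; apply: complexI; rewrite !hs2_trace.
have PP : P ^t* *m P = 1%:M by rewrite -invmx_unitary// mulVmx// unitarymx_unit.
have -> : (P *m A *m P ^t*) ^t* = P *m (A ^t* *m P ^t*).
  by rewrite !trmx_mul !map_mxM/= trmxCK mulmxA.
rewrite [X in \tr X](_ : _ = P *m (A *m A ^t*) *m P ^t*); last first.
  transitivity (P *m A *m (P ^t* *m P) *m (A ^t* *m P ^t*)); first by rewrite !mulmxA.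
  by rewrite PP mulmx1 !mulmxA.
by rewrite mxtrace_mulC [P ^t* *m _]mulmxA PP mul1mx.
Qed.

(** An eigenvector satisfies [\det B *: v = th *: (v *m \adj B)]; compare the two
    sides at the coordinate of largest modulus. *)
Lemma eigenvalue_lower n (B : 'M[C]_n.+1) (K : R) (th : C) : \det B != 0 ->
  (forall i j, nc (cofactor B i j) <= K * nc (\det B)) ->
  eigenvalue B th -> 1 <= n.+1%:R * K * nc th.
Proof.
move=> d0 hK /eigenvalueP[v vB v0].
have key : \det B *: v = th *: (v *m \adj B).
  by rewrite scalemxAl -vB -mulmxA mul_mx_adj mul_mx_scalar.
pose j := [arg max_(j > ord0 | true) nc (v 0 j)]%O.
have hj k : nc (v 0 k) <= nc (v 0 j).
  by rewrite /j; case: arg_maxP => // i _; apply.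
have vj0 : 0 < nc (v 0 j).
  rewrite lt_neqAle nc_ge0 andbT eq_sym nc_eq0; apply: contra v0 => /eqP vj.
  apply/eqP/rowP => k; rewrite mxE; apply/eqP; rewrite -nc_eq0 eq_le nc_ge0 andbT.
  by apply: le_trans (hj k) _; rewrite vj nc0.
have dB0 : 0 < nc (\det B) by rewrite nc_gt0.
have := congr1 (fun x : 'rV_n.+1 => nc (x 0 j)) key; rewrite !mxE !ncM => e1.
have : nc (\sum_k v 0 k * \adj B k j) <= n.+1%:R * (nc (v 0 j) * (K * nc (\det B))).
  apply: le_trans (nc_sum _ _ _) _.
  rewrite mulr_natl -[X in _ *+ X]card_ord -sumr_const; apply: ler_sum => k _.
  by rewrite ncM mxE ler_pM ?nc_ge0.
move=> h; have {h} := ler_wpM2l (nc_ge0 th) h; rewrite -e1 => h.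
rewrite -(ler_pM2r (mulr_gt0 dB0 vj0)) mul1r; apply: le_trans h _.
by rewrite le_eqVlt; apply/orP; left; apply/eqP; ring.
Qed.

(** If [th] is within [1 / 2] of [1], its logarithm is almost linear in [th - 1] and
    the linear term is split by the arithmetic-geometric inequality; otherwise
    [4 * nc (th - 1) ^+ 2] exceeds [1] and pays for the hypothesis on [th]. *)
Lemma ln_nc_lower (th : C) (L tau : R) : 0 < tau -> 0 <= L -> expR (- L) <= nc th ->
  expR (- (tau + nc (th - 1) ^+ 2 / tau + 4 * L * nc (th - 1) ^+ 2)) <= nc th.
Proof.
move=> tau0 L0 hL; set a := nc (th - 1).
have a0 : 0 <= a by exact: nc_ge0.
have LA : 0 <= L * a ^+ 2 by rewrite mulr_ge0// sqr_ge0.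
have ha : 2 * a <= tau + a ^+ 2 / tau.
  rewrite -(ler_pM2r tau0).
  have -> : (tau + a ^+ 2 / tau) * tau = tau ^+ 2 + a ^+ 2 by field; rewrite gt_eqF.
  have := sqr_ge0 (tau - a); nra.
have [h|h] := leP a (1 / 2); last first.
  apply: le_trans hL; rewrite ler_expR lerN2.
  have : 0 <= L * (4 * a ^+ 2 - 1) by rewrite mulr_ge0//; nra.
  lra.
have h1 : 1 - a <= nc th.
  have := ncB th (th - 1); rewrite (_ : th - (th - 1) = 1); last by ring.
  by rewrite nc1 -/a; lra.
apply: le_trans h1.
have := @expR_le1Dx R (- a); rewrite sqrrN => /(_ _) hx.
apply: le_trans (hx _); last lra.
by rewrite ler_expR; nra.
Qed.

(** By Schur's theorem the eigenvalues of [B] are square-summably close to [1],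
    hence all but few of them are close to [1]; the bound on the cofactors
    keeps the exceptional ones away from [0]. *)
Lemma det_lower n (B : 'M[C]_n.+1) (K H tau : R) : \det B != 0 ->
  1 <= K -> 0 < tau ->
  (forall i j, nc (cofactor B i j) <= K * nc (\det B)) ->
  hs2 (B - 1%:M) <= H ->
  expR (- (n.+1%:R * tau + (tau^-1 + 4 * ln (n.+1%:R * K)) * H)) <= nc (\det B).
Proof.
move=> d0 K1 tau0 hK hH.
have [P uP] := @Schur C n.+1 B isT.
rewrite /similar_to /= conjymx// => trig.
set T := P *m B *m P ^t* in trig.
have PP : P ^t* *m P = 1%:M by rewrite -invmx_unitary// mulVmx// unitarymx_unit.
have PP2 : P *m P ^t* = 1%:M by apply/unitarymxP.
have detT : \det B = \prod_i T i i.
  rewrite -det_trig// /T !det_mulmx mulrC mulrA -det_mulmx PP det1 mul1r//.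
have hT : \sum_i nc (T i i - 1) ^+ 2 <= H.
  apply: le_trans hH; rewrite -(hs2_unitary _ uP) mulmxBr mulmx1 mulmxBl PP2 -/T.
  apply: ler_sum => i _; rewrite (bigD1 i)//= !mxE eqxx lerDl.
  by apply: sumr_ge0 => j _; exact: sqr_ge0.
pose L := ln (n.+1%:R * K).
have nK1 : 1 <= n.+1%:R * K by rewrite mulr_ege1 ?ler1n.
have L0 : 0 <= L by rewrite ln_ge0.
have hL i : expR (- L) <= nc (T i i).
  have ev : eigenvalue B (T i i).
    have : eigenvalue T (T i i).
      rewrite eigenvalue_root_char char_poly_trig// /root horner_prod.
      by rewrite (bigD1 i)//= !hornerE subrr mul0r.
    move=> /eigenvalueP[v vT v0]; apply/eigenvalueP; exists (v *m P).
      by rewrite scalemxAl -vT /T !mulmxA -!mulmxA PP mulmx1.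
    apply: contra v0 => /eqP e; rewrite -[v]mulmx1 -PP2 mulmxA e mul0mx//.
  have := eigenvalue_lower d0 hK ev.
  rewrite expRN lnK ?posrE ?(lt_le_trans ltr01)// => h.
  by rewrite -[X in X <= _]mul1r ler_pdivrMr ?(lt_le_trans ltr01)// mulrC.
rewrite detT nc_prod.
apply: (@le_trans _ _ (\prod_i expR (- (tau + nc (T i i - 1) ^+ 2 / tau +
    4 * L * nc (T i i - 1) ^+ 2)))); last first.
  by apply: ler_prod => i _; rewrite expR_ge0/= ln_nc_lower.
rewrite -expR_sum ler_expR sumrN lerN2 !big_split/=.
rewrite sumr_const card_ord -mulr_suml -mulr_sumr -[tau *+ _]mulr_natl -addrA lerD2l.
rewrite [X in X + _]mulrC -mulrDl; apply: ler_wpM2l => //.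
by rewrite addr_ge0 ?mulr_ge0// invr_ge0 ltW.
Qed.

End DeterminantLowerBound.

Section ShiftRows.
Variable R : realType.
Local Notation C := R[i].

(** The shift is nilpotent, but a cyclic permutation of its rows turns it into the
    identity with one entry removed. *)
Lemma hs2_shift n (G : 'M[C]_n.+1) :
  hs2 (mxsub (@ord_pred n.+1) id (nilpotent_shift R n.+1 + G) - 1%:M) <= 2 * hs2 G + 2.
Proof.
have -> : hs2 G = \sum_i \sum_j nc (G (ord_pred i) j) ^+ 2.
  by rewrite /hs2 (reindex_inj (@ord_pred_inj _)).
rewrite /hs2 mulr_sumr.
have E2 : 2 = \sum_(i < n.+1) \sum_(j < n.+1) 2 * ((i == ord0) && (j == ord0))%:R :> R.
  rewrite (bigD1 ord0)//= (bigD1 ord0)//= !big1 ?addr0 ?mulr1//.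
    by move=> i /negbTE ->; rewrite big1// => j _; rewrite mulr0.
  by move=> i /negbTE ->; rewrite mulr0.
rewrite [X in _ <= _ + X]E2 -big_split/=; apply: ler_sum => i _.
rewrite mulr_sumr -big_split/=; apply: ler_sum => j _.
rewrite !mxE; set g := G _ _.
(* the cyclic shift of the rows turns the superdiagonal into the diagonal, where
   only the first entry is missing *)
have -> : ((j : nat) == (ord_pred i).+1)%:R + g - (i == j)%:R =
    g - ((i == ord0) && (j == ord0))%:R :> C.
  rewrite addrAC [RHS]addrC; congr (_ + _).
  have ij : (i == j) = ((i : nat) == j) by [].
  have jn := ltn_ord j; have i_n := ltn_ord i.
  have [i0|i0] := eqVneq i ord0.
    have -> : ord_pred i = n :> nat by rewrite i0 /= modn_small.
    by rewrite ltn_eqF// sub0r ij i0 eq_sym.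
  have i0' : (0 < i)%N by rewrite lt0n.
  have -> : ord_pred i = i.-1 :> nat.
    by rewrite /= (_ : (i + n.+1).-1 = i.-1 + n.+1)%N ?modnDr ?modn_small//; lia.
  by rewrite prednK// ij eq_sym subrr oppr0.
apply: le_trans (_ : (nc g + nc ((i == ord0) && (j == ord0))%:R) ^+ 2 <= _).
  by rewrite ler_pXn2r ?nnegrE ?addr_ge0 ?nc_ge0 ?ncB.
have -> : nc (((i == ord0) && (j == ord0))%:R : C) = ((i == ord0) && (j == ord0))%:R.
  by case: (_ && _); rewrite ?nc1 ?nc0.
have := sqr_ge0 (nc g - 1); have := sqr_ge0 (nc g).
by case: (_ && _) => /=; nra.
Qed.

End ShiftRows.

(** * Decoupling one of several independent variables *)

Section Decoupling.
Context d d' (T : measurableType d) (T' : measurableType d') (R : realType).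
Variables (P : probability T R) (I : finType) (X : I -> T -> T').
Hypothesis mX : forall i, measurable_fun [set: T] (X i).
Hypothesis indep : mutually_independent P X.
Variable i0 : I.

Definition other_cylinders : set (set T) :=
  [set A | exists2 B : I -> set T', (forall i, measurable (B i)) &
     A = \bigcap_(i in [set` [set~ i0]%SET]) (X i @^-1` B i)].

(** A copy of the sample space with a coarser sigma-algebra: measurability on it
    expresses that a function depends only on the variables other than [X i0]. *)
Definition others : Type := g_sigma_algebraType other_cylinders.
HB.instance Definition _ := Measurable.on others.

Let to_others (w : T) : others := w.

Let measurable_preimage i B : measurable B -> measurable (X i @^-1` B).
Proof. by move=> mB; rewrite -[X in measurable X]setTI; exact: mX. Qed.

Let cylinders_measurable : other_cylinders `<=` measurable.
Proof.
move=> _ [B mB ->]; apply: fin_bigcap_measurable => // i _.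
exact: measurable_preimage.
Qed.

Let measurable_to_others : measurable_fun [set: T] to_others.
Proof.
move=> _ A mA; rewrite setTI; apply: (smallest_sub _ cylinders_measurable mA).
exact: sigma_algebra_measurable.
Qed.

Lemma measurable_id_others : measurable_fun [set: T] (id : T -> others).
Proof. exact: measurable_to_others. Qed.

Lemma measurable_other i : i != i0 ->
  measurable_fun [set: others] (X i : others -> T').
Proof.
move=> ii0 _ B mB; rewrite setTI; apply: sub_sigma_algebra.
exists (fun j => if j == i then B else setT); first by move=> j; case: ifP.
rewrite eqEsubset; split=> w /=.
  by move=> XB j _ /=; case: eqP => [->|].
by move=> /(_ i) /=; rewrite eqxx; apply; rewrite !inE.
Qed.

Let cylinders_setI : setI_closed other_cylinders.
Proof.
move=> _ _ [A mA ->] [B mB ->]; exists (fun i => A i `&` B i).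
  by move=> i; exact: measurableI.
by rewrite -bigcapI.
Qed.

Let cylinders_setT : other_cylinders setT.
Proof.
by exists (fun=> setT) => //; rewrite eqEsubset; split.
Qed.

Let prob_cylinder (B : set T') (A : set T) : measurable B -> other_cylinders A ->
  P (X i0 @^-1` B `&` A) = (P (X i0 @^-1` B) * P A)%E.
Proof.
move=> mB [C mC ->].
pose D i := if i == i0 then B else C i.
have mD i : measurable (D i) by rewrite /D; case: ifP.
have -> : X i0 @^-1` B `&` \bigcap_(i in [set` [set~ i0]%SET]) (X i @^-1` C i) =
    \bigcap_(i in [set` [set: I]%SET]) (X i @^-1` D i).
  rewrite eqEsubset; split=> w /=.
    move=> [Bw Cw] i _; rewrite /D /=; case: eqP => [->//|/eqP ii0].
    by apply: (Cw i); rewrite /= !inE.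
  move=> h0; have h i : D i (X i w) by apply: (h0 i); rewrite /= inE.
  split; first by have := h i0; rewrite /D eqxx.
  move=> i; rewrite /= !inE => ii0.
  by have := h i; rewrite /D (negbTE ii0).
rewrite indep// indep// (bigD1 i0)//= {1}/D eqxx; congr (_ * _)%E.
apply: eq_big => [i|i]; first by rewrite !inE.
by rewrite inE => ii0; rewrite /D (negbTE ii0).
Qed.

(* the cylinders form a pi-system generating the events of the other variables *)
Let prob_indep (B : set T') (A : set others) : measurable B -> measurable A ->
  P (X i0 @^-1` B `&` A) = (P (X i0 @^-1` B) * P A)%E.
Proof.
move=> mB mA.
have mXB := measurable_preimage i0 mB.
have pge0 : 0 <= fine (P (X i0 @^-1` B)) by rewrite fine_ge0// measure_ge0.
pose m1 : {measure set others -> \bar R} := pushforward (mrestr P mXB) to_others.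
pose m2 : {measure set others -> \bar R} :=
  mscale (NngNum pge0) (pushforward P to_others).
have pfin : (fine (P (X i0 @^-1` B)))%:E = P (X i0 @^-1` B).
  by rewrite fineK// fin_num_measure.
have m12 : m1 measurable_to_others A = m2 measurable_to_others A.
  apply: (@measure_unique _ R others other_cylinders (fun=> setT)) => //.
  - by rewrite bigcup_const//; exists 0%N.
  - move=> C cylC; rewrite /= /mscale /= /pushforward /mrestr /= pfin.
    by rewrite -prob_cylinder// setIC.
  - move=> k; rewrite /= /pushforward /mrestr; apply: le_lt_trans (_ : (1 < +oo)%E).
      apply: probability_le1; apply: measurableI => //; rewrite preimage_setT; exact: measurableT.
    exact: ltry.
by move: m12; rewrite /= /mscale /= /pushforward /mrestr /= pfin setIC.
Qed.

(** Tonelli's theorem, after replacing the joint law of [X i0] and of the other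
    variables by the product of their laws. *)
Lemma decoupling (F : T' * others -> \bar R) :
  measurable_fun [set: T' * others] F -> (forall z, 0 <= F z)%E ->
  (\int[P]_w F (X i0 w, w) = \int[P]_w \int[P]_w' F (X i0 w', w))%E.
Proof.
move=> mF F0.
pose mo : {mfun T >-> others} := HB.pack to_others
  (isMeasurableFun.Build _ _ _ _ to_others measurable_to_others).
pose Xo : {mfun T >-> T'} := HB.pack (X i0)
  (isMeasurableFun.Build _ _ _ _ (X i0) (mX i0)).
have mpair : measurable_fun [set: T] (fun w => (X i0 w, to_others w)).
  by apply: measurable_fun_pair => //.
pose mp : {mfun T >-> (T' * others)%type} := HB.pack (fun w => (X i0 w, to_others w))
  (isMeasurableFun.Build _ _ _ _ (fun w => (X i0 w, to_others w)) mpair).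
pose mu1 := distribution P Xo; pose mu2 := distribution P mo.
pose nu := distribution P mp.
transitivity (\int[nu]_z F z)%E.
  by rewrite ge0_integral_distribution.
transitivity (\int[mu1 \x mu2]_z F z)%E.
  apply: eq_measure_integral => A mA _; apply/esym.
  by apply: product_measure_unique => //; exact: prob_indep.
rewrite fubini_tonelli2// ge0_integral_distribution//=; last 2 first.
- exact: measurable_fun_fubini_tonelli_G.
- by move=> w; apply: integral_ge0.
apply: eq_integral => w _; rewrite /fubini_G/=.
rewrite ge0_integral_distribution//.
by apply: measurableT_comp => //; exact: measurable_pair2.
Qed.

Lemma measurable_decoupled (F : T' * others -> \bar R) :
  measurable_fun [set: T' * others] F -> (forall z, 0 <= F z)%E ->
  measurable_fun [set: T] (fun w => \int[P]_w' F (X i0 w', w))%E.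
Proof.
move=> mF F0.
pose Xo : {mfun T >-> T'} := HB.pack (X i0)
  (isMeasurableFun.Build _ _ _ _ (X i0) (mX i0)).
have mG := measurable_fun_fubini_tonelli_G (m1 := distribution P Xo) F mF F0.
have -> : (fun w => \int[P]_w' F (X i0 w', w))%E =
    fubini_G (distribution P Xo) F \o to_others.
  apply/funext => w; rewrite /fubini_G/= ge0_integral_distribution//.
  by apply: measurableT_comp => //; exact: measurable_pair2.
exact: measurableT_comp mG measurable_to_others.
Qed.

End Decoupling.

(** * Gaussian variables *)

Section GaussianVariable.
Variable R : realType.
Local Notation mu := (@lebesgue_measure R).

Lemma normal_pdf0E (s x : R) : s != 0 ->
  normal_pdf 0 s x = normal_peak s * expR (- x ^+ 2 / (s ^+ 2 *+ 2)).
Proof. by move=> s0; rewrite /normal_pdf (negbTE s0) /normal_fun subr0. Qed.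

Lemma normal_prob_sym (s : R) (A : set R) : s != 0 -> measurable A ->
  normal_prob 0 s (-%R @^-1` A) = normal_prob 0 s A.
Proof.
move=> s0 mA; rewrite /normal_prob.
have mpdf : measurable_fun setT (fun x => (normal_pdf 0 s x)%:E).
  by apply/measurable_EFinP; exact: measurable_normal_pdf.
transitivity (\int[pushforward mu (-%R : measurableTypeR R -> measurableTypeR R)]_(x in A)
    (normal_pdf 0 s x)%:E)%E; last first.
  by apply: eq_measure_integral => //= B mB BA; exact: lebesgue_measureN.
rewrite ge0_integral_pushforward//=.
- apply: eq_integral => x _ /=; congr (_%:E).
  by rewrite !normal_pdf0E// sqrrN.
- exact: measurable_funTS.
- by move=> x _; rewrite lee_fin normal_pdf_ge0.
Qed.

Lemma centered_normal_sym (s : R) (A : set R) : measurable A ->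
  centered_normal s (-%R @^-1` A) = centered_normal s A.
Proof.
rewrite /centered_normal; case: ifPn => [_ mA|s0 mA]; last exact: normal_prob_sym.
rewrite /dirac /= !indicE; congr ((_ : bool)%:R%:E).
by apply/idP/idP => /set_mem /=; rewrite ?oppr0 => h; apply/mem_set => /=; rewrite ?oppr0.
Qed.

Lemma integral_normal (s : R) (f : R -> R) : s != 0 -> measurable_fun setT f ->
  (forall x, 0 <= f x) ->
  (\int[normal_prob 0 s]_x (f x)%:E = \int[mu]_x (f x * normal_pdf 0 s x)%:E)%E.
Proof.
move=> s0 mf f0.
pose nu : {finite_measure set (measurableTypeR R) -> \bar R} := normal_prob 0 s.
have numu : nu `<< mu by exact: normal_prob_dominates.
pose g := Radon_Nikodym_SigmaFinite.f nu mu.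
have mpdf : measurable_fun setT (fun x => (normal_pdf 0 s x)%:E).
  by apply/measurable_EFinP; exact: measurable_normal_pdf.
have gE : ae_eq mu setT g (fun x => (normal_pdf 0 s x)%:E).
  apply: integral_ae_eq => //.
  - exact: Radon_Nikodym_SigmaFinite.f_integrable.
  - by move=> A _ mA; rewrite -Radon_Nikodym_SigmaFinite.f_integral.
have f0E x : (0 <= (f x)%:E)%E by rewrite lee_fin.
have mfE : measurable_fun setT (fun x => (f x)%:E) by exact/measurable_EFinP.
rewrite -(Radon_Nikodym_SigmaFinite.change_of_variables numu f0E measurableT mfE).
apply: ge0_ae_eq_integral => //.
- apply: emeasurable_funM; first exact/measurable_EFinP.
  by have /integrableP[] := Radon_Nikodym_SigmaFinite.f_integrable numu.
- by apply/measurable_EFinP; apply: measurable_funM => //; exact: measurable_normal_pdf.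
- by move=> x _; rewrite mule_ge0 ?lee_fin//; exact: Radon_Nikodym_SigmaFinite.f_ge0.
- by move=> x _; rewrite lee_fin mulr_ge0// normal_pdf_ge0.
- by apply: filterS gE => x /= gx _; rewrite EFinM -(gx I).
Qed.

(** The factor [y^2] costs a constant multiple of [s^2] when half of the exponent
    of the Gaussian density is spent on it. *)
Lemma normal_second_moment (s : R) : s != 0 ->
  (\int[normal_prob 0 s]_x (x ^+ 2)%:E <= (6 * s ^+ 2)%:E)%E.
Proof.
move=> s0; have s2 : 0 < s ^+ 2 by rewrite lt0r expf_neq0//= sqr_ge0.
rewrite integral_normal//; last by move=> x; exact: sqr_ge0.
pose r := Num.sqrt 2 * s.
have r2 : r ^+ 2 = 2 * s ^+ 2 by rewrite exprMn sqr_sqrtr.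
have r0 : r != 0 by rewrite mulf_neq0// gt_eqF// sqrtr_gt0.
have pk : normal_peak s = Num.sqrt 2 * normal_peak r.
  rewrite /normal_peak r2 (_ : 2 * s ^+ 2 * pi *+ 2 = 2 * (s ^+ 2 * pi *+ 2)); last by rewrite -mulrA mulrnAr.
  rewrite (sqrtrM _ (ltW (ltr0n _ 2))) invfM mulrA divff ?mul1r//.
have bound x : x ^+ 2 * normal_pdf 0 s x <= 6 * s ^+ 2 * normal_pdf 0 r x.
  rewrite !normal_pdf0E// pk r2.
  pose u := x ^+ 2 / (4 * s ^+ 2).
  have e1 : - x ^+ 2 / (s ^+ 2 *+ 2) = - u - u.
    by rewrite /u -[s ^+ 2 *+ 2]mulr_natl; field.
  have e2 : - x ^+ 2 / (2 * s ^+ 2 *+ 2) = - u.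
    by rewrite /u -[_ *+ 2]mulr_natl; field.
  rewrite e1 e2 expRD.
  have ux : x ^+ 2 = 4 * s ^+ 2 * u by rewrite /u; field.
  have hu : u * expR (- u) <= 1.
    have : u <= expR u by apply: le_trans (expR_ge1Dx u); rewrite lerDr.
    by rewrite -(ler_pM2r (expR_gt0 (- u))) -[X in _ <= X -> _]expRD subrr expR0.
  have sq2 : Num.sqrt 2 <= 3 / 2 :> R.
    rewrite -[3 / 2]ger0_norm// -sqrtr_sqr ler_wsqrtr//; lra.
  rewrite ux.
  have p0 := normal_peak_ge0 r; have E0 := expR_ge0 (- u).
  have -> : 4 * s ^+ 2 * u * (Num.sqrt 2 * normal_peak r * (expR (- u) * expR (- u))) =
    (u * expR (- u)) * (Num.sqrt 2 * (4 * s ^+ 2 * (normal_peak r * expR (- u)))) by ring.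
  have Q0 : 0 <= s ^+ 2 * (normal_peak r * expR (- u)) by rewrite mulr_ge0 ?(ltW s2)// mulr_ge0.
  apply: (@le_trans _ _ (1 * (3 / 2 * (4 * s ^+ 2 * (normal_peak r * expR (- u)))))).
    apply: ler_pM => //.
    - by rewrite mulr_ge0// divr_ge0 ?sqr_ge0// mulr_ge0// ltW.
    - by rewrite mulr_ge0 ?sqrtr_ge0// -mulrA mulr_ge0.
    - by rewrite ler_wpM2r// -mulrA mulr_ge0.
  by rewrite le_eqVlt; apply/orP; left; apply/eqP; field.
apply: (@le_trans _ _ (\int[mu]_x ((6 * s ^+ 2)%:E * (normal_pdf 0 r x)%:E))%E).
  apply: ge0_le_integral => //.
  - by move=> x _; rewrite lee_fin mulr_ge0 ?sqr_ge0 ?normal_pdf_ge0.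
  - by apply/measurable_EFinP; apply: measurable_funM => //; exact: measurable_normal_pdf.
  - by apply: measurable_funeM; apply/measurable_EFinP; exact: measurable_normal_pdf.
  - by move=> x _; rewrite -EFinM lee_fin.
rewrite ge0_integralZl//; last 3 first.
- by apply/measurable_EFinP; exact: measurable_normal_pdf.
- by move=> x _; rewrite lee_fin normal_pdf_ge0.
- by rewrite lee_fin mulr_ge0// ltW.
by rewrite integral_normal_pdf mule1.
Qed.

(** The density is at most its peak. *)
Lemma normal_interval_le (s c h : R) : s != 0 -> 0 <= h ->
  (normal_prob 0 s `[(c - h)%R, (c + h)%R] <= (2 * h / `|s|)%:E)%E.
Proof.
move=> s0 h0.
have s_gt0 : 0 < `|s| by rewrite normr_gt0.
apply: (@le_trans _ _ (\int[mu]_(x in `[(c - h)%R, (c + h)%R]) (normal_peak s)%:E)%E).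
  apply: ge0_le_integral => //.
  - by move=> x _; rewrite lee_fin normal_pdf_ge0.
  - by apply/measurable_EFinP; apply: measurable_funTS; exact: measurable_normal_pdf.
  - by move=> x _; rewrite lee_fin normal_pdf_ub.
rewrite integral_cst//= lebesgue_measure_itv/= lte_fin.
case: ifPn => _; last by rewrite mule0 lee_fin divr_ge0 ?mulr_ge0// ltW.
rewrite -EFinB -EFinM lee_fin.
have -> : c + h - (c - h) = 2 * h by ring.
rewrite mulrC ler_wpM2l ?mulr_ge0// /normal_peak lef_pV2 ?posrE//; last first.
  by rewrite sqrtr_gt0 pmulrn_lgt0// mulr_gt0 ?pi_gt0// lt0r expf_neq0//= sqr_ge0.
rewrite -sqrtr_sqr ler_wsqrtr// -mulrnAr ler_peMr ?sqr_ge0//.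
by have := pi_ge2 R; rewrite -mulr_natl => h2; lra.
Qed.

End GaussianVariable.

Section NonnegIntegrals.
Context d (T : measurableType d) (R : realType) (P : probability T R).
Implicit Types f g : T -> R.

Lemma ge0_integralD_real f g : measurable_fun setT f -> measurable_fun setT g ->
  (forall w, 0 <= f w) -> (forall w, 0 <= g w) ->
  (\int[P]_w (f w + g w)%:E = \int[P]_w (f w)%:E + \int[P]_w (g w)%:E)%E.
Proof.
move=> mf mg f0 g0; under eq_integral do rewrite EFinD.
by apply: ge0_integralD => //; try (by move=> w _; rewrite lee_fin);
  exact/measurable_EFinP.
Qed.

Lemma ge0_integralZl_real (k : R) f : measurable_fun setT f ->
  (forall w, 0 <= f w) -> 0 <= k ->
  (\int[P]_w (k * f w)%:E = k%:E * \int[P]_w (f w)%:E)%E.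
Proof.
move=> mf f0 k0; under eq_integral do rewrite EFinM.
by apply: ge0_integralZl_EFin => //; [move=> w _; rewrite lee_fin|exact/measurable_EFinP].
Qed.

Lemma ge0_le_integral_real f g : measurable_fun setT f -> measurable_fun setT g ->
  (forall w, 0 <= f w) -> (forall w, f w <= g w) ->
  (\int[P]_w (f w)%:E <= \int[P]_w (g w)%:E)%E.
Proof.
move=> mf mg f0 fg; apply: ge0_le_integral => //.
- by move=> w _; rewrite lee_fin.
- exact/measurable_EFinP.
- exact/measurable_EFinP.
- by move=> w _; rewrite lee_fin.
Qed.

Lemma integral_cst_prob (k : R) : (\int[P]_w k%:E = k%:E)%E.
Proof. by rewrite integral_cst//= probability_setT mule1. Qed.

End NonnegIntegrals.

Section ComplexGaussian.
Context d (T : measurableType d) (R : realType) (P : probability T R).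
Local Notation C := R[i].
Variable Z : T -> C.
Hypothesis hZ : centered_complex_gaussian P Z.

Lemma measurable_Re_gaussian : measurable_fun [set: T] (fun w => complex.Re (Z w)).
Proof.
exact: (measurableT_comp (@measurable_fst _ _ _ _) hZ.1).
Qed.

Lemma measurable_Im_gaussian : measurable_fun [set: T] (fun w => complex.Im (Z w)).
Proof.
exact: (measurableT_comp (@measurable_snd _ _ _ _) hZ.1).
Qed.

Let lin (a b : R) (w : T) : R := a * complex.Re (Z w) + b * complex.Im (Z w).

Let mlin a b : measurable_fun [set: T] (lin a b).
Proof.
by apply: measurable_funD; apply: measurable_funM => //;
  [exact: measurable_Re_gaussian|exact: measurable_Im_gaussian].
Qed.

Let measurable_nc2 (a b : C) : measurable_fun [set: T] (fun w => nc (a + Z w * b) ^+ 2).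
Proof.
have -> : (fun w => nc (a + Z w * b) ^+ 2) = (fun w =>
    (complex.Re a + lin (complex.Re b) (- complex.Im b) w) ^+ 2 +
    (complex.Im a + lin (complex.Im b) (complex.Re b) w) ^+ 2).
  apply/funext => w; rewrite nc_sqr /lin; case: a b (Z w) => a1 a2 [b1 b2] [z1 z2] /=.
  by congr (_ ^+ 2 + _ ^+ 2); ring.
by apply: measurable_funD; apply: measurable_funX; apply: measurable_funD => //; exact: mlin.
Qed.

(* the positive and negative parts have the same mean, because the law of a linear
   form is symmetric *)
Let integral_lin_sym (a b : R) :
  (\int[P]_w (Num.max (lin a b w) 0)%:E = \int[P]_w (Num.max (- lin a b w) 0)%:E)%E.
Proof.
have mmax : measurable_fun setT (fun x : R => (Num.max x 0)%:E).
  by apply/measurable_EFinP; apply: measurable_maxr => //; exact: measurable_cst.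
have max0 (x : R) : (0 <= (Num.max x 0)%:E)%E by rewrite lee_fin le_max lexx orbT.
have mNlin : measurable_fun [set: T] (fun w => - lin a b w).
  by apply: measurableT_comp => //; exact: mlin.
transitivity (\int[pushforward P (lin a b)]_x (Num.max x 0)%:E)%E.
  by rewrite (ge0_integral_pushforward (mlin a b)).
transitivity (\int[pushforward P (fun w => (- lin a b w)%R)]_x
    (Num.max x 0)%:E)%E; last first.
  by rewrite (ge0_integral_pushforward mNlin).
have [s hs] := hZ.2 a b.
apply: eq_measure_integral => A mA _; rewrite /= /pushforward.
have mNA : measurable (-%R @^-1` A : set R).
  by rewrite -[X in measurable X]setTI; apply: oppr_measurable.
by rewrite hs// -centered_normal_sym// -hs.
Qed.

(** The cross term vanishes because linear forms of [Z] are symmetric. *)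
Lemma second_moment_affine (a b : C) :
  (\int[P]_w (nc (Z w) ^+ 2)%:E < +oo)%E ->
  (\int[P]_w (nc (a + Z w * b) ^+ 2)%:E =
   (nc a ^+ 2)%:E + (nc b ^+ 2)%:E * \int[P]_w (nc (Z w) ^+ 2)%:E)%E.
Proof.
move=> Zfin.
have id3 (x y z : C) : nc (x + z * y) ^+ 2 = nc x ^+ 2 + nc y ^+ 2 * nc z ^+ 2 +
    (complex.Re (2 * (x^*%C * y)) * complex.Re z - complex.Im (2 * (x^*%C * y)) * complex.Im z).
  rewrite !nc_sqr; case: x y z => a1 a2 [b1 b2] [z1 z2] /=; ring.
pose c := 2 * (a^*%C * b).
pose L := lin (complex.Re c) (- complex.Im c).
have expand w : nc (a + Z w * b) ^+ 2 + Num.max (- L w) 0 =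
    nc a ^+ 2 + nc b ^+ 2 * nc (Z w) ^+ 2 + Num.max (L w) 0.
  have -> : Num.max (L w) 0 = L w + Num.max (- L w) 0.
    by case: (leP 0 (L w)) => h; case: (leP 0 (- L w)) => h'; lra.
  by rewrite addrA; congr (_ + _); rewrite /L /lin /c mulNr id3.
have mZ2 : measurable_fun [set: T] (fun w => nc (Z w) ^+ 2).
  have := measurable_nc2 0 1; congr measurable_fun.
  by apply/funext => w; rewrite add0r mulr1.
have mL : measurable_fun [set: T] L by exact: mlin.
have mLp : measurable_fun [set: T] (fun w => Num.max (L w) 0).
  by apply: measurable_maxr => //; exact: measurable_cst.
have mLn : measurable_fun [set: T] (fun w => Num.max (- L w) 0).
  by apply: measurable_maxr; [exact: measurableT_comp|exact: measurable_cst].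
have max0 (x : R) : 0 <= Num.max x 0 by rewrite le_max lexx orbT.
have main : (\int[P]_w (nc (a + Z w * b) ^+ 2)%:E + \int[P]_w (Num.max (- L w) 0)%:E =
    (nc a ^+ 2)%:E + (nc b ^+ 2)%:E * \int[P]_w (nc (Z w) ^+ 2)%:E +
    \int[P]_w (Num.max (L w) 0)%:E)%E.
  have mc : measurable_fun [set: T] (fun=> nc a ^+ 2 : R) by exact: measurable_cst.
  have mbZ : measurable_fun [set: T] (fun w => nc b ^+ 2 * nc (Z w) ^+ 2).
    by apply: measurable_funM => //; exact: measurable_cst.
  rewrite -ge0_integralD_real//; last by move=> w; exact: sqr_ge0.
  under eq_integral do rewrite expand.
  rewrite ge0_integralD_real//; last 2 first.
  - exact: measurable_funD.
  - by move=> w; rewrite addr_ge0 ?sqr_ge0// mulr_ge0 ?sqr_ge0.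
  rewrite ge0_integralD_real//; last 2 first.
  - by move=> w; exact: sqr_ge0.
  - by move=> w; rewrite mulr_ge0 ?sqr_ge0.
  rewrite integral_cst_prob ge0_integralZl_real ?sqr_ge0// => w.
  exact: sqr_ge0.
have Lfin : (\int[P]_w (Num.max (L w) 0)%:E)%E \is a fin_num.
  rewrite ge0_fin_numE; last by apply: integral_ge0 => w _; rewrite lee_fin.
  apply: (@le_lt_trans _ _ (\int[P]_w (nc a ^+ 2 + nc b ^+ 2 * nc (Z w) ^+ 2)%:E)%E).
    apply: ge0_le_integral_real => //.
      by apply: measurable_funD => //; apply: measurable_funM => //; exact: measurable_cst.
    move=> w; rewrite ge_max; apply/andP; split; last by rewrite addr_ge0 ?sqr_ge0// mulr_ge0 ?sqr_ge0.
    have := id3 (- a) (Z w) b; rewrite mulrC [X in _ = X]/= => _.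
    have := sqr_ge0 (nc (- a + Z w * b)); rewrite id3 ncN /L /lin /c.
    have -> : 2 * ((- a)^*%C * b) = - (2 * (a^*%C * b)) by rewrite rmorphN mulNr mulrN.
    by rewrite !raddfN /=; lra.
  rewrite ge0_integralD_real//.
  - rewrite integral_cst_prob ge0_integralZl_real ?sqr_ge0//; last by move=> w; exact: sqr_ge0.
    rewrite lte_add_pinfty ?ltry// lte_mul_pinfty ?lee_fin ?sqr_ge0//.
  - by apply: measurable_funM => //; exact: measurable_cst.
  - by move=> w; exact: sqr_ge0.
  - by move=> w; rewrite mulr_ge0 ?sqr_ge0.
move: main; rewrite /L -integral_lin_sym -/L => /(congr1 (fun x => x - \int[P]_w (Num.max (L w) 0)%:E)%E).
by rewrite !addeK.
Qed.

(* a linear form with second moment at least [v / 2] is normal with variance at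
   least [v / 12] *)
Let small_interval (a b v t c : R) : 0 < v -> 0 <= t ->
  ((v / 2)%:E <= \int[P]_w (lin a b w ^+ 2)%:E)%E ->
  (P [set w | (`|lin a b w + c| <= t)%R] <= (7 * t / Num.sqrt v)%:E)%E.
Proof.
move=> v0 t0 hv; have [s hs] := hZ.2 a b.
pose l : T -> measurableTypeR R := lin a b.
have ml : measurable_fun [set: T] l by exact: mlin.
have msq : measurable_fun [set: measurableTypeR R] (fun x => (x ^+ 2)%:E).
  by apply/measurable_EFinP; exact: measurable_funX.
have lawE : (\int[P]_w (lin a b w ^+ 2)%:E = \int[pushforward P l]_x (x ^+ 2)%:E)%E.
  rewrite (ge0_integral_pushforward ml)//.
  by move=> x _; rewrite lee_fin sqr_ge0.
have v2 : 0 < v / 2 by rewrite divr_gt0.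
have s0 : s != 0.
  apply/negP => /eqP s0; move: hv; rewrite lawE.
  have -> : (\int[pushforward P l]_x (x ^+ 2)%:E = \int[\d_((0 : R)%R : measurableTypeR R)]_x (x ^+ 2)%:E)%E.
    apply: eq_measure_integral => A mA _.
    by rewrite /= /pushforward hs// /centered_normal s0 eqxx.
  rewrite integral_dirac// diracT mul1e expr0n/= lee_fin => h.
  by move: (lt_le_trans v2 h); rewrite ltxx.
have hvs : v <= 12 * s ^+ 2.
  have lawN : (\int[pushforward P l]_x (x ^+ 2)%:E =
      \int[normal_prob 0 s]_x (x ^+ 2)%:E)%E.
    apply: eq_measure_integral => A mA _.
    by rewrite /= /pushforward hs// /centered_normal (negbTE s0).
  move: hv; rewrite lawE lawN.
  move=> /le_trans /(_ (normal_second_moment s0)); rewrite lee_fin; lra.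
have -> : [set w | (`|lin a b w + c| <= t)%R] =
    lin a b @^-1` `[(- c - t)%R, (- c + t)%R].
  by apply/seteqP; split=> w /=; rewrite in_itv/= ler_norml => /andP[h1 h2];
    apply/andP; split; lra.
rewrite hs// /centered_normal (negbTE s0).
apply: le_trans (normal_interval_le _ s0 t0) _; rewrite lee_fin.
have s_gt0 : 0 < `|s| by rewrite normr_gt0.
have sv0 : 0 < Num.sqrt v by rewrite sqrtr_gt0.
rewrite ler_pdivrMr// mulrAC ler_pdivlMr// -!mulrA [X in _ <= 7 * X]mulrC.
have h : 2 * Num.sqrt v <= 7 * `|s|.
  rewrite -(@ler_pXn2r _ 2) ?nnegrE ?mulr_ge0 ?sqrtr_ge0//.
  rewrite !exprMn sqr_sqrtr ?ltW// -normrX ger0_norm ?sqr_ge0//; nra.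
rewrite mulrCA [X in _ <= X]mulrA [X in _ <= X]mulrC ler_wpM2l//.
Qed.

(** Projecting on the coordinate of larger variance reduces the estimate to the
    bound on the Gaussian density. *)
Lemma small_ball (v t : R) (c : C) : 0 < v -> 0 <= t ->
  (v%:E <= \int[P]_w (nc (Z w) ^+ 2)%:E)%E ->
  (P [set w | (nc (Z w + c) < t)%R] <= (7 * t / Num.sqrt v)%:E)%E.
Proof.
move=> v0 t0 hv.
have mevent : measurable [set w | (nc (Z w + c) < t)%R].
  have -> : [set w | (nc (Z w + c) < t)%R] = (fun w => nc (c + Z w * 1) ^+ 2) @^-1` `]-oo, (t ^+ 2)%R[.
    apply/seteqP; split=> w /=; rewrite in_itv/= mulr1 (addrC c).
      by move=> h; rewrite ltr_pXn2r ?nnegrE ?nc_ge0.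
    by rewrite ltr_pXn2r ?nnegrE ?nc_ge0.
  by rewrite -[X in measurable X]setTI; apply: measurable_nc2.
have mlin2 a b : measurable_fun setT (fun w => lin a b w ^+ 2).
  by apply: measurable_funX; exact: mlin.
have splitE : (\int[P]_w (nc (Z w) ^+ 2)%:E =
    \int[P]_w (lin 1 0 w ^+ 2)%:E + \int[P]_w (lin 0 1 w ^+ 2)%:E)%E.
  rewrite -ge0_integralD_real//; try by move=> w; exact: sqr_ge0.
  by apply: eq_integral => w _; rewrite nc_sqr /lin !mul1r !mul0r addr0 add0r.
have sub (a b : R) (c0 : R) : (forall w, `|lin a b w + c0| <= nc (Z w + c)) ->
    ((v / 2)%:E <= \int[P]_w (lin a b w ^+ 2)%:E)%E ->
    (P [set w | (nc (Z w + c) < t)%R] <= (7 * t / Num.sqrt v)%:E)%E.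
  move=> hle hv2; apply: le_trans (small_interval c0 v0 t0 hv2).
  apply: le_measure; rewrite ?inE//.
    have -> : [set w | (`|lin a b w + c0| <= t)%R] =
        (fun w => lin a b w + c0) @^-1` `[(- t)%R, t].
      by apply/seteqP; split=> w /=; rewrite in_itv/= ler_norml.
    by rewrite -[X in measurable X]setTI; apply: measurable_funD => //; exact: mlin.
  by move=> w /= h; exact: le_trans (hle w) (ltW h).
have [h|h] := leP (v / 2)%:E (\int[P]_w (lin 1 0 w ^+ 2)%:E)%E.
  apply: (sub 1 0 (complex.Re c)) => // w; apply: le_trans (abs_Re_le _).
  by rewrite /lin; case: (Z w) c {sub mevent} => x y [x' y'] /=; rewrite mul1r mul0r addr0.
apply: (sub 0 1 (complex.Im c)).
  move=> w; apply: le_trans (abs_Im_le _).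
  by rewrite /lin; case: (Z w) c {sub mevent} => x y [x' y'] /=; rewrite mul1r mul0r add0r.
rewrite leNgt; apply/negP => h2; move: hv; rewrite splitE leNgt => /negP; apply.
by rewrite (splitr v) EFinD lteD.
Qed.

End ComplexGaussian.

(** * Minors of the shift and perturbation of one entry *)

Section EntryPerturbation.
Variable A : comNzRingType.

Lemma cofactor_mxsub m n k (M : 'M[A]_(m, n)) (f : 'I_k -> 'I_m) (g : 'I_k -> 'I_n) i j :
  cofactor (mxsub f g M) i j =
  (-1) ^+ (i + j) * \det (mxsub (f \o lift i) (g \o lift j) M).
Proof.
rewrite /cofactor; congr (_ * \det _).
by apply/matrixP => a b; rewrite !mxE.
Qed.

Lemma det_add_delta n (M : 'M[A]_n) i j c :
  \det (M + c *: delta_mx i j) = \det M + c * cofactor M i j.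
Proof.
rewrite (expand_det_row _ i) [in RHS](expand_det_row _ i).
have cof k : cofactor (M + c *: delta_mx i j) i k = cofactor M i k.
  rewrite /cofactor; congr (_ * \det _); apply/matrixP => a b; rewrite !mxE.
  by rewrite [_ == i]eq_sym (negbTE (neq_lift i a)) mulr0 addr0.
under eq_bigr do rewrite cof !mxE eqxx mulrDl.
rewrite big_split/=; congr (_ + _).
rewrite (bigD1 j)//= eqxx mulr1 big1 ?addr0// => k /negbTE ->.
by rewrite mulr0 mul0r.
Qed.

End EntryPerturbation.

Section ShiftMinors.
Variable R : realType.
Local Notation C := R[i].

Lemma coef_norm2_ge0 K (p : {poly C}) : 0 <= coef_norm2 K p.
Proof. by apply: sumr_ge0 => i _; exact: sqr_ge0. Qed.

Lemma coef_norm2_sign K (p : {poly C}) k : coef_norm2 K ((-1) ^+ k * p) = coef_norm2 K p.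
Proof.
apply: eq_bigr => i _; congr (_ ^+ 2).
by rewrite -signr_odd; case: (odd k); rewrite ?expr0 ?expr1 ?mul1r// mulN1r coefN ncN.
Qed.

Lemma coef_norm2_mulX K (p : {poly C}) : coef_norm2 K ('X * p) <= coef_norm2 K p.
Proof.
rewrite /coef_norm2; case: K => [|K]; first by rewrite !big_geq.
rewrite big_nat_recl//= coefXM eqxx nc0 expr0n/= add0r [leRHS]big_nat_recr//=.
under eq_bigr do rewrite coefXM/=.
by rewrite lerDl sqr_ge0.
Qed.

(** The minors of a bidiagonal matrix are zero or products of entries: the row
    or the column that comes first has at most one nonzero entry. *)
Lemma shift_minor_norm n K k (f g : 'I_k -> 'I_n) : injective f -> injective g ->
  coef_norm2 K (\det (mxsub f g (char_poly_mx (nilpotent_shift R n)))) <= 1.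
Proof.
set B := char_poly_mx _.
have BE (x y : 'I_n) : B x y = if x == y then 'X else if (y : nat) == x.+1 then - 1 else 0.
  rewrite /B !mxE; case: eqVneq => [->|xy].
    by rewrite mulr1n ltn_eqF// polyC0 subr0.
  by rewrite mulr0n; case: eqP => _; rewrite ?polyC1 ?polyC0 ?sub0r ?subr0 ?oppr0.
elim: k f g => [|k IH] f g fI gI.
  rewrite det_mx00 /coef_norm2; case: K => [|K]; first by rewrite big_geq.
  rewrite big_nat_recl//= coef1 nc1 expr1n big1 ?addr0// => i _.
  by rewrite coef1 nc0 expr0n.
have [i0 _ hi0] := arg_minnP (fun i => f i : nat) (isT : xpredT (ord0 : 'I_k.+1)).
have [j0 _ hj0] := arg_minnP (fun j => g j : nat) (isT : xpredT (ord0 : 'I_k.+1)).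
have detE : \det (mxsub f g B) = B (f i0) (g j0) * cofactor (mxsub f g B) i0 j0.
  case: (ltnP (f i0) (g j0)) => h.
    rewrite (expand_det_row _ i0) (bigD1 j0)//= big1 ?addr0 ?mxE// => j jj0.
    rewrite mxE BE; have gj := hj0 j isT.
    case: eqP => [e|_]; first by move: gj; rewrite -e leqNgt h.
    case: eqP => [e|_]; last by rewrite mul0r.
    case/eqP: jj0; apply: gI; apply: val_inj; apply/eqP.
    by rewrite /= eqn_leq gj andbT e.
  rewrite (expand_det_col _ j0) (bigD1 i0)//= big1 ?addr0 ?mxE// => i ii0.
  rewrite mxE BE; have fi := hi0 i isT.
  case: eqP => [e|_].
    case/eqP: ii0; apply: fI; apply: val_inj; apply/eqP.
    by rewrite /= eqn_leq fi andbT e.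
  case: eqP => [e|_]; last by rewrite mul0r.
  by move: (leq_trans h fi); rewrite e ltnn.
have IHk := IH _ _ (inj_comp fI (@lift_inj _ i0)) (inj_comp gI (@lift_inj _ j0)).
rewrite detE cofactor_mxsub mulrCA coef_norm2_sign BE.
case: ifP => _; first exact: le_trans (coef_norm2_mulX _ _) IHk.
case: ifP => _; first by rewrite -[- 1]expr1 coef_norm2_sign.
by rewrite mul0r /coef_norm2 big1// => i _; rewrite coef0 nc0 expr0n.
Qed.

End ShiftMinors.

(** * Measurability and independence of the entries *)

Section ComplexMeasurability.
Context d (T : measurableType d) (R : realType).
Local Notation C := R[i].

(** Complex functions are measurable as pairs of real functions, and polynomials
    coefficient by coefficient. *)
Definition cmeasurable (f : T -> C) : Prop :=
  measurable_fun [set: T] (fun w => complex.Re (f w)) /\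
  measurable_fun [set: T] (fun w => complex.Im (f w)).

Definition pmeasurable (p : T -> {poly C}) : Prop :=
  forall m, cmeasurable (fun w => (p w)`_m).

Lemma cmeasurable_cst (c : C) : cmeasurable (fun=> c).
Proof. by split; exact: measurable_cst. Qed.

Lemma cmeasurableD f g : cmeasurable f -> cmeasurable g -> cmeasurable (fun w => f w + g w).
Proof.
move=> [f1 f2] [g1 g2]; split.
  under eq_fun do rewrite raddfD/=; exact: measurable_funD.
under eq_fun do rewrite raddfD/=; exact: measurable_funD.
Qed.

Lemma cmeasurableM f g : cmeasurable f -> cmeasurable g -> cmeasurable (fun w => f w * g w).
Proof.
move=> [f1 f2] [g1 g2]; split.
  have -> : (fun w => complex.Re (f w * g w)) = (fun w =>
      complex.Re (f w) * complex.Re (g w) - complex.Im (f w) * complex.Im (g w)).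
    by apply/funext => w; case: (f w) (g w) => a b [c e].
  by apply: measurable_funB; exact: measurable_funM.
have -> : (fun w => complex.Im (f w * g w)) = (fun w =>
    complex.Re (f w) * complex.Im (g w) + complex.Im (f w) * complex.Re (g w)).
  by apply/funext => w; case: (f w) (g w) => a b [c e].
by apply: measurable_funD; exact: measurable_funM.
Qed.

Lemma cmeasurable_sum (I : Type) (s : seq I) (F : I -> T -> C) :
  (forall i, cmeasurable (F i)) -> cmeasurable (fun w => \sum_(i <- s) F i w).
Proof.
move=> mF; elim: s => [|i s IH].
  by under eq_fun do rewrite big_nil; exact: cmeasurable_cst.
by under eq_fun do rewrite big_cons; exact: cmeasurableD.
Qed.

Lemma cmeasurable_nc2 f : cmeasurable f -> measurable_fun [set: T] (fun w => nc (f w) ^+ 2).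
Proof.
move=> [f1 f2]; under eq_fun do rewrite nc_sqr.
by apply: measurable_funD; exact: measurable_funX.
Qed.

Lemma pmeasurable_cst p : pmeasurable (fun=> p).
Proof. by move=> m; exact: cmeasurable_cst. Qed.

Lemma pmeasurableD p q : pmeasurable p -> pmeasurable q -> pmeasurable (fun w => p w + q w).
Proof.
by move=> mp mq m; under eq_fun do rewrite coefD; exact: cmeasurableD.
Qed.

Lemma pmeasurableM p q : pmeasurable p -> pmeasurable q -> pmeasurable (fun w => p w * q w).
Proof.
move=> mp mq m; under eq_fun do rewrite coefM; apply: cmeasurable_sum => i.
exact: cmeasurableM.
Qed.

Lemma pmeasurableC f : cmeasurable f -> pmeasurable (fun w => (f w)%:P).
Proof.
move=> mf m; under eq_fun do rewrite coefC.
by case: (m == 0)%N; [exact: mf|exact: cmeasurable_cst].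
Qed.

Lemma pmeasurable_coef_norm2 K p : pmeasurable p ->
  measurable_fun [set: T] (fun w => coef_norm2 K (p w)).
Proof.
move=> mp; rewrite /coef_norm2; elim: K => [|K IH].
  by under eq_fun do rewrite big_geq//; exact: measurable_cst.
under eq_fun do rewrite big_nat_recr//=.
by apply: measurable_funD => //; exact: cmeasurable_nc2.
Qed.

End ComplexMeasurability.

(** Determinants stay in any class of matrix-valued functions whose entries
    belong to a ring of functions. *)
Lemma det_closed (T : Type) (A : comNzRingType) (Q : (T -> A) -> Prop) :
  (forall c, Q (fun=> c)) ->
  (forall f g, Q f -> Q g -> Q (fun w => f w + g w)) ->
  (forall f g, Q f -> Q g -> Q (fun w => f w * g w)) ->
  forall n (M : T -> 'M[A]_n), (forall i j, Q (fun w => M w i j)) ->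
  Q (fun w => \det (M w)).
Proof.
move=> Qc QD QM n M hM; rewrite /determinant.
have Qsum (I : Type) (s : seq I) (F : I -> T -> A) :
    (forall i, Q (F i)) -> Q (fun w => \sum_(i <- s) F i w).
  move=> hF; elim: s => [|i s IH].
    rewrite (_ : (fun w => _) = fun=> 0); first exact: Qc.
    by apply/funext => w; rewrite big_nil.
  rewrite (_ : (fun w => _) = fun w => F i w + \sum_(i <- s) F i w); first exact: QD.
  by apply/funext => w; rewrite big_cons.
have Qprod (I : Type) (s : seq I) (F : I -> T -> A) :
    (forall i, Q (F i)) -> Q (fun w => \prod_(i <- s) F i w).
  move=> hF; elim: s => [|i s IH].
    rewrite (_ : (fun w => _) = fun=> 1); first exact: Qc.
    by apply/funext => w; rewrite big_nil.
  rewrite (_ : (fun w => _) = fun w => F i w * \prod_(i <- s) F i w); first exact: QM.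
  by apply/funext => w; rewrite big_cons.
by apply: Qsum => s; apply: QM => //; apply: Qprod => i.
Qed.

Section RandomMatrix.
Context d (T : measurableType d) (R : realType) (P : probability T R).
Local Notation C := R[i].
Variables (n : nat) (G : T -> 'M[C]_n).
Hypothesis hgauss : forall i j, centered_complex_gaussian P (fun w => G w i j).
Hypothesis hind : mutually_independent P
  (fun (ij : 'I_n * 'I_n) w => cpair (G w ij.1 ij.2)).

Definition entry (ij : 'I_n * 'I_n) (w : T) : R * R := cpair (G w ij.1 ij.2).

Definition of_pair (x : R * R) : C := x.1 +i* x.2.

Lemma of_pairK z : of_pair (cpair z) = z. Proof. by case: z. Qed.

Lemma measurable_entry ij : measurable_fun [set: T] (entry ij).
Proof. exact: (hgauss ij.1 ij.2).1. Qed.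

Lemma cmeasurable_entry i j : cmeasurable (fun w => G w i j).
Proof.
split; first exact: (measurableT_comp (@measurable_fst _ _ _ _) (measurable_entry (i, j))).
exact: (measurableT_comp (@measurable_snd _ _ _ _) (measurable_entry (i, j))).
Qed.

Local Notation Oth ij := (others entry ij).

Lemma cmeasurable_other_entry ij0 i j : (i, j) != ij0 ->
  @cmeasurable _ (Oth ij0) R (fun w => G w i j).
Proof.
move=> h; have m := measurable_other (X := entry) h.
split; first exact: (measurableT_comp (@measurable_fst _ _ _ _) m).
exact: (measurableT_comp (@measurable_snd _ _ _ _) m).
Qed.

Lemma cmeasurable_of_pair dT (S : measurableType dT) :
  @cmeasurable _ ((R * R) * S)%type R (fun z => of_pair z.1).
Proof.
split; first exact: (measurableT_comp (@measurable_fst _ _ _ _) (@measurable_fst _ _ _ _)).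
exact: (measurableT_comp (@measurable_snd _ _ _ _) (@measurable_fst _ _ _ _)).
Qed.

Lemma cmeasurable_snd dT (S : measurableType dT) (a : S -> C) : cmeasurable a ->
  @cmeasurable _ ((R * R) * S)%type R (fun z => a z.2).
Proof.
move=> [a1 a2]; split; first exact: (measurableT_comp a1 (@measurable_snd _ _ _ _)).
exact: (measurableT_comp a2 (@measurable_snd _ _ _ _)).
Qed.

Let cmeasurable_T ij0 (a : T -> C) : @cmeasurable _ (Oth ij0) R a -> cmeasurable a.
Proof.
have mid : measurable_fun [set: T] (id : T -> Oth ij0).
  exact: (measurable_id_others measurable_entry).
by move=> [a1 a2]; split; [exact: (measurableT_comp a1 mid)|exact: (measurableT_comp a2 mid)].
Qed.

(** Given the other entries, [a] and [b] are constants and the entry is centered, so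
    that the cross term has mean zero. *)
Lemma mean_affine_entry ij0 (a b : T -> C) (sg : R) :
  @cmeasurable _ (Oth ij0) R a -> @cmeasurable _ (Oth ij0) R b -> 0 <= sg ->
  (\int[P]_w (nc (G w ij0.1 ij0.2) ^+ 2)%:E <= sg%:E)%E ->
  (\int[P]_w (nc (a w + G w ij0.1 ij0.2 * b w) ^+ 2)%:E <=
   \int[P]_w (nc (a w) ^+ 2)%:E + sg%:E * \int[P]_w (nc (b w) ^+ 2)%:E)%E.
Proof.
move=> ma mb sg0 hsg.
pose F (z : (R * R) * Oth ij0) := ((nc (a z.2 + of_pair z.1 * b z.2)) ^+ 2)%:E.
have mF : measurable_fun setT F.
  apply/measurable_EFinP; apply: cmeasurable_nc2; apply: cmeasurableD.
    exact: cmeasurable_snd.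
  by apply: cmeasurableM; [exact: cmeasurable_of_pair|exact: cmeasurable_snd].
have F0 z : (0 <= F z)%E by rewrite lee_fin sqr_ge0.
have := decoupling measurable_entry hind mF F0.
rewrite /F /=; under eq_integral do rewrite of_pairK.
move=> ->.
have ma2 := cmeasurable_nc2 (cmeasurable_T ma).
have mb2 := cmeasurable_nc2 (cmeasurable_T mb).
rewrite -ge0_integralZl_real//; last by move=> w; exact: sqr_ge0.
rewrite -ge0_integralD_real//; first last.
- by move=> w; rewrite mulr_ge0// sqr_ge0.
- by move=> w; exact: sqr_ge0.
- by apply: measurable_funM => //; exact: measurable_cst.
apply: ge0_le_integral => //.
- by move=> w _; apply: integral_ge0 => w' _; rewrite lee_fin sqr_ge0.
- exact: (measurable_decoupled P measurable_entry mF F0).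
- apply/measurable_EFinP; apply: measurable_funD => //.
  by apply: measurable_funM => //; exact: measurable_cst.
- move=> w _; under eq_integral do rewrite of_pairK.
  rewrite second_moment_affine ?(le_lt_trans hsg) ?ltry//.
  rewrite EFinD; apply: leeD2l.
  rewrite mulrC (EFinM (nc (b w) ^+ 2) sg); apply: lee_pmul; rewrite ?lee_fin ?sqr_ge0//.
  by apply: integral_ge0 => w' _; rewrite lee_fin sqr_ge0.
Qed.

End RandomMatrix.

(** * Mean square of the characteristic polynomial *)

Lemma mxsub_delta (A : pzRingType) m n k (f : 'I_k -> 'I_m) (g : 'I_k -> 'I_n) i j (M : 'M[A]_(m, n)) c :
  injective f -> injective g ->
  mxsub f g (M + c *: delta_mx (f i) (g j)) = mxsub f g M + c *: delta_mx i j.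
Proof.
by move=> fI gI; apply/matrixP => a b; rewrite !mxE !(inj_eq fI) !(inj_eq gI).
Qed.

Lemma integral_coef_norm2 d (T : measurableType d) (R : realType) (P : probability T R)
    (K : nat) (p : T -> {poly R[i]}) : pmeasurable p ->
  (\int[P]_w (coef_norm2 K (p w))%:E =
   \sum_(0 <= m < K) \int[P]_w (nc ((p w)`_m) ^+ 2)%:E)%E.
Proof.
move=> mp; elim: K => [|K IH].
  rewrite big_geq// -[RHS](integral_cst_prob P).
  by apply: eq_integral => w _; rewrite /coef_norm2 big_geq.
rewrite big_nat_recr//= -IH -ge0_integralD_real.
- by apply: eq_integral => w _; rewrite /coef_norm2 big_nat_recr.
- exact: pmeasurable_coef_norm2.
- exact: cmeasurable_nc2.
- by move=> w; exact: coef_norm2_ge0.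
- by move=> w; exact: sqr_ge0.
Qed.

Section CharacteristicPolynomial.
Context d (T : measurableType d) (R : realType) (P : probability T R).
Local Notation C := R[i].
Variables (n : nat) (G : T -> 'M[C]_n).
Hypothesis hgauss : forall i j, centered_complex_gaussian P (fun w => G w i j).
Hypothesis hind : mutually_independent P
  (fun (ij : 'I_n * 'I_n) w => cpair (G w ij.1 ij.2)).
Local Notation J := (nilpotent_shift R n).
Local Notation Oth ij := (others (entry G) ij).

(** Interpolates, one entry at a time, between the characteristic matrices of the
    shift and of its perturbation. *)
Definition partial_char_mx (S : {set 'I_n * 'I_n}) (w : T) : 'M[{poly C}]_n :=
  char_poly_mx J + \matrix_(i, j) (if (i, j) \in S then - (G w i j)%:P else 0).

Lemma partial_char_mxT w : partial_char_mx [set: _]%SET w = char_poly_mx (J + G w).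
Proof.
apply/matrixP => i j; rewrite !mxE inE polyCD opprD addrA; congr (_ + _ - _).
Qed.

Lemma partial_char_mx_add (S : {set 'I_n * 'I_n}) i j w : (i, j) \in S ->
  partial_char_mx S w =
  partial_char_mx (S :\ (i, j)) w + (- (G w i j)%:P) *: delta_mx i j.
Proof.
move=> ijS; apply/matrixP => a b; rewrite !mxE !inE -[RHS]addrA; congr (_ + _).
have [[-> ->]|ne] := eqVneq (a, b) (i, j); first by rewrite ijS; rewrite !eqxx /= mulr1 add0r.
rewrite /=; case: andP => [[/eqP ea /eqP eb]|_]; first by rewrite ea eb eqxx in ne.
by rewrite mulr0 addr0.
Qed.

Lemma pmeasurable_partial_minor dT (S' : measurableType dT) (h : S' -> T)
    (S : {set 'I_n * 'I_n}) k
    (f g : 'I_k -> 'I_n) :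
  (forall i j, (i, j) \in S -> cmeasurable (fun w => G (h w) i j)) ->
  pmeasurable (fun w => \det (mxsub f g (partial_char_mx S (h w)))).
Proof.
move=> mG; apply: (det_closed (Q := @pmeasurable _ S' R)).
- exact: pmeasurable_cst.
- exact: pmeasurableD.
- exact: pmeasurableM.
move=> i j; under eq_fun do rewrite !mxE.
apply: pmeasurableD; first exact: pmeasurable_cst.
case h': ((f i, g j) \in S); last exact: pmeasurable_cst.
have -> : (fun w => - (G (h w) (f i) (g j))%:P) = fun w => (-1)%:P * (G (h w) (f i) (g j))%:P.
  by apply/funext => w; rewrite polyCN mulN1r.
by apply: pmeasurableM; [exact: pmeasurable_cst|apply: pmeasurableC; exact: mG].
Qed.

(** Removing one perturbed entry costs a factor [1 + sg], because the minor is
    affine in that entry, which is centered and independent of the others. *)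
Lemma mean_minor_norm (K : nat) (sg : R) : 0 <= sg ->
  (forall i j, (\int[P]_w (nc (G w i j) ^+ 2)%:E <= sg%:E)%E) ->
  forall (S : {set 'I_n * 'I_n}) k (f g : 'I_k -> 'I_n), injective f -> injective g ->
  (\int[P]_w (coef_norm2 K (\det (mxsub f g (partial_char_mx S w))))%:E <=
   ((1 + sg) ^+ #|S|)%:E)%E.
Proof.
move=> sg0 hsg S; move sE : #|S| => m; elim: m S sE => [|m IH] S sE k f g fI gI.
  rewrite expr0 -[leRHS](integral_cst_prob P); apply: ge0_le_integral => //.
  - by move=> w _; rewrite lee_fin coef_norm2_ge0.
  - apply/measurable_EFinP; apply: pmeasurable_coef_norm2.
    apply: (pmeasurable_partial_minor (h := id)) => i j _.
    exact: cmeasurable_entry.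
  - move=> w _; rewrite lee_fin; move/eqP: sE; rewrite cards_eq0 => /eqP ->.
    have -> : partial_char_mx finset.set0 w = char_poly_mx J.
      by apply/matrixP => i j; rewrite !mxE inE addr0.
    exact: shift_minor_norm.
have [[i j] ijS] : exists ij, ij \in S by apply/set0Pn; rewrite -card_gt0 sE.
have sE' : #|S :\ (i, j)| = m by move: sE; rewrite (cardsD1 (i, j)) ijS => -[].
have sgm : (1 + sg) ^+ m <= (1 + sg) ^+ m.+1.
  by rewrite exprS ler_peMl ?exprn_ge0 ?addr_ge0// lerDl.
have [/existsP[i' /eqP fi]|ni] := boolP [exists i', f i' == i]; last first.
  have e w : mxsub f g (partial_char_mx S w) = mxsub f g (partial_char_mx (S :\ (i, j)) w).
    apply/matrixP => a b; rewrite !mxE !inE (_ : (f a, g b) == (i, j) = false)//.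
    by apply/eqP => -[fa _]; case/negP: ni; apply/existsP; exists a; apply/eqP.
  under eq_integral do rewrite e.
  by apply: le_trans (IH _ sE' _ _ _ fI gI) _; rewrite lee_fin.
have [/existsP[j' /eqP gj]|nj] := boolP [exists j', g j' == j]; last first.
  have e w : mxsub f g (partial_char_mx S w) = mxsub f g (partial_char_mx (S :\ (i, j)) w).
    apply/matrixP => a b; rewrite !mxE !inE (_ : (f a, g b) == (i, j) = false)//.
    by apply/eqP => -[_ gb]; case/negP: nj; apply/existsP; exists b; apply/eqP.
  under eq_integral do rewrite e.
  by apply: le_trans (IH _ sE' _ _ _ fI gI) _; rewrite lee_fin.
case: k f g fI gI i' j' fi gj => [|k] f g fI gI i' j' fi gj; first by case: (i').
pose S' := S :\ (i, j).
pose a w := \det (mxsub f g (partial_char_mx S' w)).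
pose b w := cofactor (mxsub f g (partial_char_mx S' w)) i' j'.
have detE w : \det (mxsub f g (partial_char_mx S w)) = a w - (G w i j)%:P * b w.
  rewrite (partial_char_mx_add _ ijS) -fi -gj mxsub_delta// det_add_delta fi gj.
  by rewrite mulNr.
have inS' x y : (x, y) \in S' -> (x, y) != (i, j) by rewrite !inE => /andP[].
have ma : @pmeasurable _ (Oth (i, j)) R a.
  apply: (pmeasurable_partial_minor (h := (id : Oth (i, j) -> T))) => x y /inS' xy.
  exact: cmeasurable_other_entry.
have mb : @pmeasurable _ (Oth (i, j)) R b.
  rewrite /b; under eq_fun do rewrite cofactor_mxsub.
  apply: pmeasurableM; first exact: pmeasurable_cst.
  apply: (pmeasurable_partial_minor (h := (id : Oth (i, j) -> T))) => x y /inS' xy.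
  exact: cmeasurable_other_entry.
have maT : pmeasurable a.
  apply: (pmeasurable_partial_minor (h := id)) => x y _; exact: cmeasurable_entry.
have mbT : pmeasurable b.
  rewrite /b; under eq_fun do rewrite cofactor_mxsub.
  apply: pmeasurableM; first exact: pmeasurable_cst.
  apply: (pmeasurable_partial_minor (h := id)) => x y _; exact: cmeasurable_entry.
have mdet : pmeasurable (fun w => \det (mxsub f g (partial_char_mx S w))).
  apply: (pmeasurable_partial_minor (h := id)) => x y _; exact: cmeasurable_entry.
have step : (\int[P]_w (coef_norm2 K (\det (mxsub f g (partial_char_mx S w))))%:E <=
    \int[P]_w (coef_norm2 K (a w))%:E + sg%:E * \int[P]_w (coef_norm2 K (b w))%:E)%E.
  rewrite !integral_coef_norm2// ge0_sume_distrr; last first.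
    by move=> x _; apply: integral_ge0 => w _; rewrite lee_fin sqr_ge0.
  rewrite -big_split/=; apply: lee_sum => x _.
  have mbN : @cmeasurable _ (Oth (i, j)) R (fun w => - (b w)`_x).
    have -> : (fun w => - (b w)`_x) = fun w => (-1) * (b w)`_x.
      by apply/funext => w; rewrite mulN1r.
    by apply: cmeasurableM; [exact: cmeasurable_cst|exact: mb].
  have h := mean_affine_entry hgauss hind (ij0 := (i, j)) (ma x) mbN sg0 (hsg i j).
  rewrite (_ : \int[P]_w (nc (b w)`_x ^+ 2)%:E = \int[P]_w (nc (- (b w)`_x) ^+ 2)%:E)%E; last first.
    by apply: eq_integral => w _; rewrite ncN.
  apply: le_trans h; rewrite le_eqVlt; apply/orP; left; apply/eqP.
  by apply: eq_integral => w _; rewrite detE coefB coefCM mulrN.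
apply: le_trans step _.
have hb : (\int[P]_w (coef_norm2 K (b w))%:E <= ((1 + sg) ^+ m)%:E)%E.
  rewrite /b; under eq_integral do rewrite cofactor_mxsub coef_norm2_sign.
  by apply: IH => //; apply: inj_comp => //; exact: lift_inj.
have ha := IH _ sE' _ _ _ fI gI.
apply: le_trans (leeD ha (lee_wpmul2l _ hb)) _; first by rewrite lee_fin.
by rewrite -EFinM -EFinD lee_fin exprS mulrDl mul1r.
Qed.

End CharacteristicPolynomial.

(** * Anticoncentration of minors *)

Lemma cmeasurable_det d (T : measurableType d) (R : realType) n (M : T -> 'M[R[i]]_n) :
  (forall i j, cmeasurable (fun w => M w i j)) -> cmeasurable (fun w => \det (M w)).
Proof.
apply: (det_closed (Q := @cmeasurable _ T R)).
- exact: cmeasurable_cst.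
- exact: cmeasurableD.
- exact: cmeasurableM.
Qed.

Lemma measurable_nc_lt d (T : measurableType d) (R : realType) (f g : T -> R[i]) (t : R) :
  0 <= t -> cmeasurable f -> cmeasurable g ->
  measurable [set w | (nc (f w) < t * nc (g w))%R].
Proof.
move=> t0 mf mg.
have -> : [set w | (nc (f w) < t * nc (g w))%R] =
    (fun w => nc (f w) ^+ 2 - t ^+ 2 * nc (g w) ^+ 2) @^-1` `]-oo, 0%R[.
  apply/seteqP; split=> w /=; rewrite in_itv/= subr_lt0 -exprMn.
    by move=> h; rewrite ltr_pXn2r ?nnegrE ?mulr_ge0 ?nc_ge0.
  by rewrite ltr_pXn2r ?nnegrE ?mulr_ge0 ?nc_ge0.
rewrite -[X in measurable X]setTI; apply: measurable_funB => //.
  exact: cmeasurable_nc2.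
by apply: measurable_funM; [exact: measurable_cst|exact: cmeasurable_nc2].
Qed.

Section MinorRatio.
Context d (T : measurableType d) (R : realType) (P : probability T R).
Local Notation C := R[i].
Variables (n : nat) (G : T -> 'M[C]_n).
Hypothesis hgauss : forall i j, centered_complex_gaussian P (fun w => G w i j).
Hypothesis hind : mutually_independent P
  (fun (ij : 'I_n * 'I_n) w => cpair (G w ij.1 ij.2)).
Variable A : 'M[C]_n.
Local Notation Oth ij := (others (entry G) ij).

Lemma cmeasurable_minor k (f g : 'I_k -> 'I_n) :
  cmeasurable (fun w => \det (mxsub f g (A + G w))).
Proof.
apply: cmeasurable_det => i j; under eq_fun do rewrite !mxE.
by apply: cmeasurableD; [exact: cmeasurable_cst|exact: cmeasurable_entry].
Qed.

(** A determinant is affine in each entry, with the complementary minor as slope;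
    the other entries being frozen, it is rarely much smaller than its slope. *)
Lemma minor_ratio (v t : R) k (f g : 'I_k.+1 -> 'I_n) i' j' : 0 < v -> 0 <= t ->
  (forall i j, (v%:E <= \int[P]_w (nc (G w i j) ^+ 2)%:E)%E) ->
  injective f -> injective g ->
  (P [set w | (nc (\det (mxsub f g (A + G w))) <
      t * nc (\det (mxsub (f \o lift i') (g \o lift j') (A + G w))))%R] <=
   (7 * t / Num.sqrt v)%:E)%E.
Proof.
move=> v0 t0 hv fI gI.
pose i := f i'; pose j := g j'.
pose M0 w : 'M[C]_n := \matrix_(x, y) (A x y + if (x, y) == (i, j) then 0 else G w x y).
have M0E w : A + G w = M0 w + G w i j *: delta_mx i j.
  apply/matrixP => x y; rewrite !mxE xpair_eqE.
  by case: eqP => [->|_]; case: eqP => [->|_]; rewrite ?mulr1 ?mulr0 ?addr0.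
pose a w := \det (mxsub f g (M0 w)).
pose b w := cofactor (mxsub f g (M0 w)) i' j'.
have detE w : \det (mxsub f g (A + G w)) = a w + G w i j * b w.
  by rewrite M0E mxsub_delta// det_add_delta.
have minorE w : nc (\det (mxsub (f \o lift i') (g \o lift j') (A + G w))) = nc (b w).
  rewrite /b cofactor_mxsub ncM ncX ncN nc1 expr1n mul1r; congr (nc (\det _)).
  apply/matrixP => x y; rewrite !mxE/= xpair_eqE (inj_eq fI) eq_sym.
  by rewrite (negbTE (neq_lift i' x)).
have mM0 x y : @cmeasurable _ (Oth (i, j)) R (fun w => M0 w x y).
  under eq_fun do rewrite !mxE.
  apply: cmeasurableD; first exact: cmeasurable_cst.
  case e: ((x, y) == (i, j)); first exact: cmeasurable_cst.
  by apply: cmeasurable_other_entry; rewrite e.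
have ma : @cmeasurable _ (Oth (i, j)) R a.
  apply: (@cmeasurable_det _ (Oth (i, j))) => x y; under eq_fun do rewrite mxE.
  exact: mM0.
have mb : @cmeasurable _ (Oth (i, j)) R b.
  rewrite /b; under eq_fun do rewrite cofactor_mxsub.
  apply: cmeasurableM; first exact: cmeasurable_cst.
  apply: (@cmeasurable_det _ (Oth (i, j))) => x y; under eq_fun do rewrite mxE.
  exact: mM0.
pose E : set ((R * R) * Oth (i, j)) :=
  [set z | (nc (a z.2 + of_pair z.1 * b z.2) < t * nc (b z.2))%R].
have mE : measurable E.
  apply: (@measurable_nc_lt _ ((R * R) * Oth (i, j))%type) => //; last exact: cmeasurable_snd.
  apply: cmeasurableD; first exact: cmeasurable_snd.
  by apply: cmeasurableM; [exact: cmeasurable_of_pair|exact: cmeasurable_snd].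
pose F z := ((\1_E z : R)%:E)%E.
have mF : measurable_fun setT F by apply/measurable_EFinP; exact: measurable_indic.
have F0 z : (0 <= F z)%E by rewrite lee_fin.
set Q := [set w | _].
have mQ : measurable Q.
  by apply: measurable_nc_lt => //; exact: cmeasurable_minor.
have FE w w' : F (entry G (i, j) w', w) = (\1_[set w' | (nc (a w + G w' i j * b w) < t * nc (b w))%R] w')%:E.
  by rewrite /F !indicE /E; congr ((_ : bool)%:R%:E); apply/idP/idP => /set_mem /= h; apply/mem_set;
    move: h; rewrite /= of_pairK.
have -> : P Q = (\int[P]_w F (entry G (i, j) w, w))%E.
  rewrite -[X in P X = _]setIT -integral_indic//; apply: eq_integral => w _.
  rewrite FE !indicE; congr ((_ : bool)%:R%:E).
  by apply/idP/idP => /set_mem /= h; apply/mem_set; move: h; rewrite /Q /= detE minorE.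
rewrite (decoupling (measurable_entry hgauss) hind mF F0).
rewrite -[leRHS](integral_cst_prob P); apply: ge0_le_integral => //.
- by move=> w _; apply: integral_ge0 => w' _.
- exact: (measurable_decoupled P (measurable_entry hgauss) mF F0).
- move=> w _; under eq_integral do rewrite FE.
  rewrite integral_indic// ?setIT; last first.
    apply: (@measurable_nc_lt _ T R (fun w' => a w + G w' i j * b w) (fun=> b w)) => //.
    apply: cmeasurableD; first exact: cmeasurable_cst.
    by apply: cmeasurableM; [exact: cmeasurable_entry|exact: cmeasurable_cst].
  have [b0|b0] := eqVneq (b w) 0.
    rewrite b0 nc0 mulr0 (_ : [set _ | _] = set0) ?measure0.
      by rewrite lee_fin divr_ge0 ?sqrtr_ge0// mulr_ge0.
    by apply/seteqP; split=> // w' /=; rewrite mulr0 addr0 ltNge nc_ge0.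
  apply: le_trans (small_ball (hgauss i j) (a w / b w) v0 t0 (hv i j)).
  rewrite (_ : [set w' | _] = [set w' | (nc (G w' i j + a w / b w) < t)%R])//.
  have nb : 0 < nc (b w) by rewrite nc_gt0.
  have e w' : nc (G w' i j + a w / b w) * nc (b w) = nc (a w + G w' i j * b w).
    by rewrite -ncM mulrDl divfK// addrC.
  by apply/seteqP; split=> w' /=; rewrite -(ltr_pM2r nb (nc _) t) e.
Qed.

End MinorRatio.

(** * Measurability of symmetric functions of the roots *)

Section ComplexContinuity.
Context (V : topologicalType) (R : realType).
Local Notation C := R[i].

Definition ccontinuous (u : V -> C) : Prop :=
  continuous (fun v => complex.Re (u v)) /\ continuous (fun v => complex.Im (u v)).

Lemma ccontinuous_cst (c : C) : ccontinuous (fun=> c).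
Proof. by split; exact: cst_continuous. Qed.

Lemma ccontinuousB u1 u2 : ccontinuous u1 -> ccontinuous u2 ->
  ccontinuous (fun v => u1 v - u2 v).
Proof.
move=> [a1 b1] [a2 b2]; split.
  have -> : (fun v => complex.Re (u1 v - u2 v)) =
      (fun v => complex.Re (u1 v) - complex.Re (u2 v)).
    by apply/funext => w; case: (u1 w) (u2 w) => a b [c e].
  by move=> v; apply: cvgB; [exact: a1|exact: a2].
have -> : (fun v => complex.Im (u1 v - u2 v)) =
    (fun v => complex.Im (u1 v) - complex.Im (u2 v)).
  by apply/funext => w; case: (u1 w) (u2 w) => a b [c e].
by move=> v; apply: cvgB; [exact: b1|exact: b2].
Qed.

Lemma ccontinuousM u1 u2 : ccontinuous u1 -> ccontinuous u2 ->
  ccontinuous (fun v => u1 v * u2 v).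
Proof.
move=> [a1 b1] [a2 b2]; split.
  have -> : (fun v => complex.Re (u1 v * u2 v)) = (fun v =>
      complex.Re (u1 v) * complex.Re (u2 v) - complex.Im (u1 v) * complex.Im (u2 v)).
    by apply/funext => w; case: (u1 w) (u2 w) => a b [c e].
  by move=> v; apply: cvgB; apply: cvgM; [exact: a1|exact: a2|exact: b1|exact: b2].
have -> : (fun v => complex.Im (u1 v * u2 v)) = (fun v =>
    complex.Re (u1 v) * complex.Im (u2 v) + complex.Im (u1 v) * complex.Re (u2 v)).
  by apply/funext => w; case: (u1 w) (u2 w) => a b [c e].
by move=> v; apply: cvgD; apply: cvgM; [exact: a1|exact: b2|exact: b1|exact: a2].
Qed.

Lemma ccontinuous_prod (I : Type) (s : seq I) (F : I -> V -> C) :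
  (forall i, ccontinuous (F i)) -> ccontinuous (fun v => \prod_(i <- s) F i v).
Proof.
move=> cF; elim: s => [|i s IH].
  rewrite (_ : (fun v => _) = fun=> 1); first exact: ccontinuous_cst.
  by apply/funext => v; rewrite big_nil.
rewrite (_ : (fun v => _) = fun v => F i v * \prod_(j <- s) F j v); first exact: ccontinuousM.
by apply/funext => v; rewrite big_cons.
Qed.

Lemma continuous_l1 (u : V -> C) : ccontinuous u ->
  continuous (fun v => `|complex.Re (u v)| + `|complex.Im (u v)|).
Proof.
move=> [a b] v; apply: cvgD.
  by apply: continuous_comp; [exact: a|exact: norm_continuous].
by apply: continuous_comp; [exact: b|exact: norm_continuous].
Qed.

Lemma continuous_sum_ord N (F : 'I_N -> V -> R) : (forall k, continuous (F k)) ->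
  continuous (fun v => \sum_k F k v).
Proof.
move=> cF; elim: N F cF => [|N IH] F cF.
  rewrite (_ : (fun v => _) = fun=> 0); first exact: cst_continuous.
  by apply/funext => v; rewrite big_ord0.
rewrite (_ : (fun v => _) = fun v => \sum_k F (widen_ord (leqnSn N) k) v + F ord_max v); last first.
  by apply/funext => v; rewrite big_ord_recr.
by move=> v; apply: cvgD; [apply: IH => k; exact: cF|exact: cF].
Qed.

End ComplexContinuity.

Section RootSums.
Variable R : realType.
Local Notation C := R[i].
Variable N : nat.
Local Notation V := {ptws 'I_N -> (R * R)%type}.

Lemma continuous_point (h : R * R -> R) (k : 'I_N) : continuous h ->
  continuous (fun v : V => h (v k)).
Proof.
move=> ch v; apply: (@continuous_comp _ _ _ (fun v : V => v k) h); last exact: ch.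
exact: (@proj_continuous _ (fun=> (R * R)%type) k).
Qed.

Lemma ccontinuous_point (k : 'I_N) : ccontinuous (fun v : V => of_pair (v k)).
Proof. by split; apply: continuous_point => z; [exact: cvg_fst|exact: cvg_snd]. Qed.

(** A monic polynomial of degree [N] is determined by these [N] values. *)
Definition root_values (v : V) (j : 'I_N) : C := \prod_(k < N) (j%:R - of_pair (v k)).

Definition dist1 (x y : 'I_N -> C) : R :=
  \sum_(j < N) (`|complex.Re (x j - y j)| + `|complex.Im (x j - y j)|).

Lemma dist1_sym x y : dist1 x y = dist1 y x.
Proof.
apply: eq_bigr => j _; rewrite -opprB.
by case: (y j - x j) => a b /=; rewrite !normrN.
Qed.

Lemma dist1_triangle x y z : dist1 x z <= dist1 x y + dist1 y z.
Proof.
rewrite -big_split/=; apply: ler_sum => j _.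
have -> : x j - z j = (x j - y j) + (y j - z j) by ring.
case: (x j - y j) (y j - z j) => a b [c e] /=.
rewrite addrACA; exact: lerD (ler_normD _ _) (ler_normD _ _).
Qed.

Lemma dist1_eq0 x y : dist1 x y <= 0 -> x = y.
Proof.
move=> h; apply/funext => j; apply/eqP; rewrite -subr_eq0 -nc_eq0 eq_le nc_ge0 andbT.
apply: le_trans h; apply: le_trans (nc_le_abs _) _.
by rewrite /dist1 (bigD1 j)//= lerDl sumr_ge0// => i _; rewrite addr_ge0.
Qed.

Lemma continuous_dist1 (y : 'I_N -> C) : continuous (fun v : V => dist1 (root_values v) y).
Proof.
have c1 (j : 'I_N) : ccontinuous (fun v => root_values v j - y j).
  apply: ccontinuousB; last exact: ccontinuous_cst.
  apply: ccontinuous_prod => k; apply: ccontinuousB; first exact: ccontinuous_cst.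
  exact: ccontinuous_point.
exact: (continuous_sum_ord (fun j => continuous_l1 (c1 j))).
Qed.

(** The box makes the region compact, and every tuple of roots lies in a box with
    integer bounds. *)
Definition root_region (h : R * R -> R) (c b : R) : set V :=
  [set v | forall k, (`[- b, b]%classic `*` `[- b, b]%classic) (v k)] `&`
  [set v | c <= \sum_(k < N) h (v k)].

Lemma compact_root_region h c b : continuous h -> compact (root_region h c b).
Proof.
move=> ch; apply: compact_closedI.
  apply: (@tychonoff _ (fun=> (R * R)%type : topologicalType)
    (fun=> `[- b, b]%classic `*` `[- b, b]%classic)) => k.
  by apply: compact_setX; exact: segment_compact.
have cs : continuous (fun v : V => \sum_(k < N) h (v k)).
  apply: (@continuous_sum_ord (V : topologicalType)) => k; exact: continuous_point.
exact: ((iffLR (@continuous_closedP (V : topologicalType) R _) cs) _ (@closed_ge _ c)).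
Qed.

Variables (d : measure_display) (T : measurableType d).
Variables (p : T -> {poly C}) (s : T -> seq C) (h : R * R -> R).
Hypotheses (pE : forall w, p w = \prod_(l <- s w) ('X - l%:P))
  (size_s : forall w, size (s w) = N)
  (mp : forall z, cmeasurable (fun w => (p w).[z])) (ch : continuous h).

Let values w (j : 'I_N) : C := (p w).[j%:R].

Let root_values_s w : root_values (fun k => cpair (nth 0 (s w) k)) = values w.
Proof.
apply/funext => j; rewrite /root_values /values pE horner_prod.
rewrite (big_nth 0) size_s big_mkord; apply: eq_bigr => k _.
by rewrite of_pairK !hornerE.
Qed.

Let root_values_inj w (v : V) : root_values v = values w ->
  perm_eq (s w) [seq of_pair (v k) | k <- enum 'I_N].
Proof.
move=> e; apply: prod_XsubC_eq; rewrite -pE; apply/eqP; rewrite -subr_eq0.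
set q := \prod_(x <- _) _.
have hq j : (j < N)%N -> root (p w - q) j%:R.
  move=> jN; rewrite /root hornerD hornerN subr_eq0.
  have := congr1 (fun f => f (Ordinal jN)) e; rewrite /values /= => <-.
  rewrite /q horner_prod big_map big_enum /root_values; apply/eqP.
  by apply: eq_bigr => k _; rewrite !hornerE.
have sq : size q = N.+1 by rewrite size_prod_XsubC size_map size_enum_ord.
have szp : size (p w) = N.+1 by rewrite pE size_prod_XsubC size_s.
have sz : (size (p w - q)%R <= N)%N.
  apply/leq_sizeP => j; rewrite leq_eqVlt => /orP[/eqP <-|Nj].
    have mon1 : (p w)`_N = 1.
      have := monic_prod_XsubC (s w) predT id; rewrite -pE monicE lead_coefE szp.
      by move=> /eqP.
    have mon2 : q`_N = 1.
      have := monic_prod_XsubC [seq of_pair (v k) | k <- enum 'I_N] predT id.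
      by rewrite -/q monicE lead_coefE sq => /eqP.
    by rewrite coefB mon1 mon2 subrr.
  by rewrite coefB !nth_default ?szp ?sq// subrr.
pose rs : seq C := [seq (nat_of_ord j)%:R | j <- enum 'I_N].
have := @max_poly_roots _ (p w - q) rs.
case: eqP => // _ /(_ isT); rewrite size_map size_enum_ord.
have -> : all (root (p w - q)) rs by apply/allP => _ /mapP[j _ ->]; exact: hq.
have -> : uniq rs.
  rewrite map_inj_uniq ?enum_uniq// => i j /eqP; rewrite eqr_nat => /eqP.
  exact: val_inj.
by move=> /(_ isT isT); rewrite ltnNge sz.
Qed.

Let root_sum_s w (v : V) : root_values v = values w ->
  \sum_(l <- s w) h (cpair l) = \sum_(k < N) h (v k).
Proof.
move=> /root_values_inj pe; rewrite (perm_big _ pe)/= big_map big_enum/=.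
by apply: eq_bigr => k _; congr h; case: (v k).
Qed.

Let mdist (y : 'I_N -> C) (e : R) : measurable [set w | dist1 y (values w) < e].
Proof.
have m : measurable_fun setT (fun w => dist1 y (values w)).
  have mj (j : 'I_N) : cmeasurable (fun w => y j - values w j).
    have -> : (fun w => y j - values w j) = (fun w => y j + (- 1) * values w j).
      by apply/funext => w; rewrite mulN1r.
    apply: cmeasurableD; first exact: cmeasurable_cst.
    by apply: cmeasurableM; [exact: cmeasurable_cst|exact: mp].
  rewrite /dist1; apply: measurable_sum => j; apply: measurable_funD.
    exact: measurableT_comp (@normr_measurable _ _) (mj j).1.
  exact: measurableT_comp (@normr_measurable _ _) (mj j).2.
have -> : [set w | dist1 y (values w) < e] = (fun w => dist1 y (values w)) @^-1` `]-oo, e[.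
  by apply/seteqP; split=> w /=; rewrite in_itv.
by rewrite -[X in measurable X]setTI; exact: m.
Qed.

Let ratp (q : {ffun 'I_N -> rat * rat}) (j : 'I_N) : C :=
  of_pair (ratr (q j).1, ratr (q j).2).

Let ratp_dense (y : 'I_N -> C) (e : R) : 0 < e -> exists q, dist1 (ratp q) y < e.
Proof.
move=> e0; pose a : R := e / (2 * N.+1%:R).
have a0 : 0 < a by rewrite divr_gt0// mulr_gt0.
have near (x : R) : exists q : rat, `|ratr q - x| < a.
  have [|q] := @rat_in_itvoo R (x - a) (x + a).
    by rewrite ltrBlDr -addrA ltrDl addr_gt0.
  by rewrite in_itv/= => hq; exists q; rewrite ltr_distl.
have [q1 h1] := boolp.choice (fun j => near (complex.Re (y j))).
have [q2 h2] := boolp.choice (fun j => near (complex.Im (y j))).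
exists [ffun j => (q1 j, q2 j)].
apply: (@le_lt_trans _ _ (\sum_(j < N) (a + a))).
  apply: ler_sum => j _; rewrite /ratp ffunE/=.
  move: (h1 j) (h2 j); case: (y j) => b c /= h1j h2j.
  by apply: lerD; exact: ltW.
rewrite sumr_const card_ord -[_ *+ N]mulr_natl /a.
have N1 : 0 < N.+1%:R :> R by [].
have E (x M : R) : 0 < M -> x * (e / (2 * M) + e / (2 * M)) = e * (x / M).
  by move=> M0; field; rewrite gt_eqF.
rewrite E//.
by rewrite gtr_pMr// ltr_pdivrMr// mul1r ltr_nat.
Qed.

(** Symmetric continuous functions of the roots are measurable in the
    coefficients, although no measurable labelling of the roots is chosen: their
    superlevel sets are projections of compact sets. *)
Lemma measurable_root_sum : measurable_fun [set: T] (fun w => \sum_(l <- s w) h (cpair l)).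
Proof.
move=> _; apply: (measurability _ (RGenCInfty.measurableE R)) => //.
move=> /= _ [_ [c ->] <-]; rewrite setTI.
pose A b := root_region h c b.
(* the superlevel set consists of the [w] whose values are at distance zero from
   the compact image of some region [A m]; distances are tested on rational points *)
pose W (m p : nat) (q : {ffun 'I_N -> rat * rat}) : set T :=
  if `[< exists2 v, A m%:R v & dist1 (root_values v) (ratp q) < p.+1%:R^-1 >]
  then [set w | dist1 (ratp q) (values w) < p.+1%:R^-1] else set0.
have mW m p' q : measurable (W m p' q).
  by rewrite /W; case: ifP => // _; exact: mdist.
rewrite (_ : _ @^-1` _ = \bigcup_m \bigcap_p' \bigcup_q W m p' q).
  apply: bigcupT_measurable => m; apply: bigcapT_measurable => p'.
  by apply: countable_bigcupT_measurable => //; exact: mW.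
apply/seteqP; split=> w /=.
  rewrite in_itv/= andbT => cw.
  pose v : V := fun k => cpair (nth 0 (s w) k).
  pose b : R := \sum_(k < N) nc (nth 0 (s w) k).
  have b0 k : nc (nth 0 (s w) (k : 'I_N)) <= b.
    by rewrite /b (bigD1 k)//= lerDl sumr_ge0// => i _; exact: nc_ge0.
  have vw : root_values v = values w by exact: root_values_s.
  have Av : A (Num.truncn b).+1%:R v.
    have bm : b <= (Num.truncn b).+1%:R by apply: ltW; exact: truncnS_gt.
    split; last by rewrite /= -(root_sum_s vw).
    move=> k; have hk := le_trans (b0 k) bm.
    by split; rewrite /= in_itv/= -ler_norml;
      [exact: le_trans (abs_Re_le _) hk|exact: le_trans (abs_Im_le _) hk].
  exists (Num.truncn b).+1 => // p' _.
  have p0 : 0 < p'.+1%:R^-1 :> R by rewrite invr_gt0.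
  have [q hq] := ratp_dense (values w) p0.
  exists q => //; rewrite /W; case: asboolP => // -[].
  by exists v => //; rewrite vw dist1_sym.
move=> [m _ hw].
have cA := @compact_root_region h c m%:R ch.
have close p' : exists2 v, A m%:R v & dist1 (root_values v) (values w) < p'.+1%:R^-1 + p'.+1%:R^-1.
  have [q _] := hw p' I; rewrite /W; case: asboolP => // -[v Av vq] qw.
  by exists v => //; apply: le_lt_trans (dist1_triangle _ (ratp q) _) _; exact: ltrD.
(* by compactness the distance is attained *)
have cD : continuous (fun v : V => dist1 (root_values v) (values w)) by exact: continuous_dist1.
have [|v0 Av0 hv0] := compact_EVT_min _ cA (continuous_subspaceT cD).
  by have [v Av _] := close 0%N; exists v.
have vw : root_values v0 = values w.
  apply: dist1_eq0; rewrite leNgt; apply/negP => D0.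
  have D2 : 0 < dist1 (root_values v0) (values w) / 2 by rewrite divr_gt0.
  have [k] := ltr_add_invr D2; rewrite add0r => hk.
  have [v Av hv] := close k.
  have := hv0 v (mem_set Av); rewrite leNgt => /negP; apply.
  by apply: lt_trans hv _; rewrite [ltRHS]splitr ltrD.
rewrite in_itv/= andbT (root_sum_s vw).
by have [] := set_mem Av0.
Qed.

End RootSums.

(** * Eigenvalues and linear statistics *)

Section Eigenvalues.
Variable R : realType.
Local Notation C := R[i].

Lemma char_poly_eigenvalues n (A : 'M[C]_n) :
  char_poly A = \prod_(l <- eigenvalues A) ('X - l%:P).
Proof.
rewrite /eigenvalues; case: closed_field_poly_normal => s /= {1}->.
by rewrite (monicP (char_poly_monic A)) scale1r.
Qed.

Lemma size_eigenvalues n (A : 'M[C]_n) : size (eigenvalues A) = n.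
Proof.
have := size_char_poly A; rewrite char_poly_eigenvalues size_prod_XsubC.
by case.
Qed.

Lemma nc_det_eigenvalues n (A : 'M[C]_n) : nc (\det A) = \prod_(l <- eigenvalues A) nc l.
Proof.
have := char_poly_det A; rewrite -horner_coef0 char_poly_eigenvalues horner_prod.
move=> /(congr1 (@Normc.normc R)); rewrite ncM ncX ncN nc1 expr1n mul1r => <-.
by rewrite nc_prod; apply: eq_bigr => l _; rewrite !hornerE ncN.
Qed.

Lemma integral_empirical_measure n (A : 'M[C]_n) (f : R * R -> R) (M : R) :
  (0 < n)%N -> continuous f -> (forall z, `|f z| <= M) ->
  (\int[empirical_measure A]_z (f z)%:E =
   (n%:R^-1 * \sum_(l <- eigenvalues A) f (cpair l))%:E)%E.
Proof.
move=> n0 cf fM.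
have mf := measurable_continuous_plane cf.
have n0R : n%:R != 0 :> R by rewrite pnatr_eq0 -lt0n.
have ge0_case (g : R * R -> R) : measurable_fun setT g -> (forall z, 0 <= g z) ->
    (\int[empirical_measure A]_z (g z)%:E =
     (n%:R^-1 * \sum_(l <- eigenvalues A) g (cpair l))%:E)%E.
  move=> mg g0; have mgE : measurable_fun setT (EFin \o g) by exact/measurable_EFinP.
  rewrite /empirical_measure ge0_integral_mscale//; last by move=> z _; rewrite lee_fin.
  rewrite ge0_integral_measure_sum//; last by move=> z _; rewrite lee_fin.
  rewrite EFinM; congr (_ * _)%E.
  rewrite (big_nth 0) size_eigenvalues big_mkord -sumEFin.
  by apply: eq_bigr => k _; rewrite integral_dirac// diracT mul1e.
have M0 : 0 <= M by exact: le_trans (normr_ge0 _) (fM (0, 0)).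
have fM0 z : 0 <= f z + M.
  by have := fM z; rewrite ler_norml => /andP[]; rewrite lerNl -subr_ge0 opprK addrC.
have total : (\int[empirical_measure A]_z M%:E = M%:E)%E.
  rewrite (ge0_case (fun=> M))//.
  by rewrite big_const_seq count_predT iter_addr addr0 size_eigenvalues -[M *+ n]mulr_natl mulKf.
have mass : empirical_measure A setT = 1%E.
  have := ge0_case (fun=> 1) (measurable_cst _) (fun=> ler01).
  rewrite integral_cst// mul1e => ->.
  by rewrite big_const_seq count_predT iter_addr addr0 size_eigenvalues mulVf.
have ifin (h : R * R -> R) (B : R) : measurable_fun setT h -> (forall z, `|h z| <= B) ->
    (empirical_measure A).-integrable setT (EFin \o h).
  move=> mh hB; apply: measurable_bounded_integrable => //; first by rewrite mass ltry.
  exists B; split; first exact: num_real.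
  by move=> x Bx y _; apply: le_trans (hB y) (ltW Bx).
(* the general case follows by adding the bound [M] to [f] *)
transitivity (\int[empirical_measure A]_z ((f z + M)%:E - M%:E))%E.
  by apply: eq_integral => z _; rewrite -EFinB addrK.
rewrite integralB_EFin//.
- rewrite total ge0_case//; last exact: measurable_funD.
  rewrite -EFinB big_split/= mulrDr.
  by rewrite big_const_seq count_predT iter_addr addr0 size_eigenvalues -[M *+ n]mulr_natl mulKf// addrK.
- apply: (ifin _ (M + `|M|)); first exact: measurable_funD.
  by move=> z; apply: le_trans (ler_normD _ _) _; rewrite lerD2r.
- by apply: (ifin _ `|M|).
Qed.

Lemma measurable_eigenvalue_sum d (T : measurableType d) n (A : T -> 'M[C]_n) (f : R * R -> R) :
  continuous f -> (forall i j, cmeasurable (fun w => A w i j)) ->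
  measurable_fun [set: T] (fun w => \sum_(l <- eigenvalues (A w)) f (cpair l)).
Proof.
move=> cf mA.
have mp : pmeasurable (fun w => char_poly (A w)).
  apply: (det_closed (Q := @pmeasurable _ T R)).
  - exact: pmeasurable_cst.
  - exact: pmeasurableD.
  - exact: pmeasurableM.
  move=> i j; have -> : (fun w => char_poly_mx (A w) i j) =
      (fun w => ('X *+ (i == j)) + (-1)%:P * (A w i j)%:P).
    by apply/funext => w; rewrite !mxE polyCN mulN1r.
  apply: pmeasurableD; first exact: pmeasurable_cst.
  by apply: pmeasurableM; [exact: pmeasurable_cst|exact: pmeasurableC].
apply: (measurable_root_sum (N := n) (p := fun w => char_poly (A w))) => //.
- by move=> w; exact: char_poly_eigenvalues.
- by move=> w; exact: size_eigenvalues.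
- move=> z; have -> : (fun w => (char_poly (A w)).[z]) =
      (fun w => \sum_(i < n.+1) (char_poly (A w))`_i * z ^+ i).
    by apply/funext => w; rewrite (@horner_coef_wide _ n.+1) ?size_char_poly.
  apply: cmeasurable_sum => i; apply: cmeasurableM; last exact: cmeasurable_cst.
  exact: mp.
Qed.

End Eigenvalues.

(** * Exceptional events *)

Section Events.
Context d (T : measurableType d) (R : realType) (P : probability T R).

Lemma markov_bound (X : T -> R) (s m : R) : measurable_fun setT X ->
  (forall w, 0 <= X w) -> 0 < s -> (\int[P]_w (X w)%:E <= m%:E)%E ->
  (P [set w | (s < X w)%R] <= (m / s)%:E)%E.
Proof.
move=> mX X0 s0 Xm; set E := [set w | _].
have mE : measurable E.
  have -> : E = X @^-1` `]s, +oo[ by apply/seteqP; split=> w /=; rewrite in_itv/= andbT.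
  by rewrite -[X in measurable X]setTI; exact: mX.
rewrite mulrC EFinM lee_pdivlMl//; apply: le_trans Xm.
rewrite -[X in P X]setIT -integral_indic// -ge0_integralZl_real//; last exact: ltW.
apply: ge0_le_integral_real => //.
- by apply: measurable_funM; [exact: measurable_cst|exact: measurable_indic].
- by move=> w; rewrite mulr_ge0// ltW.
- move=> w; rewrite indicE; case: (boolP (w \in E)) => [/set_mem Ew|_].
    by rewrite mulr1 ltW.
  by rewrite mulr0.
Qed.

Lemma union_bound (I : finType) (F : I -> set T) (c : R) :
  (forall i, measurable (F i)) -> (forall i, (P (F i) <= c%:E)%E) ->
  (P (\big[setU/set0]_i F i) <= (#|I|%:R * c)%:E)%E.
Proof.
move=> mF Fc; rewrite cardE -(big_enum _ _ _ F) -/(enum I); move: (enum I) => s.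
suff [] : measurable (\big[setU/set0]_(i <- s) F i) /\
  (P (\big[setU/set0]_(i <- s) F i) <= ((size s)%:R * c)%:E)%E by [].
elim: s => [|i s [mU IH]]; first by rewrite big_nil measure0 mul0r.
rewrite big_cons; split; first exact: measurableU.
apply: le_trans (measureU2 _ _ _) _ => //.
by rewrite /= -natr1 mulrDl mul1r EFinD addeC; apply: leeD.
Qed.

Lemma le_prob_union2 (A B0 B1 : set T) (b0 b1 : R) :
  measurable A -> measurable B0 -> measurable B1 -> A `<=` B0 `|` B1 ->
  (P B0 <= b0%:E)%E -> (P B1 <= b1%:E)%E -> (P A <= (b0 + b1)%:E)%E.
Proof.
move=> mA m0 m1 sub h0 h1.
apply: (@le_trans _ _ (P (B0 `|` B1))).
  by apply: le_measure; rewrite ?inE//; exact: measurableU.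
by apply: le_trans (measureU2 _ m0 m1) _; rewrite EFinD; apply: leeD.
Qed.

Lemma le_prob_union3 (A B0 B1 B2 : set T) (b0 b1 b2 : R) :
  measurable A -> measurable B0 -> measurable B1 -> measurable B2 ->
  A `<=` B0 `|` (B1 `|` B2) ->
  (P B0 <= b0%:E)%E -> (P B1 <= b1%:E)%E -> (P B2 <= b2%:E)%E ->
  (P A <= (b0 + (b1 + b2))%:E)%E.
Proof.
move=> mA m0 m1 m2 sub h0 h1 h2; have m12 := measurableU _ _ m1 m2.
by apply: (le_prob_union2 mA m0 m12) => //; exact: (le_prob_union2 m12 m1 m2).
Qed.

End Events.

Section Deterministic.
Variable R : realType.
Local Notation C := R[i].

(** The leading minors are nonzero one after the other, from the empty one. *)
Lemma leading_minors_neq0 n (M : 'M[C]_n) (t : R) : 0 < t ->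
  (forall k : 'I_n,
    t * nc (\det (mxsub (widen_ord (ltn_ord k) \o lift ord_max)
                        (widen_ord (ltn_ord k) \o lift ord_max) M)) <=
    nc (\det (mxsub (widen_ord (ltn_ord k)) (widen_ord (ltn_ord k)) M))) ->
  \det M != 0.
Proof.
move=> t0 h.
have key k (hk : (k <= n)%N) : 0 < nc (\det (mxsub (widen_ord hk) (widen_ord hk) M)).
  elim: k hk => [|k IH] hk; first by rewrite det_mx00 nc1.
  have := h (Ordinal hk); rewrite (bool_irrelevance (ltn_ord (Ordinal hk)) hk).
  apply: lt_le_trans; rewrite mulr_gt0//=.
  rewrite (_ : mxsub _ _ _ = mxsub (widen_ord (ltnW hk)) (widen_ord (ltnW hk)) M)//.
  by apply/matrixP => i j; rewrite !mxE; congr (M _ _); apply/val_inj;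
    rewrite /= /bump leqNgt ltn_ord.
have := key n (leqnn n); rewrite (_ : mxsub _ _ _ = M) ?nc_gt0//.
by apply/matrixP => i j; rewrite !mxE; congr (M _ _); apply/val_inj.
Qed.

Lemma nc_det_cyclic_rows n (M : 'M[C]_n) : nc (\det (mxsub (@ord_pred n) id M)) = nc (\det M).
Proof.
have -> : mxsub (@ord_pred n) id M = row_perm (perm (@ord_pred_inj n)) M.
  by apply/matrixP => i j; rewrite !mxE permE.
by rewrite row_permE det_mulmx det_perm ncM ncX ncN nc1 expr1n mul1r.
Qed.

End Deterministic.

Section MatrixEvents.
Context d (T : measurableType d) (R : realType) (P : probability T R).
Local Notation C := R[i].
Variables (n : nat) (G : T -> 'M[C]_n.+1).
Hypothesis hgauss : forall i j, centered_complex_gaussian P (fun w => G w i j).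
Hypothesis hind : mutually_independent P
  (fun (ij : 'I_n.+1 * 'I_n.+1) w => cpair (G w ij.1 ij.2)).
Local Notation J := (nilpotent_shift R n.+1).
Local Notation N := (n.+1%:R : R).
Variables (v sg : R).
Hypothesis v_gt0 : 0 < v.
Hypothesis sg_ge0 : 0 <= sg.
Hypothesis hv : forall i j, (v%:E <= \int[P]_w (nc (G w i j) ^+ 2)%:E)%E.
Hypothesis hsg : forall i j, (\int[P]_w (nc (G w i j) ^+ 2)%:E <= sg%:E)%E.

Lemma measurable_hs2 : measurable_fun [set: T] (fun w => hs2 (G w)).
Proof.
apply: measurable_sum => i; apply: measurable_sum => j.
by apply: cmeasurable_nc2; exact: cmeasurable_entry.
Qed.

Lemma integral_sum_le (I : finType) (F : I -> T -> R) (c : R) :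
  (forall i, measurable_fun setT (F i)) -> (forall i w, 0 <= F i w) ->
  (forall i, (\int[P]_w (F i w)%:E <= c%:E)%E) ->
  (\int[P]_w (\sum_i F i w)%:E <= (#|I|%:R * c)%:E)%E.
Proof.
move=> mF F0 Fc; under eq_integral do rewrite -sumEFin.
rewrite ge0_integral_sum//.
- apply: le_trans (lee_sum _ (fun i _ => Fc i)) _.
  by rewrite sumEFin sumr_const mulr_natl.
- by move=> i; exact/measurable_EFinP.
- by move=> i w _; rewrite lee_fin.
Qed.

Lemma mean_hs2 : (\int[P]_w (hs2 (G w))%:E <= (N * (N * sg))%:E)%E.
Proof.
have h i : (\int[P]_w (\sum_j nc (G w i j) ^+ 2)%:E <= (N * sg)%:E)%E.
  rewrite -[X in X%:R * _](card_ord n.+1); apply: integral_sum_le => [j|j w|j].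
  - by apply: cmeasurable_nc2; exact: cmeasurable_entry.
  - exact: sqr_ge0.
  - exact: hsg.
rewrite -[X in X%:R * (_ * _)](card_ord n.+1) /hs2; apply: integral_sum_le => // [i|i w].
- by apply: measurable_sum => j; apply: cmeasurable_nc2; exact: cmeasurable_entry.
- by apply: sumr_ge0 => j _; exact: sqr_ge0.
Qed.

Lemma measurable_char_norm :
  measurable_fun [set: T] (fun w => coef_norm2 n.+2 (char_poly (J + G w))).
Proof.
have -> : (fun w => coef_norm2 n.+2 (char_poly (J + G w))) =
    fun w => coef_norm2 n.+2 (\det (mxsub id id (partial_char_mx G [set: _]%SET w))).
  by apply/funext => w; rewrite partial_char_mxT /char_poly mxsub_id.
apply: pmeasurable_coef_norm2; apply: (pmeasurable_partial_minor (h := id)) => i j _.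
exact: cmeasurable_entry.
Qed.

(** The mean of the squared norm grows only subexponentially with the dimension
    when [sg * N] tends to zero. *)
Lemma char_norm_tail (s : R) : 0 < s ->
  (P [set w | (s < coef_norm2 n.+2 (char_poly (J + G w)))%R] <=
   ((1 + sg) ^+ (n.+1 * n.+1) / s)%:E)%E.
Proof.
move=> s0; apply: markov_bound => //; first exact: measurable_char_norm.
  by move=> w; exact: coef_norm2_ge0.
have := mean_minor_norm hgauss hind n.+2 sg_ge0 hsg [set: _]%SET (@inj_id 'I_n.+1) (@inj_id 'I_n.+1).
rewrite cardsT card_prod card_ord.
rewrite (_ : (fun w => _) = fun w => (coef_norm2 n.+2 (char_poly (J + G w)))%:E)//.
by apply/funext => w; rewrite partial_char_mxT /char_poly mxsub_id.
Qed.

Lemma measurable_det_lt (s : R) : 0 <= s ->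
  measurable [set w | (nc (\det (J + G w)) < s)%R].
Proof.
move=> s0.
have -> : [set w | (nc (\det (J + G w)) < s)%R] =
    [set w | (nc (\det (J + G w)) < s * nc (1 : C))%R].
  by rewrite nc1 mulr1.
apply: (measurable_nc_lt (g := fun=> 1)) => //.
apply: cmeasurable_det => i j; under eq_fun do rewrite !mxE.
by apply: cmeasurableD; [exact: cmeasurable_cst|exact: cmeasurable_entry].
Qed.

(** When the leading minors do not collapse the determinant is nonzero; when it also
    dominates all the first minors, the inverse is polynomially bounded and
    [det_lower] applies to the matrix with its rows shifted cyclically. *)
Lemma det_tail (t H tau : R) : 0 < t <= 1 -> 0 < H -> 0 < tau ->
  (P [set w | (nc (\det (J + G w)) <
      expR (- (N * tau + (tau^-1 + 4 * ln (N * t^-1)) * (2 * H + 2))))%R] <=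
   (N * (N * sg) / H + (N * (7 * t / Num.sqrt v) + N * N * (7 * t / Num.sqrt v)))%:E)%E.
Proof.
move=> /andP[t0 t1] H0 tau0.
pose M w := J + G w.
pose ratio k (f g : 'I_k.+1 -> 'I_n.+1) i j := [set w | (nc (\det (mxsub f g (M w))) <
  t * nc (\det (mxsub (f \o lift i) (g \o lift j) (M w))))%R].
have mratio k (f g : 'I_k.+1 -> 'I_n.+1) i j : measurable (ratio k f g i j).
  by apply: measurable_nc_lt; [exact: ltW|exact: cmeasurable_minor|exact: cmeasurable_minor].
have Pratio k (f g : 'I_k.+1 -> 'I_n.+1) i j : injective f -> injective g ->
    (P (ratio k f g i j) <= (7 * t / Num.sqrt v)%:E)%E.
  by move=> fI gI; apply: minor_ratio => //; exact: ltW.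
pose wd (k : 'I_n.+1) := widen_ord (ltn_ord k).
have wdI k : injective (wd k) by move=> x y /(congr1 val)/= /val_inj.
pose R1 (k : 'I_n.+1) := ratio k (wd k) (wd k) ord_max ord_max.
pose R2 (ij : 'I_n.+1 * 'I_n.+1) := ratio n (@ord_pred n.+1) id ij.1 ij.2.
have mR0 : measurable [set w | (H < hs2 (G w))%R].
  have -> : [set w | (H < hs2 (G w))%R] = (fun w => hs2 (G w)) @^-1` `]H, +oo[.
    by apply/seteqP; split=> w /=; rewrite in_itv/= andbT.
  by rewrite -[X in measurable X]setTI; exact: measurable_hs2.
apply: (le_prob_union3 (B0 := [set w | (H < hs2 (G w))%R])
  (B1 := \big[setU/set0]_k R1 k) (B2 := \big[setU/set0]_ij R2 ij)) => //.
- by apply: measurable_det_lt; exact: expR_ge0.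
- by apply: bigsetU_measurable => k _; exact: mratio.
- by apply: bigsetU_measurable => ij _; exact: mratio.
- move=> w /= small; apply: contrapT => /not_orP[/negP nH /not_orP[n1 n2]].
  have g1 k : ~ R1 k w by move=> hk; apply: n1; rewrite -bigcup_seq; exists k => //=; rewrite mem_index_enum.
  have g2 ij : ~ R2 ij w by move=> hk; apply: n2; rewrite -bigcup_seq; exists ij => //=; rewrite mem_index_enum.
  have d0 : \det (M w) != 0.
    by apply: (leading_minors_neq0 t0) => k; rewrite leNgt; apply/negP; exact: g1.
  set B := mxsub (@ord_pred n.+1) id (M w).
  have dB : nc (\det B) = nc (\det (M w)) by exact: nc_det_cyclic_rows.
  move: small; rewrite -/(M w) -dB ltNge => /negP; apply.
  apply: det_lower => //.
  + by rewrite -nc_gt0 dB nc_gt0.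
  + by rewrite invf_ge1.
  + move=> i j; rewrite cofactor_mxsub ncM ncX ncN nc1 expr1n mul1r ler_pdivlMl//.
    by rewrite leNgt; apply/negP; exact: (g2 (i, j)).
  + apply: le_trans (hs2_shift _) _; rewrite lerD2r ler_pM2l// leNgt; exact: nH.
- by apply: markov_bound => //; [exact: measurable_hs2| |exact: mean_hs2] => w;
    apply: sumr_ge0 => i _; apply: sumr_ge0 => j _; exact: sqr_ge0.
- apply: le_trans (union_bound (c := 7 * t / Num.sqrt v) _ _) _ => [k|k|].
  + exact: mratio.
  + by apply: Pratio.
  + by rewrite card_ord.
- apply: le_trans (union_bound (c := 7 * t / Num.sqrt v) _ _) _ => [k|k|].
  + exact: mratio.
  + by apply: Pratio; [exact: ord_pred_inj|exact: inj_id].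
  + by rewrite card_prod card_ord natrM.
Qed.

End MatrixEvents.

(** * Convergence *)

Section Asymptotics.
Variable R : realType.

Lemma cvge0_eventually_small (u : nat -> \bar R) : (forall N, 0 <= u N)%E ->
  (forall dl : R, 0 < dl -> exists N0, forall N, (N0 <= N)%N -> (u N <= dl%:E)%E) ->
  u N @[N --> \oo] --> 0%E.
Proof.
move=> u0 h.
have ufin N : (u N <= 1%:E)%E -> u N \is a fin_num.
  by move=> uN; rewrite ge0_fin_numE//; apply: le_lt_trans uN (ltry _).
apply/fine_cvgP; split.
  have [N0 hN] := h 1 ltr01; exists N0 => // N /= N0N; exact/ufin/hN.
apply/cvgrPdist_le => e e0; have [N0 hN0] := h (Num.min e 1) ltac:(by rewrite lt_min e0 ltr01).
exists N0 => // N /= /hN0 uN; rewrite /= sub0r normrN ger0_norm ?fine_ge0//.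
have fN : u N \is a fin_num by apply: ufin; apply: le_trans uN _; rewrite lee_fin ge_min lexx orbT.
by rewrite -lee_fin fineK//; apply: le_trans uN _; rewrite lee_fin ge_min lexx.
Qed.

(** The bound holds as soon as the dimension exceeds [e `^ (- c^-1)]. *)
Lemma powR_neg_small (c e : R) : 0 < c -> 0 < e ->
  exists N0, forall N, (N0 <= N)%N -> N.+1%:R `^ (- c) <= e.
Proof.
move=> c0 e0; pose a := e `^ (- c^-1).
exists (Num.truncn a) => N hN.
have aN : a <= N.+1%:R.
  by apply: ltW; apply: lt_le_trans (truncnS_gt _) _; rewrite ler_nat.
have ac : a `^ c = e^-1.
  by rewrite /a -powRrM mulNr mulVf ?gt_eqF// powR_inv1// ltW.
rewrite powRN -[leRHS]invrK lef_pV2 ?posrE ?powR_gt0 ?invr_gt0// -ac.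
by apply: ge0_ler_powR; rewrite ?nnegrE ?powR_ge0// ltW.
Qed.

Lemma ln_le_powR (p x : R) : 0 < p -> 0 < x -> ln x <= p^-1 / (x `^ (- p)).
Proof.
move=> p0 x0; rewrite powRN invrK ler_pdivlMl// -ln_powR.
have := expR_ge1Dx (ln (x `^ p)); rewrite lnK ?posrE ?powR_gt0//.
by move=> /(le_trans _); apply; rewrite lerDr.
Qed.

(** Every error term is at most a constant times [u], where [u] is a small
    negative power of the dimension. *)
Lemma error_terms_small (p e0 B dl : R) : 0 < p -> 0 < e0 -> 0 <= B -> 0 < dl ->
  exists2 u0 : R, 0 < u0 & forall (n : nat) (u sg w : R) (N := n.+1%:R : R),
    0 < u <= u0 -> 0 < w -> N^-1 <= u ^+ 2 -> ln N <= p^-1 / u ->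
    - ln w <= B * ln N -> sg = N^-1 * u ^+ 4 ->
    (1 + sg) ^+ (n.+1 * n.+1) / expR (e0 * N) ^+ 2 +
      (N * (N * sg) / (N * u ^+ 2) +
        (N * (7 * (w * N ^- 3) / w) + N * N * (7 * (w * N ^- 3) / w))) <= dl /\
    N * (e0 / 2) + ((e0 / 2)^-1 + 4 * ln (N * (w * N ^- 3)^-1)) * (2 * (N * u ^+ 2) + 2)
      <= e0 * N.
Proof.
move=> p0 e00 B0 dl0.
pose K := 8 / e0 + 16 * ((4 + B) / p).
have K0 : 0 < K by rewrite addr_gt0 ?divr_gt0// mulr_gt0// divr_gt0// ltr_wpDr.
exists (Num.min (Num.min 1 e0) (Num.min (Num.min (e0 * (dl / 3)) (dl / 3 / 14)) (e0 / 2 / K))).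
  by rewrite !lt_min ltr01 e00 /= !(divr_gt0, mulr_gt0).
move=> n u sg w N /andP[u_gt0]; rewrite !le_min => /andP[/andP[u1 ue] /andP[/andP[u_1 u_2] u_3]].
move=> w0 Nu lnN lnw sgE.
have N0 : 0 < N by rewrite ltr0n.
have N1 : 1 <= N by rewrite ler1n.
have lnN0 : 0 <= ln N by rewrite ln_ge0.
have u2u : u ^+ 2 <= u by rewrite expr2 ler_piMl// ltW.
have u4u : u ^+ 4 <= u.
  by apply: le_trans u2u; rewrite ler_wiXn2l// ltW.
split.
- have t1 : (1 + sg) ^+ (n.+1 * n.+1) / expR (e0 * N) ^+ 2 <= dl / 3.
    have h : (1 + sg) ^+ (n.+1 * n.+1) <= expR (e0 * N).
      apply: (@le_trans _ _ (expR sg ^+ (n.+1 * n.+1))).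
        rewrite lerXn2r ?nnegrE ?expR_ge0 ?expR_ge1Dx//.
        by rewrite addr_ge0// sgE mulr_ge0 ?exprn_ge0 ?invr_ge0// ltW.
      rewrite -expRM_natl ler_expR natrM -/N sgE.
      rewrite (_ : N * N * (N^-1 * u ^+ 4) = u ^+ 4 * N); last by field; rewrite gt_eqF.
      by rewrite ler_pM2r// (le_trans u4u).
    apply: (@le_trans _ _ (expR (e0 * N))^-1).
      rewrite ler_pdivrMr ?exprn_gt0 ?expR_gt0// expr2 mulKf ?gt_eqF ?expR_gt0//.
    apply: (@le_trans _ _ (e0 * N)^-1).
      rewrite lef_pV2 ?posrE ?expR_gt0 ?mulr_gt0//.
      by apply: le_trans (expR_ge1Dx _); rewrite lerDr.
    rewrite invfM ler_pdivrMl//.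
    by apply: le_trans Nu _; apply: le_trans u2u _.
  have t2 : N * (N * sg) / (N * u ^+ 2) <= dl / 3.
    have -> : N * (N * sg) / (N * u ^+ 2) = u ^+ 2.
      by rewrite sgE; field; rewrite !gt_eqF.
    apply: le_trans u2u _; apply: le_trans u_2 _.
    by rewrite ler_pdivrMr// ler_peMr ?divr_ge0 ?ltW// ltr1n.
  have t3 : N * (7 * (w * N ^- 3) / w) + N * N * (7 * (w * N ^- 3) / w) <= dl / 3.
    have -> : N * (7 * (w * N ^- 3) / w) + N * N * (7 * (w * N ^- 3) / w) =
        7 * (N^-1 * N^-1 + N^-1).
      by field; rewrite !gt_eqF.
    have NN : N^-1 * N^-1 <= N^-1.
      by rewrite ler_piMl ?invr_ge0 ?(ltW N0)// invf_le1.
    have Nu' := le_trans Nu u2u.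
    rewrite ler_pdivlMr// in u_2; move: u_2 NN Nu'; set y := N^-1; clearbody y.
    by clear; move: (dl / 3) => q; lra.
  apply: le_trans (lerD t1 (lerD t2 t3)) _.
  by rewrite le_eqVlt; apply/orP; left; apply/eqP; field.
- have -> : ln (N * (w * N ^- 3)^-1) = 4 * ln N - ln w.
    have -> : N * (w * N ^- 3)^-1 = N ^+ 4 / w by field; rewrite !gt_eqF.
    by rewrite ln_div ?posrE ?exprn_gt0// lnXn// mulr_natl.
  have H4 : 2 * (N * u ^+ 2) + 2 <= 4 * u ^+ 2 * N.
    have : 1 <= u ^+ 2 * N by rewrite -ler_pdivrMr// mul1r.
    lra.
  have l1 : (e0 / 2)^-1 + 4 * (4 * ln N - ln w) <= 2 / e0 + 4 * ((4 + B) * ln N).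
    rewrite invfM invrK mulrC; lra.
  have l0 : 0 <= 2 / e0 + 4 * ((4 + B) * ln N).
    by rewrite addr_ge0 ?divr_ge0 ?(ltW e00)// !mulr_ge0// addr_ge0.
  have l2 : (2 / e0 + 4 * ((4 + B) * ln N)) * (4 * u ^+ 2) <= K * u.
    have a1 : 2 / e0 * (4 * u ^+ 2) <= 8 / e0 * u.
      rewrite mulrA (_ : 2 / e0 * 4 = 8 / e0); last by field; rewrite gt_eqF.
      by rewrite ler_wpM2l// divr_ge0// ltW.
    have a2 : ln N * u ^+ 2 <= u / p.
      move: lnN; rewrite ler_pdivlMr// => lnN.
      by rewrite expr2 mulrA (mulrC u) ler_wpM2r// ltW.
    rewrite [leLHS]mulrDl /K [leRHS]mulrDl; apply: lerD => //.
    have -> : 4 * ((4 + B) * ln N) * (4 * u ^+ 2) = 16 * (4 + B) * (ln N * u ^+ 2) by ring.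
    have -> : 16 * ((4 + B) / p) * u = 16 * (4 + B) * (u / p) by ring.
    by rewrite ler_wpM2l// mulr_ge0// addr_ge0.
  have l3 : K * u <= e0 / 2 by rewrite mulrC -ler_pdivlMr.
  apply: (@le_trans _ _ (N * (e0 / 2) + (e0 / 2) * N)); last lra.
  rewrite lerD2l; apply: le_trans (ler_wpM2r _ l1) _.
    by rewrite addr_ge0// !mulr_ge0 ?sqr_ge0// ltW.
  apply: le_trans (ler_wpM2l l0 H4) _.
  rewrite [leLHS]mulrA ler_pM2r//; exact: le_trans l2 l3.
Qed.

End Asymptotics.

Section Deviation.
Context d (T : measurableType d) (R : realType) (P : probability T R).
Local Notation C := R[i].
Variables (n : nat) (G : T -> 'M[C]_n.+1).
Hypothesis hgauss : forall i j, centered_complex_gaussian P (fun w => G w i j).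
Hypothesis hind : mutually_independent P
  (fun (ij : 'I_n.+1 * 'I_n.+1) w => cpair (G w ij.1 ij.2)).
Local Notation J := (nilpotent_shift R n.+1).
Local Notation N := (n.+1%:R : R).

(** Outside two exceptional events the characteristic polynomial satisfies the
    hypotheses of the equidistribution theorem. *)
Lemma empirical_deviation (f : R * R -> R) (M eps e0 v sg t H tau : R) :
  continuous f -> (forall z, `|f z| <= M) ->
  (forall s : seq C, size s = n.+1 ->
    coef_norm2 n.+2 (\prod_(l <- s) ('X - l%:P)) <= expR (e0 * N) ^+ 2 ->
    expR (- (e0 * N)) <= \prod_(l <- s) nc l ->
    `|\sum_(l <- s) f (cpair l) - N * circle_mean f| <= eps * N) ->
  0 < v -> 0 <= sg -> (forall i j, (v%:E <= \int[P]_w (nc (G w i j) ^+ 2)%:E)%E) ->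
  (forall i j, (\int[P]_w (nc (G w i j) ^+ 2)%:E <= sg%:E)%E) ->
  0 < t <= 1 -> 0 < H -> 0 < tau ->
  N * tau + (tau^-1 + 4 * ln (N * t^-1)) * (2 * H + 2) <= e0 * N ->
  (P [set w | (eps%:E < `| \int[empirical_measure (J + G w)]_z (f z)%:E -
      \int[uniform_circle R]_z (f z)%:E |)%E] <=
   ((1 + sg) ^+ (n.+1 * n.+1) / expR (e0 * N) ^+ 2 + (N * (N * sg) / H +
     (N * (7 * t / Num.sqrt v) + N * N * (7 * t / Num.sqrt v))))%:E)%E.
Proof.
move=> cf fM key v0 sg0 hv hsg t01 H0 tau0 small.
set m := circle_mean f.
pose dev w := N^-1 * \sum_(l <- eigenvalues (J + G w)) f (cpair l) - m.
have -> : [set w | (eps%:E < `| \int[empirical_measure (J + G w)]_z (f z)%:E -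
      \int[uniform_circle R]_z (f z)%:E |)%E] = [set w | eps < `|dev w|].
  apply/seteqP; split=> w /=;
    by rewrite (integral_empirical_measure _ _ cf fM)// (integral_uniform_circle cf fM) -EFinB abse_EFin lte_fin.
have mdev : measurable_fun setT (fun w => `|dev w|).
  apply: measurableT_comp => //; apply: measurable_funB => //.
  apply: measurable_funM => //; apply: measurable_eigenvalue_sum => // i j.
  under eq_fun do rewrite !mxE.
  by apply: cmeasurableD; [exact: cmeasurable_cst|exact: cmeasurable_entry].
have mlt (X : T -> R) c : measurable_fun setT X -> measurable [set w | c < X w].
  move=> mX; have -> : [set w | c < X w] = X @^-1` `]c, +oo[.
    by apply/seteqP; split=> w /=; rewrite in_itv/= andbT.
  by rewrite -[X in measurable X]setTI; exact: mX.
apply: (le_prob_union2 (B0 := [set w | (expR (e0 * N) ^+ 2 < coef_norm2 n.+2 (char_poly (J + G w)))%R])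
  (B1 := [set w | (nc (\det (J + G w)) <
      expR (- (N * tau + (tau^-1 + 4 * ln (N * t^-1)) * (2 * H + 2))))%R])).
- exact: mlt.
- by apply: mlt; exact: (measurable_char_norm hgauss).
- by apply: (measurable_det_lt hgauss); exact: expR_ge0.
- move=> w /= big; apply: contrapT => /not_orP[/negP n1 /negP n2].
  move: big; apply/negP; rewrite -leNgt.
  move: n1 n2; rewrite -!leNgt => n1 n2.
  have := key (eigenvalues (J + G w)) (size_eigenvalues _).
  rewrite -char_poly_eigenvalues -nc_det_eigenvalues => /(_ n1).
  move/(_ (le_trans _ n2)); rewrite ler_expR lerN2 => /(_ small) h.
  have N0 : 0 < N by rewrite ltr0n.
  rewrite -(ler_pM2r N0); apply: le_trans h.
  rewrite -[X in `|dev w| * X](gtr0_norm N0) -normrM /dev mulrBl (mulrC N^-1).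
  by rewrite divfK ?gt_eqF// (mulrC m).
- by apply: (char_norm_tail hgauss hind) => //; rewrite exprn_gt0// expR_gt0.
- exact: (det_tail hgauss hind v0 hv hsg t01 H0 tau0).
Qed.

End Deviation.

Local Close Scope classical_set_scope.

Theorem corollary6 (R : realType) (d : nat -> measure_display)
    (T : forall N : nat, measurableType (d N))
    (P : forall N : nat, probability (T N) R)
    (G : forall N : nat, T N -> 'M[R[i]]_N)
    (hG : polynomially_vanishing P G) :
  cvg_weakly_in_probability P
    (fun (N : nat) (w : T N) =>
       empirical_measure (nilpotent_shift R N + G N w))
    (uniform_circle R).
Proof.
case: hG => gauss [kp [kp' [kp0 kpkp' bounds]]].
move=> f cf [M fM] eps eps0.
have [e0 e00 [N1 equi]] := roots_equidistributed cf fM eps0.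
apply: cvge0_eventually_small => // dl dl0.
(* with [u = N `^ (- p)], the bounds [p <= kp / 4] and [p <= 1 / 2] make the variances
   at most [N^-1 * u ^+ 4] and [N^-1] at most [u ^+ 2] *)
pose p := Num.min (kp / 4) (1 / 2).
have p0 : 0 < p by rewrite lt_min !divr_gt0.
have p4 : 4 * p <= kp by rewrite mulrC -ler_pdivlMr// /p ge_min lexx.
have p2 : 2 * p <= 1 by rewrite mulrC -ler_pdivlMr// /p ge_min lexx orbT.
have kp'0 : 0 <= kp' by apply: le_trans kpkp'; rewrite addr_ge0// ltW.
have [u0 u00 errors] := error_terms_small p0 e00 (divr_ge0 kp'0 (ler0n _ 2)) dl0.
have [N2 usmall] := powR_neg_small p0 u00.
exists (maxn N1 N2).+1 => -[//|n]; rewrite ltnS geq_max => /andP[nN1 nN2].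
have N0 : 0 < n.+1%:R :> R by rewrite ltr0n.
have N1' : 1 <= n.+1%:R :> R by rewrite ler1n.
pose N := n.+1%:R : R; pose u := N `^ (- p); pose w := N `^ (- (kp' / 2)).
have u_gt0 : 0 < u by exact: powR_gt0.
have w_gt0 : 0 < w by exact: powR_gt0.
pose sg := N^-1 * u ^+ 4.
have uX k : u ^+ k = N `^ (- (k%:R * p)).
  by rewrite -powR_mulrn ?powR_ge0// -powRrM mulNr mulrC.
have Nu : N^-1 <= u ^+ 2.
  by rewrite uX -powR_inv1 ?(ltW N0)// ler_powR// lerN2.
have lnw : - ln w <= kp' / 2 * ln N by rewrite ln_powR mulNr opprK.
have [tail small] := errors n u sg w ltac:(by rewrite u_gt0 usmall)
  w_gt0 Nu (ln_le_powR p0 N0) lnw erefl.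
have sqrtw : Num.sqrt (N `^ (- kp')) = w.
  rewrite -(ger0_norm (ltW w_gt0)) -sqrtr_sqr; congr Num.sqrt.
  by rewrite -powR_mulrn ?(ltW w_gt0)// -powRrM mulNr divfK.
have sgN : N `^ (- 1 - kp) <= sg.
  rewrite /sg uX -powR_inv1 ?(ltW N0)// -powRD ?(gt_eqF N0) ?implybT//.
  by rewrite ler_powR// lerD2l lerN2.
have moment i j := bounds n.+1 i j; rewrite unlock in moment.
(* minors are allowed to shrink by [w * N ^- 3], so that each of the [N + N^2] small
   ball estimates costs a multiple of [N ^- 3] *)
have t01 : 0 < w * N ^- 3 <= 1.
  rewrite mulr_gt0 ?invr_gt0 ?exprn_gt0//= mulr_ile1 ?invr_ge0 ?exprn_ge0 ?(ltW w_gt0) ?(ltW N0)//.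
    by rewrite -(powRr0 N) ler_powR// oppr_le0 divr_ge0.
  by rewrite invf_le1 ?exprn_gt0// exprn_ege1.
apply: le_trans (empirical_deviation (gauss n.+1).1 (gauss n.+1).2 (e0 := e0)
  (v := N `^ (- kp')) (sg := sg) (t := w * N ^- 3) (H := N * u ^+ 2) (tau := e0 / 2)
  cf fM _ _ _ _ _ t01 _ _ small) _.
- by move=> s ss; have := equi s; rewrite ss; apply; exact: leqW.
- exact: powR_gt0.
- by rewrite mulr_ge0 ?invr_ge0 ?exprn_ge0// ltW.
- by move=> i j; have /andP[] := moment i j.
- move=> i j; have /andP[_ /le_trans] := moment i j; apply.
  by rewrite lee_fin.
- by rewrite mulr_gt0// exprn_gt0.
- by rewrite divr_gt0.
- by rewrite sqrtw lee_fin.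
Qed.
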